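(* Let $\vartheta_0,\tilde\vartheta_1,\vartheta_\infty\in\mathbb C$ and $$H(q,p,x,\epsilon)=-\tfrac{(\vartheta_0+\tilde\vartheta_1)^2-\vartheta_\infty^2}{4}\big((x-\epsilon)q-x\big)+x\vartheta_0p+\big(1-\epsilon-(x-\epsilon)\vartheta_0-x(\vartheta_0+\tilde\vartheta_1)\big)qp+(2x-\epsilon)(qp)^2+(x-\epsilon)(\vartheta_0+\tilde\vartheta_1)q^2p-xqp^2-(x-\epsilon)q^3p^2.$$ Then the formal invariant of the system $x(x-\epsilon)\frac{dq}{dx}=\frac{\partial H}{\partial p}$, $x(x-\epsilon)\frac{dp}{dx}=-\frac{\partial H}{\partial q}$ (with $y=(q,p)$) is $$\chi(h,x,\epsilon)=1-\epsilon-(x-\epsilon)\vartheta_0-x(\vartheta_0+\tilde\vartheta_1)+2(2x-\epsilon)h.$$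
   Context: For a system $x(x-\epsilon)\frac{dy_1}{dx}=\partial_{y_2}H$, $x(x-\epsilon)\frac{dy_2}{dx}=-\partial_{y_1}H$ with $H$ an analytic germ at $0\in\mathbb C^2\times\mathbb C^2$ such that $H(\cdot,0,0)$ has a non-degenerate critical point at $0$: for small $(x,\epsilon)$ let $G_H(h,x,\epsilon)$ be the Birkhoff–Siegel normal form of $(H(\cdot,x,\epsilon),dy_1\wedge dy_2)$ at its critical point near $0$, i.e. there are analytic coordinates $u$ with $du_1\wedge du_2=dy_1\wedge dy_2$ and $H=G_H(u_1u_2,x,\epsilon)$ ($G_H$ is unique up to $G_H(h)\mapsto G_H(-h)$). The formal invariant is the function $\chi(h,x,\epsilon)=\chi^{(0)}(h,\epsilon)+x\chi^{(1)}(h,\epsilon)$, affine in $x$, with $\chi\equiv\partial_hG_H\bmod x(x-\epsilon)$; it is defined up to the involution $\chi(h,x,\epsilon)\mapsto-\chi(-h,x,\epsilon)$. This system is obtained from the sixth Painlevé Hamiltonian system by the confluence $t=1+\epsilon\tilde t$, $x=1/\tilde t+\epsilon$. *)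

(* Defs.v *)
From mathcomp Require Import all_boot all_order all_algebra.
From mathcomp Require Import all_classical all_reals all_analysis.
From mathcomp Require Import complex.
Import Order.TTheory GRing.Theory Num.Theory.
Import numFieldNormedType.Exports.

Set Implicit Arguments.
Unset Strict Implicit.
Unset Printing Implicit Defensive.

Local Open Scope classical_set_scope.
Local Open Scope ring_scope.

(* The complex numbers, as a numFieldType (hence a normed field with the
   usual topology, limits and complex derivatives from MathComp-Analysis). *)
Definition Cx (R : realType) : numFieldType := R[i].

Section Analytic.
Variable R : realType.
Local Notation C := (Cx R).

Definition monom n (z : 'I_n -> C) (k : 'I_n -> nat) : C :=
  \prod_(i < n) z i ^+ k i.

Definition psum n (a : ('I_n -> nat) -> C) (N : nat) (z : 'I_n -> C) : C :=
  \sum_(k : {ffun 'I_n -> 'I_N}) a (fun i => nat_of_ord (k i)) *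
                                   monom z (fun i => nat_of_ord (k i)).

(* f is (the germ of) a complex-analytic function at 0 in C^n: it is given,
   on a polydisc of radius r > 0, by a power series that converges
   absolutely on the closed polydisc of radius r. *)
Definition analytic_at0 n (f : ('I_n -> C) -> C) : Prop :=
  exists (a : ('I_n -> nat) -> C) (r : R), 0 < r /\
    (exists M : R, forall N : nat,
        \sum_(k : {ffun 'I_n -> 'I_N})
           `|a (fun i => nat_of_ord (k i))| * (r%:C)%C ^+ (\sum_(i < n) nat_of_ord (k i))
        <= (M%:C)%C) /\
    (forall z : 'I_n -> C, (forall i, `|z i| < (r%:C)%C) ->
        psum a N z @[N --> \oo] --> f z).

Definition i31 : 'I_3 := @Ordinal 3 1 isT.
Definition i32 : 'I_3 := @Ordinal 3 2 isT.
Definition i41 : 'I_4 := @Ordinal 4 1 isT.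
Definition i42 : 'I_4 := @Ordinal 4 2 isT.
Definition i43 : 'I_4 := @Ordinal 4 3 isT.

Definition analytic3 (g : C -> C -> C -> C) : Prop :=
  analytic_at0 (fun z : 'I_3 -> C => g (z ord0) (z i31) (z i32)).
Definition analytic4 (g : C -> C -> C -> C -> C) : Prop :=
  analytic_at0 (fun z : 'I_4 -> C => g (z ord0) (z i41) (z i42) (z i43)).

Definition near0_3 (P : C -> C -> C -> Prop) : Prop :=
  exists r : R, 0 < r /\ forall a b c,
    `|a| < (r%:C)%C -> `|b| < (r%:C)%C -> `|c| < (r%:C)%C -> P a b c.
Definition near0_4 (P : C -> C -> C -> C -> Prop) : Prop :=
  exists r : R, 0 < r /\ forall a b c d,
    `|a| < (r%:C)%C -> `|b| < (r%:C)%C -> `|c| < (r%:C)%C -> `|d| < (r%:C)%C -> P a b c d.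

(* Birkhoff–Siegel normal form.  H = H(y1,y2,x,eps), G = G(h,x,eps).
   G is a Birkhoff–Siegel normal form of (H(.,x,eps), dy1/\dy2) at its
   critical point near 0 (for small (x,eps)) iff G is an analytic germ and
   there are analytic coordinates u = (u1,u2) (depending analytically on the
   parameters (x,eps)) with du1/\du2 = dy1/\dy2 (Jacobian determinant in
   (y1,y2) equal to 1) and H = G(u1 u2, x, eps), near 0. *)
Definition BS_normal_form (H : C -> C -> C -> C -> C) (G : C -> C -> C -> C)
  : Prop :=
  analytic3 G /\
  exists u1 u2 : C -> C -> C -> C -> C,
    analytic4 u1 /\ analytic4 u2 /\
    near0_4 (fun y1 y2 x e =>
      derive1 (fun t => u1 t y2 x e) y1 * derive1 (fun t => u2 y1 t x e) y2
      - derive1 (fun t => u1 y1 t x e) y2 * derive1 (fun t => u2 t y2 x e) y1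
        = 1
      /\ H y1 y2 x e = G (u1 y1 y2 x e * u2 y1 y2 x e) x e).

Definition dh (G : C -> C -> C -> C) : C -> C -> C -> C :=
  fun h x e => derive1 (fun t => G t x e) h.

Definition cong_mod_xxe (f g : C -> C -> C -> C) : Prop :=
  exists k : C -> C -> C -> C, analytic3 k /\
    near0_3 (fun h x e => f h x e - g h x e = x * (x - e) * k h x e).

(* chi is "the" formal invariant of H: chi = d_h G_H mod x(x-eps), up to the
   involution chi(h,x,eps) |-> - chi(-h,x,eps) (coming from G(h) |-> G(-h)). *)
Definition is_formal_invariant (H : C -> C -> C -> C -> C)
  (chi : C -> C -> C -> C) : Prop :=
  (exists G, BS_normal_form H G) /\
  forall G, BS_normal_form H G ->
    cong_mod_xxe (dh G) chi \/
    cong_mod_xxe (dh G) (fun h x e => - chi (- h) x e).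

End Analytic.

(* Main.v *)
(** Put [t = x - e], so that the two singular points are [x = 0] and [t = 0], and [H = q p + W]
    where every term of [W] is divisible by [x] or by [t]. Let [D = u1 d/du1 - u2 d/du2]; it acts
    on [u1^a u2^b] by the mode [a - b]. A Siegel-type fixed point, which preserves a ball for a
    weighted l1 norm, produces an area preserving map [q = u1 + xi], [p = u2 + pi] and a series [g]
    in [u1 u2, x, t] with [g D q = H_p] and [g D p = - H_q]. Then [D] kills [H(q, p)], so that
    [H(q, p) = G(u1 u2)] is a normal form, and [g] is the derivative of [G].

    At [x = 0] all modes of the perturbation lie on one side of the linear part, and at [t = 0] on
    the other side. Hence products of non-resonant terms are never resonant there, and [g] agrees
    on both hypersurfaces, that is modulo [x t], with the resonant part [chi] of first order.

    If [H = Gamma(w1 w2)] is any normal form, substituting [(q, p)] turns [w1] and [w2] into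
    eigenvectors of [g D] for the eigenvalues [k] and [- k], where [k = Gamma'(w1 w2)]. Comparing
    linear parts, [k = g] or [k = - g], and [w1 w2] becomes [u1 u2] or [- u1 u2] accordingly. *)
From HB Require Import structures.
Require Import Defs.
From mathcomp Require Import all_boot all_order all_algebra.
From mathcomp Require Import all_classical all_reals all_analysis.
From mathcomp Require Import complex.
From mathcomp Require Import -(notations) mpoly.
From mathcomp Require Import zify ring lra.
Set Implicit Arguments.
Unset Strict Implicit.
Unset Printing Implicit Defensive.
Import Order.TTheory GRing.Theory Num.Theory.
Import numFieldNormedType.Exports.
Local Open Scope ring_scope.
Local Notation mU := (@mnm1 _).

(** * Formal power series *)

(** No small divisors occur: with one degree of freedom the modes [a - b] are integers, so the
    inverses of [D - 1] and [D + 1] away from their kernels have norm at most 1, and no domain is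
    lost in the iteration. [D] itself is unbounded, hence every equation is rewritten so that only
    bounded operators appear. Smallness comes from [x] and [t] alone: the polydisc in [u1], [u2]
    keeps radius 1, and only the radius in [x], [t] shrinks. Fixed points are limits coefficient by
    coefficient; bounds on partial sums survive such limits, which takes the place of completeness.
    The equation for [p] is first solved up to a term of mode -1, and conservation of energy shows
    that this term is zero. The algebra takes place on formal series; [hs] ties a series to a germ,
    and uniqueness of the expansion transfers identities both ways. The statement quantifies over
    all normal forms, whose coordinates are not asked to vanish at the origin; that the product
    [u1 u2] vanishes there is a separate argument, [action_vanishes]. *)

Record fps (K : comNzRingType) (n : nat) := Fps { cf : multinom n -> K }.

Section Fps.
Variables (K : comNzRingType) (n : nat).
Implicit Types (f g h : fps K n) (m : multinom n) (N : nat).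

HB.instance Definition _ := gen_eqMixin (fps K n).
HB.instance Definition _ := gen_choiceMixin (fps K n).

Lemma fpsP f g : (forall m, cf f m = cf g m) -> f = g.
Proof. by case: f g => [a] [b] /= ab; congr Fps; apply/funext. Qed.

(** A coefficient of degree [d] of a product only sees the truncations of the factors below degree
    [d + 1]; through these, ring laws and the Leibniz rule are inherited from polynomials. *)
Definition ftrunc N f : mpoly n K :=
  \sum_(m : bmultinom n N) cf f m *: mpolyX K m.

Lemma mcoeff_trunc N f m :
  mcoeff m (ftrunc N f) = if (mdeg m < N)%N then cf f m else 0.
Proof.
rewrite /ftrunc raddf_sum /=; case: ifPn => [lt|nlt].
  rewrite (bigD1 (BMultinom lt)) //= mcoeffZ mcoeffX eqxx mulr1 big1 ?addr0 //.
  move=> i /negP ne; rewrite mcoeffZ mcoeffX; case: eqP => [e|]; last by rewrite mulr0.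
  by case: ne; apply/eqP/val_inj.
apply: big1 => -[i lti] _ /=; rewrite mcoeffZ mcoeffX; case: eqP => [e|]; last by rewrite mulr0.
by rewrite -e lti in nlt.
Qed.

Definition fps0 := Fps (fun _ : multinom n => 0 : K).
Definition fps_add f g := Fps (fun m => cf f m + cf g m).
Definition fps_opp f := Fps (fun m => - cf f m).
Definition fps_const (c : K) := Fps (fun m : multinom n => if m == mnm0 then c else 0).
(* Locked, as the unifier would otherwise unfold products of series. *)
Fact fps_mul_key : unit. Proof. exact: tt. Qed.
Definition fps_mul := locked_with fps_mul_key (fun f g =>
  Fps (fun m => mcoeff m (ftrunc (mdeg m).+1 f * ftrunc (mdeg m).+1 g))).

Lemma cf_mulE f g m :
  cf (fps_mul f g) m = mcoeff m (ftrunc (mdeg m).+1 f * ftrunc (mdeg m).+1 g).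
Proof. by rewrite /fps_mul unlock. Qed.

Fact fps_addA : associative fps_add.
Proof. by move=> f g h; apply: fpsP => m /=; rewrite addrA. Qed.
Fact fps_addC : commutative fps_add.
Proof. by move=> f g; apply: fpsP => m /=; rewrite addrC. Qed.
Fact fps_add0 : left_id fps0 fps_add.
Proof. by move=> f; apply: fpsP => m /=; rewrite add0r. Qed.
Fact fps_addN : left_inverse fps0 fps_opp fps_add.
Proof. by move=> f; apply: fpsP => m /=; rewrite addNr. Qed.
HB.instance Definition _ :=
  GRing.isZmodule.Build (fps K n) fps_addA fps_addC fps_add0 fps_addN.

Lemma mcoeffM_eq (p p' q q' : mpoly n K) m :
  (forall k, (mdeg k <= mdeg m)%N -> mcoeff k p = mcoeff k p') ->
  (forall k, (mdeg k <= mdeg m)%N -> mcoeff k q = mcoeff k q') ->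
  mcoeff m (p * q) = mcoeff m (p' * q').
Proof.
move=> ep eq; rewrite !mcoeffM; apply: eq_bigr => -[[i lti] [j ltj]] /= _.
by rewrite ep ?eq.
Qed.

Lemma cfM_trunc N f g m : (mdeg m < N)%N ->
  cf (fps_mul f g) m = mcoeff m (ftrunc N f * ftrunc N g).
Proof.
move=> lt; rewrite cf_mulE; apply: mcoeffM_eq => k le;
  by rewrite !mcoeff_trunc ltnS le (leq_ltn_trans le lt).
Qed.

Lemma mcoeff_trunc_mul N f g m : (mdeg m < N)%N ->
  mcoeff m (ftrunc N (fps_mul f g)) = mcoeff m (ftrunc N f * ftrunc N g).
Proof. by move=> lt; rewrite mcoeff_trunc lt (cfM_trunc _ _ lt). Qed.

Fact fps_mulA : associative fps_mul.
Proof.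
move=> f g h; apply: fpsP => m; rewrite !(@cfM_trunc (mdeg m).+1) //.
rewrite (@mcoeffM_eq _ (ftrunc (mdeg m).+1 f) _
   (ftrunc (mdeg m).+1 g * ftrunc (mdeg m).+1 h)) //; last first.
  by move=> k le; apply: mcoeff_trunc_mul.
rewrite mulrA; apply: mcoeffM_eq => // k le.
by rewrite mcoeff_trunc_mul.
Qed.
Fact fps_mulC : commutative fps_mul.
Proof. by move=> f g; apply: fpsP => m; rewrite !cf_mulE mulrC. Qed.

Lemma trunc_const N c : ftrunc N.+1 (fps_const c) = mpolyC n c.
Proof.
apply/mpolyP => m; rewrite mcoeff_trunc mcoeffC /=.
case: eqVneq => [->|_]; first by rewrite mdeg0 mulr1.
by rewrite mulr0 if_same.
Qed.

Lemma ftruncD N f g : ftrunc N (f + g) = ftrunc N f + ftrunc N g.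
Proof.
apply/mpolyP => m; rewrite mcoeffD !mcoeff_trunc.
by case: ifP => // _; rewrite addr0.
Qed.

Fact fps_mul1 : left_id (fps_const 1) fps_mul.
Proof.
move=> f; apply: fpsP => m; rewrite cf_mulE trunc_const mul1r mcoeff_trunc.
by rewrite ltnSn.
Qed.
Fact fps_mulDl : left_distributive fps_mul +%R.
Proof.
by move=> f g h; apply: fpsP => m; rewrite /= !cf_mulE ftruncD mulrDl mcoeffD.
Qed.
Fact fps_1neq0 : fps_const 1 != 0.
Proof.
apply/eqP => /(congr1 (fun f => cf f mnm0)) /=; rewrite eqxx => /eqP.
by rewrite oner_eq0.
Qed.
HB.instance Definition _ := GRing.Zmodule_isComNzRing.Build (fps K n)
  fps_mulA fps_mulC fps_mul1 fps_mulDl fps_1neq0.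

Lemma cfD f g m : cf (f + g) m = cf f m + cf g m. Proof. by []. Qed.
Lemma cfN f m : cf (- f) m = - cf f m. Proof. by []. Qed.
Lemma cfB f g m : cf (f - g) m = cf f m - cf g m. Proof. by []. Qed.
Lemma cf0 m : cf (0 : fps K n) m = 0. Proof. by []. Qed.
Lemma cf1 m : cf (1 : fps K n) m = (m == mnm0)%:R.
Proof. by rewrite /=; case: eqP. Qed.
Lemma cf_sum (I : Type) (r : seq I) (P : pred I) (F : I -> fps K n) m :
  cf (\sum_(i <- r | P i) F i) m = \sum_(i <- r | P i) cf (F i) m.
Proof. by elim/big_rec2: _ => // i x y _ <-. Qed.

Lemma cfM N f g m : (mdeg m < N)%N ->
  cf (f * g) m = \sum_(k : bmultinom n N * bmultinom n N |
                       m == mnm_add k.1 k.2) cf f k.1 * cf g k.2.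
Proof.
move=> lt; rewrite (cfM_trunc _ _ lt) -[_ * _]/(mpoly_mul _ _).
rewrite (mcoeff_poly_mul _ _ lt).
by apply: eq_bigr => -[[i lti] [j ltj]] /= _; rewrite !mcoeff_trunc lti ltj.
Qed.

Fact fps_const_nmod : nmod_morphism fps_const.
Proof.
split=> [|x y]; apply: fpsP => m /=; first by rewrite if_same.
by case: ifP; rewrite ?addr0.
Qed.
HB.instance Definition _ := GRing.isNmodMorphism.Build K (fps K n) fps_const fps_const_nmod.
Fact fps_const_monoid : monoid_morphism fps_const.
Proof.
split=> // x y; apply: fpsP => m.
rewrite [RHS](@cfM_trunc (mdeg m).+1) // !trunc_const -mpolyCM mcoeffC /=.
by case: eqP; rewrite ?mulr1 ?mulr0.
Qed.
HB.instance Definition _ :=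
  GRing.isMonoidMorphism.Build K (fps K n) fps_const fps_const_monoid.

Lemma cf_constM c f m : cf (fps_const c * f) m = c * cf f m.
Proof.
rewrite -[_ * f]/(fps_mul _ _) cf_mulE trunc_const mul_mpolyC mcoeffZ mcoeff_trunc.
by rewrite ltnSn.
Qed.

Definition mon m0 := Fps (fun m => (m == m0)%:R : K).
Definition fX (i : 'I_n) := mon (mU i).

Lemma trunc_mon N m0 : (mdeg m0 < N)%N -> ftrunc N (mon m0) = mpolyX K m0.
Proof.
move=> lt; apply/mpolyP => m; rewrite mcoeff_trunc mcoeffX /= eq_sym.
by case: (eqVneq m0 m) => [<-|_]; rewrite ?lt // if_same.
Qed.

Lemma monD m1 m2 : mon (mnm_add m1 m2) = mon m1 * mon m2.
Proof.
apply: fpsP => m; pose N := (mdeg m + mdeg m1 + mdeg m2).+1.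
have lt : (mdeg m < N)%N by rewrite /N; lia.
rewrite [RHS](cfM_trunc _ _ lt) !trunc_mon ?/N; try lia.
by rewrite -mpolyXD mcoeffX eq_sym.
Qed.

Lemma mon0 : mon mnm0 = 1.
Proof. by apply: fpsP => m; rewrite cf1. Qed.

Lemma cf_monM m0 f m : cf (mon m0 * f) (mnm_add m0 m) = cf f m.
Proof.
rewrite (@cfM (mdeg (mnm_add m0 m)).+1) //.
have l0 : (mdeg m0 < (mdeg (mnm_add m0 m)).+1)%N by rewrite mdegD ltnS leq_addr.
have l1 : (mdeg m < (mdeg (mnm_add m0 m)).+1)%N by rewrite mdegD ltnS leq_addl.
rewrite (bigD1 (BMultinom l0, BMultinom l1)) //= eqxx mul1r big1 ?addr0 //.
case=> [[i li] [j lj]] /= /andP[/eqP e ne].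
case: (eqVneq i m0) => [ei|]; last by rewrite mul0r.
case/negP: ne; rewrite -pair_eqE /= /eq_op /= -!val_eqE /=.
by move: e; rewrite ei => /addmI ->; rewrite !eqxx.
Qed.

Lemma cf_monM0 m0 f m : ~~ lem m0 m -> cf (mon m0 * f) m = 0.
Proof.
move=> nle; rewrite (@cfM (mdeg m).+1) // big1 // => -[[i li] [j lj]] /= /eqP e.
case: eqVneq => [ei|]; last by rewrite mul0r.
by rewrite e ei lem_addr in nle.
Qed.

Lemma monM_inj m0 : injective (fun f => mon m0 * f).
Proof.
by move=> f g e; apply: fpsP => m; rewrite -(cf_monM m0 f) e cf_monM.
Qed.

(** Divisibility, order of vanishing and modes of a series are all recorded as a set containing its
    support; under products such sets add up. *)
Definition spt (S : multinom n -> Prop) f := forall m, cf f m <> 0 -> S m.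

Lemma sptP (S : multinom n -> Prop) f : spt S f <-> (forall m, ~ S m -> cf f m = 0).
Proof.
split=> h m; first by move=> nS; apply: contrapT => /h.
by move=> nz; apply: contrapT => /h.
Qed.
Lemma spt0 S : spt S 0.
Proof. by move=> m; rewrite cf0. Qed.
Lemma sptD S f g : spt S f -> spt S g -> spt S (f + g).
Proof.
move=> /sptP hf /sptP hg; apply/sptP => m nS.
by rewrite cfD hf // hg // addr0.
Qed.
Lemma sptN S f : spt S f -> spt S (- f).
Proof. by move=> /sptP hf; apply/sptP => m nS; rewrite cfN hf // oppr0. Qed.
Lemma sptB S f g : spt S f -> spt S g -> spt S (f - g).
Proof. by move=> hf hg; apply: sptD => //; apply: sptN. Qed.
Lemma sptM S1 S2 (S : multinom n -> Prop) f g : spt S1 f -> spt S2 g ->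
  (forall m1 m2, S1 m1 -> S2 m2 -> S (mnm_add m1 m2)) -> spt S (f * g).
Proof.
move=> /sptP hf /sptP hg h; apply/sptP => m nS; rewrite (@cfM (mdeg m).+1) //.
apply: big1 => -[i j] /= /eqP e.
have [s1|n1] := pselect (S1 i); last by rewrite hf // mul0r.
have [s2|n2] := pselect (S2 j); last by rewrite hg // mulr0.
by case: nS; rewrite e; apply: h.
Qed.
Lemma spt_weak S1 (S : multinom n -> Prop) f :
  spt S1 f -> (forall m, S1 m -> S m) -> spt S f.
Proof. by move=> hf h m /hf /h. Qed.
Lemma spt_mon (S : multinom n -> Prop) m0 : S m0 -> spt S (mon m0).
Proof. by move=> s m /=; case: eqP => [->|]. Qed.
Lemma spt_const (S : multinom n -> Prop) c : S mnm0 -> spt S (fps_const c).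
Proof. by move=> s m /=; case: eqP => [->|]. Qed.

Definition eqt N f g := forall m, (mdeg m < N)%N -> cf f m = cf g m.
Lemma eqt_trans N f g h : eqt N f g -> eqt N g h -> eqt N f h.
Proof. by move=> a b m lt; rewrite a // b. Qed.
Lemma eqt_sym N f g : eqt N f g -> eqt N g f.
Proof. by move=> a m lt; rewrite a. Qed.
Lemma eqt_refl N f : eqt N f f. Proof. by []. Qed.
Lemma eqt_eq f g : (forall N, eqt N f g) -> f = g.
Proof. by move=> h; apply: fpsP => m; apply: (h (mdeg m).+1). Qed.
Lemma eqtM N f g f' g' : eqt N f f' -> eqt N g g' -> eqt N (f * g) (f' * g').
Proof.
move=> a b m lt; rewrite !(@cfM (mdeg m).+1) //.
apply: eq_bigr => -[[i li] [j lj]] /= _.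
by rewrite a ?b //; apply: leq_ltn_trans lt; rewrite -ltnS.
Qed.
Lemma eqt_sub N f g : eqt N f g <-> spt (fun m => (N <= mdeg m)%N) (f - g).
Proof.
split=> h m; first by move=> nz; rewrite leqNgt; apply/negP => /h e; rewrite cfB e subrr in nz.
move=> lt; apply/eqP; rewrite -subr_eq0; apply/eqP; move: m lt.
by move/sptP: h => h m lt; rewrite -cfB h //; apply/negP; rewrite -ltnNge.
Qed.

(** Induction on the degree: the coefficient of [f * g] at [m] is [cf f mnm0 * cf g m] plus terms
    with coefficients of [g] of lower degree. *)
Lemma fps_cancel f g : (exists c, c * cf f mnm0 = 1) -> f * g = 0 -> g = 0.
Proof.
move=> [c c1] fg; apply: fpsP => m; have [d le] := ubnP (mdeg m).
elim: d m le => // d IH m le.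
have := congr1 (fun u => cf u m) fg; rewrite (@cfM (mdeg m).+1) // cf0.
have l0 : (mdeg (@mnm0 n) < (mdeg m).+1)%N by rewrite mdeg0.
rewrite (bigD1 (BMultinom l0, BMultinom (ltnSn (mdeg m)))) /= ?add0m //.
rewrite big1 ?addr0 => [e|]; first by rewrite -[LHS]mul1r -c1 -mulrA e mulr0.
case=> [[i li] [j lj]] /= /andP[/eqP e ne].
case: (eqVneq i mnm0) => [ei|ni].
  case/negP: ne; rewrite -pair_eqE /= /eq_op /= -!val_eqE /=.
  by rewrite e ei add0m !eqxx.
rewrite (IH j) ?mulr0 //; apply: leq_trans (_ : (mdeg m <= d)%N); last by rewrite -ltnS.
by rewrite e mdegD -[X in (X < _)%N]add0n ltn_add2r lt0n mdeg_eq0.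
Qed.

End Fps.

Section Der.
Variables (K : comNzRingType) (n : nat).
Implicit Types (f g h : fps K n) (m : multinom n) (N : nat).

Definition fder (i : 'I_n) f := Fps (fun m => cf f (mnm_add m (mU i)) *+ (m i).+1).

Lemma mcoeff_mderiv_trunc N i f m : (mdeg m < N)%N ->
  mcoeff m (mderiv i (ftrunc N.+1 f)) = cf (fder i f) m.
Proof. by move=> lt; rewrite mcoeff_mderiv mcoeff_trunc mdegD mdeg1 addn1 ltnS lt. Qed.

Lemma fderD i f g : fder i (f + g) = fder i f + fder i g.
Proof. by apply: fpsP => m; rewrite /= mulrnDl. Qed.
Lemma fderN i f : fder i (- f) = - fder i f.
Proof. by apply: fpsP => m; rewrite /= mulNrn. Qed.
Lemma fderB i f g : fder i (f - g) = fder i f - fder i g.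
Proof. by rewrite fderD fderN. Qed.
Lemma fderC i c : fder i (fps_const n c) = 0.
Proof. by apply: fpsP => m; rewrite /= mnmD_eq0 mnm1_eq0 andbF mul0rn. Qed.
Lemma fder1 i : fder i (1 : fps K n) = 0.
Proof. exact: fderC. Qed.
Lemma fderM i f g : fder i (f * g) = fder i f * g + f * fder i g.
Proof.
apply: fpsP => m; rewrite cfD.
set N := (mdeg m).+1; have lt : (mdeg m < N)%N by [].
rewrite -(mcoeff_mderiv_trunc _ _ lt).
(* One more degree is kept than in the claim, since a derivative lowers the degree by one. *)
transitivity (mcoeff m (mderiv i (ftrunc N.+1 f * ftrunc N.+1 g))).
  rewrite !mcoeff_mderiv; congr (_ *+ _); apply: mcoeff_trunc_mul.
  by rewrite mdegD mdeg1 addn1.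
rewrite mderivM mcoeffD; congr (_ + _).
  rewrite (cfM_trunc _ _ lt); apply: mcoeffM_eq => k le.
    by rewrite mcoeff_mderiv_trunc ?ltnS // mcoeff_trunc ltnS le.
  by rewrite !mcoeff_trunc !ltnS le (leq_trans le).
rewrite (cfM_trunc _ _ lt); apply: mcoeffM_eq => k le.
  by rewrite !mcoeff_trunc !ltnS le (leq_trans le).
by rewrite mcoeff_mderiv_trunc ?ltnS // mcoeff_trunc ltnS le.
Qed.

Lemma fderX i j : fder i (fX K j) = (i == j)%:R.
Proof.
apply: fpsP => m; rewrite /=.
have -> : (mnm_add m (mU i) == mU j) = (i == j) && (m == mnm0).
  apply/eqP/andP => [e|[/eqP-> /eqP->]]; last by rewrite add0m.
  have m0 : m = mnm0.
    apply/eqP; rewrite -mdeg_eq0; apply/eqP.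
    by have := congr1 mdeg e; rewrite mdegD !mdeg1; lia.
  by split; [rewrite -eq_mnm1 -e m0 add0m|apply/eqP].
case: (i == j) => /=; last by rewrite mul0rn.
by case: eqVneq => [->|_]; rewrite ?mnm0E ?mul0rn.
Qed.

Lemma eqt_fder N i f g : eqt N.+1 f g -> eqt N (fder i f) (fder i g).
Proof. by move=> e m lt /=; rewrite e // mdegD mdeg1 addn1 ltnS. Qed.

End Der.

(** * Composition of formal series *)

Section Comp.
Variables (K : comNzRingType) (n k : nat).
Implicit Types (f g : fps K n) (Y : 'I_n -> fps K k).

Definition psubst Y (p : mpoly n K) : fps K k := mmap (@fps_const K k) Y p.

Lemma psubstD Y p q : psubst Y (p + q) = psubst Y p + psubst Y q.
Proof. exact: mmapD. Qed.
Lemma psubstB Y p q : psubst Y (p - q) = psubst Y p - psubst Y q.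
Proof. exact: mmapB. Qed.
Lemma psubstM Y p q : psubst Y (p * q) = psubst Y p * psubst Y q.
Proof. exact: (mmap_is_multiplicative _ _).1. Qed.
Lemma psubstX Y m : psubst Y (mpolyX K m) = mmap1 Y m.
Proof. exact: mmapX. Qed.
Lemma psubstC Y c : psubst Y (mpolyC n c) = fps_const k c.
Proof. exact: mmapC. Qed.
Lemma psubst_trunc Y N f :
  psubst Y (ftrunc N f) = \sum_(m : bmultinom n N) fps_const k (cf f m) * mmap1 Y m.
Proof.
rewrite /psubst /ftrunc raddf_sum /=; apply: eq_bigr => m _.
by rewrite mmapZ mmapX.
Qed.

(** This is the composition when [nocst Y] holds: a monomial of degree [N] in [Y] then has no term
    below degree [N], so the truncated part of [f] cannot contribute. Otherwise the value is
    arbitrary. *)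
Definition fcomp f Y : fps K k :=
  Fps (fun m => cf (psubst Y (ftrunc (mdeg m).+1 f)) m).

Definition nocst Y := forall i, cf (Y i) mnm0 = 0.

Definition deg_ge l N (f : fps K l) := spt (fun m => (N <= mdeg m)%N) f.

Lemma deg_geM l N1 N2 (f g : fps K l) :
  deg_ge N1 f -> deg_ge N2 g -> deg_ge (N1 + N2) (f * g).
Proof. by move=> h1 h2; apply: sptM h1 h2 _ => m1 m2 a b; rewrite mdegD leq_add. Qed.

Lemma deg_ge_mmap1 Y m : nocst Y -> deg_ge (mdeg m) (mmap1 Y m).
Proof.
move=> nc; rewrite /mmap1 mdegE.
elim/big_rec2: _ => [//|i x y _ IH]; apply: deg_geM => //.
elim: (m i) => [|d IHd]; first by rewrite expr0.
rewrite exprS -add1n; apply: deg_geM => // m'.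
by rewrite lt0n mdeg_eq0; case: eqP => [->|//]; rewrite nc.
Qed.

Lemma cf_spt_eq0 l (S : multinom l -> Prop) (f : fps K l) m :
  spt S f -> ~ S m -> cf f m = 0.
Proof. by move/sptP; apply. Qed.

Lemma deg_ge_psubst Y N p : nocst Y ->
  (forall m, (mdeg m < N)%N -> mcoeff m p = 0) -> deg_ge N (psubst Y p).
Proof.
move=> nc hp; rewrite /psubst /mmap.
apply: big_ind => [|x y|m _]; [exact: spt0|exact: sptD|].
have [lt|ge] := ltnP (mdeg m) N.
  by rewrite hp // raddf0 mul0r; exact: spt0.
move=> m'; rewrite cf_constM => nz.
apply: leq_trans ge _; apply: (deg_ge_mmap1 nc (m := m)) => e.
by rewrite e mulr0 in nz.
Qed.

Lemma eqt_psubst Y N p q : nocst Y ->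
  (forall m, (mdeg m < N)%N -> mcoeff m p = mcoeff m q) ->
  eqt N (psubst Y p) (psubst Y q).
Proof.
move=> nc e; apply/eqt_sub; rewrite -psubstB; apply: deg_ge_psubst => // m lt.
by rewrite mcoeffB e // subrr.
Qed.

Lemma fcomp_eqt Y N f : nocst Y -> eqt N (fcomp f Y) (psubst Y (ftrunc N f)).
Proof.
move=> nc m lt; apply: (eqt_psubst nc (N := (mdeg m).+1)) => // m' le.
by rewrite !mcoeff_trunc le (leq_trans le lt).
Qed.

Lemma fcompD Y f g : fcomp (f + g) Y = fcomp f Y + fcomp g Y.
Proof. by apply: fpsP => m; rewrite /= ftruncD psubstD. Qed.

Lemma fcompC Y c : fcomp (fps_const n c) Y = fps_const k c.
Proof. by apply: fpsP => m; rewrite /= trunc_const psubstC. Qed.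

Lemma fcompM Y f g : nocst Y -> fcomp (f * g) Y = fcomp f Y * fcomp g Y.
Proof.
move=> nc; apply: eqt_eq => N.
apply: eqt_trans (fcomp_eqt _ nc) _.
apply: eqt_trans (_ : eqt N _ (psubst Y (ftrunc N f * ftrunc N g))) _.
  by apply: eqt_psubst => // m lt; rewrite mcoeff_trunc_mul.
by rewrite psubstM; apply: eqtM; apply: eqt_sym; apply: fcomp_eqt.
Qed.

Lemma fcompN Y f : fcomp (- f) Y = - fcomp f Y.
Proof.
by apply/eqP; rewrite -addr_eq0 -fcompD addNr; have := fcompC Y 0; rewrite !raddf0 => ->.
Qed.

Lemma fcompX Y i : nocst Y -> fcomp (fX K i) Y = Y i.
Proof.
move=> nc; apply: eqt_eq => N.
apply: eqt_trans (_ : eqt N _ (fcomp (fX K i) Y)) _; first exact: eqt_refl.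
move=> m lt; rewrite (fcomp_eqt (N := N.+2)) //; last by apply: ltn_trans lt _.
by rewrite trunc_mon ?mdeg1 // psubstX mmap1U.
Qed.

(** The identity is stable under sums and products, so it is enough to check it on constants and
    variables. *)
Lemma psubst_chain j Y p :
  fder j (psubst Y p) = \sum_i psubst Y (mderiv i p) * fder j (Y i).
Proof.
have HM (p1 q : mpoly n K) : fder j (psubst Y p1) = \sum_i psubst Y (mderiv i p1) * fder j (Y i) ->
    fder j (psubst Y q) = \sum_i psubst Y (mderiv i q) * fder j (Y i) ->
    fder j (psubst Y (p1 * q)) = \sum_i psubst Y (mderiv i (p1 * q)) * fder j (Y i).
  move=> hp hq; rewrite psubstM fderM hp hq mulr_suml mulr_sumr -big_split /=.
  by apply: eq_bigr => i _; rewrite mderivM psubstD !psubstM; ring.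
have HC c : fder j (psubst Y (mpolyC n c)) =
     \sum_i psubst Y (mderiv i (mpolyC n c)) * fder j (Y i).
  rewrite psubstC fderC big1 // => i _.
  by rewrite mderivC -(mpolyC0 n K) psubstC raddf0 mul0r.
rewrite (mpolyE p); elim/big_rec: _ => [|m' q _ IH].
  by have := HC 0; rewrite mpolyC0.
rewrite psubstD fderD IH; under [RHS]eq_bigr do rewrite mderivD psubstD mulrDl.
rewrite big_split /=; congr (_ + _).
rewrite -mul_mpolyC; apply: (HM); first exact: HC.
rewrite mpolyXE_id; apply: (big_ind (fun p => fder j (psubst Y p) = \sum_i psubst Y (mderiv i p) * fder j (Y i))) => [|x y|i _]; [by have := HC 1; rewrite mpolyC1|exact: HM|].
elim: (m' i) => [|d IHd]; first by have := HC 1; rewrite mpolyC1.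
rewrite exprS; refine (HM _ _ _ IHd).
have sub0 : mnm_sub (mU i) (mU i) = mnm0 by apply/mnmP=> l; rewrite mnmBE mnm0E subnn.
rewrite psubstX mmap1U (bigD1 i) //= mderivX mnm1E eqxx scale1r sub0 psubstX mmap11 mul1r.
rewrite big1 ?addr0 // => i' ne; rewrite mderivX mnm1E eq_sym (negbTE ne) scale0r.
by rewrite -(mpolyC0 n K) psubstC raddf0 mul0r.
Qed.

Lemma fcomp_chain j Y f : nocst Y ->
  fder j (fcomp f Y) = \sum_i fcomp (fder i f) Y * fder j (Y i).
Proof.
move=> nc; apply: eqt_eq => N.
apply: eqt_trans (eqt_fder j (fcomp_eqt (N := N.+1) f nc)) _.
rewrite psubst_chain => m lt; rewrite !cf_sum; apply: eq_bigr => i _.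
apply: (eqtM (N := N)) => // {m lt}.
apply: eqt_trans (eqt_sym (fcomp_eqt _ nc)).
by apply: eqt_psubst => // m lt; rewrite mcoeff_mderiv_trunc // mcoeff_trunc lt.
Qed.
End Comp.

(** * Convergent series *)

Section Cabs.
Variable R : realType.
Implicit Types (x y : Cx R).

(** The norm of [Cx R] has values in [Cx R], which is only partially ordered; estimates are made
    with this real-valued modulus. *)
Definition cabs x : R := ComplexField.Normc.normc (x : R[i]).

Lemma norm_cabs x : `|x| = ((cabs x)%:C)%C :> R[i].
Proof. by []. Qed.
Lemma cabs0 : cabs 0 = 0.
Proof. exact: ComplexField.Normc.normc0. Qed.
Lemma cabs1 : cabs 1 = 1.
Proof. exact: ComplexField.Normc.normc1. Qed.
Lemma cabsM x y : cabs (x * y) = cabs x * cabs y.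
Proof. exact: ComplexField.Normc.normcM. Qed.
Lemma cabsD x y : cabs (x + y) <= cabs x + cabs y.
Proof. exact: le_normcD. Qed.
Lemma cabsN x : cabs (- x) = cabs x.
Proof. exact: normcN. Qed.
Lemma cabs_ge0 x : 0 <= cabs x.
Proof. by have := normr_ge0 x; rewrite norm_cabs lecR. Qed.
Lemma cabs_eq0 x : cabs x = 0 -> x = 0.
Proof. exact: ComplexField.Normc.eq0_normc. Qed.
Lemma cabsX x n : cabs (x ^+ n) = cabs x ^+ n.
Proof. by elim: n => [|n IH]; rewrite ?expr0 ?cabs1 // !exprS cabsM IH. Qed.
Lemma cabsB x y : cabs (x - y) <= cabs x + cabs y.
Proof. by rewrite -(cabsN y) cabsD. Qed.
Lemma cabs_sum (I : Type) (r : seq I) (P : pred I) (F : I -> Cx R) :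
  cabs (\sum_(i <- r | P i) F i) <= \sum_(i <- r | P i) cabs (F i).
Proof.
elim/big_rec2: _ => [|i x y _ h]; first by rewrite cabs0.
by apply: le_trans (cabsD _ _) _; rewrite lerD2l.
Qed.
Lemma cabs_prod (I : Type) (r : seq I) (P : pred I) (F : I -> Cx R) :
  cabs (\prod_(i <- r | P i) F i) = \prod_(i <- r | P i) cabs (F i).
Proof. by elim/big_rec2: _ => [|i x y _ <-]; rewrite ?cabs1 ?cabsM. Qed.
Lemma cabs_real (a : R) : 0 <= a -> cabs (a%:C)%C = a.
Proof. by move=> a0; rewrite /cabs /= expr0n addr0 sqrtr_sqr ger0_norm. Qed.
Lemma cabs_nat n : cabs n%:R = n%:R.
Proof.
have -> : n%:R = ((n%:R : R)%:C)%C :> Cx R by rewrite rmorph_nat.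
by rewrite cabs_real // ler0n.
Qed.
Lemma Re_le x : `|complex.Re (x : R[i])| <= cabs x.
Proof. by case: x => a b /=; rewrite /cabs /= -sqrtr_sqr ler_sqrt ?addr_ge0 ?sqr_ge0 // lerDl sqr_ge0. Qed.
Lemma Im_le x : `|complex.Im (x : R[i])| <= cabs x.
Proof. by case: x => a b /=; rewrite /cabs /= -sqrtr_sqr ler_sqrt ?addr_ge0 ?sqr_ge0 // lerDr sqr_ge0. Qed.
Lemma cabs_ReIm x : cabs x <= `|complex.Re (x : R[i])| + `|complex.Im (x : R[i])|.
Proof.
case: x => a b /=; rewrite /cabs /=.
rewrite -[leRHS]ger0_norm ?addr_ge0 // -sqrtr_sqr ler_sqrt ?sqr_ge0 //.
by rewrite sqrrD !real_normK ?num_real // lerD2r lerDl mulrn_wge0 ?mulr_ge0.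
Qed.

(** The intervals of centre [x N] and radius [c N] meet pairwise, so the supremum of their left ends
    lies in all of them. *)
Lemma cauchy_limR (x c : nat -> R) :
  (forall N k, `|x (N + k)%N - x N| <= c N) -> exists l, forall N, `|l - x N| <= c N.
Proof.
move=> h; pose A := [set y | exists N, y = x N - c N]%classic.
have key N M : x N - c N <= x M + c M.
  have [k e] : exists k, (N + k = maxn N M)%N by exists (maxn N M - N)%N; lia.
  have [k' e'] : exists k, (M + k = maxn N M)%N by exists (maxn N M - M)%N; lia.
  have := h N k; have := h M k'; rewrite e e' !ler_norml.
  by move=> /andP[a b] /andP[a' b']; lra.
have A0 : (A !=set0)%classic by exists (x 0%N - c 0%N), 0%N.
have ub M : ubound A (x M + c M) by move=> y [N ->]; apply: key.
have hs : has_sup A by split => //; exists (x 0%N + c 0%N); apply: ub.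
exists (sup A) => N; rewrite ler_norml.
have := @ge_sup _ A (x N + c N) A0 (ub N).
have : x N - c N <= sup A by apply: ub_le_sup; [exact: hs.2|exists N].
by move=> a b; apply/andP; split; lra.
Qed.

(** Real and imaginary parts are treated separately, whence the factor [2]. *)
Lemma cauchy_limC (x : nat -> Cx R) (c : nat -> R) :
  (forall N k, cabs (x (N + k)%N - x N) <= c N) ->
  exists l, forall N, cabs (l - x N) <= 2 * c N.
Proof.
move=> h.
have [|a ha] := @cauchy_limR (fun N => complex.Re (x N : R[i])) c.
  by move=> N k; apply: le_trans (h N k); rewrite -raddfB; apply: Re_le.
have [|b hb] := @cauchy_limR (fun N => complex.Im (x N : R[i])) c.
  by move=> N k; apply: le_trans (h N k); rewrite -raddfB; apply: Im_le.
exists (Complex a b) => N; apply: le_trans (cabs_ReIm _) _.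
rewrite !raddfB /=; have := ha N; have := hb N; lra.
Qed.

(** The way in which limits are taken below: all errors decay like [2 ^- N], and an identity follows
    once its defect is bounded so for every [N]. *)
Lemma le_half_pow (a B : R) : 0 <= a -> (forall N, a <= B / 2 ^+ N) -> a = 0.
Proof.
move=> a0 h; apply/eqP; rewrite eq_le a0 andbT leNgt; apply/negP => ap.
have B0 : 0 <= B by have := h 0%N; rewrite expr0 divr1; lra.
have [N hN] : exists N : nat, B / a < N%:R.
  by have := archi_boundP (divr_ge0 B0 a0); exists (Num.bound (B / a)).
have : (N%:R : R) <= 2 ^+ N by rewrite -natrX ler_nat ltnW // ltn_expl.
have p2 : 0 < (2 : R) ^+ N by rewrite exprn_gt0.
have := h N; rewrite ler_pdivlMr // => h1 h2.
by rewrite ltr_pdivrMr // in hN; have := ler_wpM2l a0 h2; lra.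
Qed.
End Cabs.

Section BoundedSums.
Variables (n : nat) (V : nmodType).

Lemma bm_widen N N' (F : multinom n -> V) : (N <= N')%N ->
  \sum_(m : bmultinom n N) F m = \sum_(m : bmultinom n N' | (mdeg m < N)%N) F m.
Proof.
move=> le; pose h (m : bmultinom n N) := BMultinom (leq_trans (bmdeg m) le).
rewrite (reindex_omap h (fun m : bmultinom n N' => insub (m : multinom n))) /=.
  apply: eq_bigl => m; rewrite bmdeg /=.
  by case: insubP => [u _ /val_inj ->|]; rewrite ?eqxx // bmdeg.
move=> m lt; case: insubP => [u _ e|]; last by rewrite lt.
by congr Some; apply: val_inj.
Qed.

Lemma bm_conv N (F : multinom n -> multinom n -> V) :
  \sum_(m : bmultinom n N) \sum_(k : bmultinom n N * bmultinom n N |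
      (m : multinom n) == mnm_add k.1 k.2) F k.1 k.2
  = \sum_(k : bmultinom n N * bmultinom n N | (mdeg (mnm_add k.1 k.2) < N)%N) F k.1 k.2.
Proof.
rewrite (exchange_big_dep (fun k : bmultinom n N * bmultinom n N =>
  (mdeg (mnm_add k.1 k.2) < N)%N)) /=; last first.
  by move=> m k _ /eqP <-; rewrite bmdeg.
apply: eq_bigr => k lt; rewrite (big_pred1 (BMultinom lt)) //.
Qed.
End BoundedSums.

Lemma mmap1D (S : comNzRingType) n (h : 'I_n -> S) m1 m2 :
  mmap1 h (mnm_add m1 m2) = mmap1 h m1 * mmap1 h m2.
Proof.
by rewrite /mmap1 -big_split /=; apply: eq_bigr => i _; rewrite mnmDE exprD.
Qed.

Section Norms.
Variables (R : realType) (n : nat).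
Implicit Types (f g : fps (Cx R) n) (m : multinom n) (N : nat) (w : 'I_n -> R) (z : 'I_n -> Cx R).

Lemma mmap1_ge0 w m : (forall i, 0 <= w i) -> 0 <= mmap1 w m.
Proof. by move=> w0; apply: prodr_ge0 => i _; rewrite exprn_ge0. Qed.

Lemma ler_mmap1 w w' m : (forall i, 0 <= w i <= w' i) -> mmap1 w m <= mmap1 w' m.
Proof.
move=> h; apply: ler_prod => i _; have /andP[a b] := h i.
by rewrite exprn_ge0 // lerXn2r // nnegrE // (le_trans a).
Qed.

Lemma mmap1_scale s w m : mmap1 (fun i => s * w i) m = s ^+ mdeg m * mmap1 w m.
Proof.
rewrite /mmap1; under eq_bigr do rewrite exprMn.
by rewrite big_split /= prodrXr mdegE.
Qed.

Lemma cabs_mmap1 z m : cabs (mmap1 z m) = mmap1 (fun i => cabs (z i)) m.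
Proof. by rewrite /mmap1 cabs_prod; apply: eq_bigr => i _; rewrite cabsX. Qed.

(** A partial sum of the weighted l1 norm. [bnd w M f] says that the norm is at most [M] without
    forming an infinite sum. *)
Definition snorm w N f := \sum_(m : bmultinom n N) cabs (cf f m) * mmap1 w m.
Definition bnd w (M : R) f := forall N, snorm w N f <= M.

Lemma snorm_ge0 w N f : (forall i, 0 <= w i) -> 0 <= snorm w N f.
Proof. by move=> w0; apply: sumr_ge0 => m _; rewrite mulr_ge0 ?cabs_ge0 ?mmap1_ge0. Qed.
Lemma bnd_ge0 w M f : (forall i, 0 <= w i) -> bnd w M f -> 0 <= M.
Proof. by move=> w0 /(_ 0%N); apply: le_trans; apply: snorm_ge0. Qed.

Lemma bnd_le w M M' f : M <= M' -> bnd w M f -> bnd w M' f.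
Proof. by move=> le h N; apply: le_trans le. Qed.
Lemma bnd_dom w c M f g : 0 <= c -> (forall i, 0 <= w i) ->
  (forall m, cabs (cf f m) <= c * cabs (cf g m)) -> bnd w M g -> bnd w (c * M) f.
Proof.
move=> c0 w0 h b N; apply: le_trans (_ : c * snorm w N g <= _); last exact: ler_wpM2l.
rewrite mulr_sumr; apply: ler_sum => m _.
by rewrite mulrA ler_wpM2r ?mmap1_ge0.
Qed.
Lemma bnd_w w w' M f : (forall i, 0 <= w i <= w' i) -> bnd w' M f -> bnd w M f.
Proof.
move=> h b N; apply: le_trans (b N); apply: ler_sum => m _.
by rewrite ler_wpM2l ?cabs_ge0 ?ler_mmap1.
Qed.
Lemma bndD w M M' f g : (forall i, 0 <= w i) ->
  bnd w M f -> bnd w M' g -> bnd w (M + M') (f + g).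
Proof.
move=> w0 hf hg N; apply: le_trans (lerD (hf N) (hg N)).
rewrite -big_split /=; apply: ler_sum => m _.
by rewrite -mulrDl ler_wpM2r ?mmap1_ge0 // cabsD.
Qed.
Lemma bndN w M f : bnd w M f -> bnd w M (- f).
Proof.
by move=> h N; have := h N; rewrite /snorm; under [leLHS]eq_bigr do rewrite -cabsN.
Qed.
Lemma bndB w M M' f g : (forall i, 0 <= w i) ->
  bnd w M f -> bnd w M' g -> bnd w (M + M') (f - g).
Proof. by move=> w0 hf hg; apply: bndD => //; apply: bndN. Qed.

Lemma bndM w M M' f g : (forall i, 0 <= w i) ->
  bnd w M f -> bnd w M' g -> bnd w (M * M') (f * g).
Proof.
move=> w0 hf hg N.
have M0 := bnd_ge0 w0 hf; have M0' := bnd_ge0 w0 hg.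
apply: le_trans (_ : snorm w N f * snorm w N g <= _); last first.
  by apply: ler_pM; rewrite ?snorm_ge0.
pose F k l := cabs (cf f k) * mmap1 w k * (cabs (cf g l) * mmap1 w l).
have F0 k l : 0 <= F k l by rewrite !mulr_ge0 ?cabs_ge0 ?mmap1_ge0.
have -> : snorm w N f * snorm w N g =
    \sum_(k : bmultinom n N * bmultinom n N) F k.1 k.2.
  by rewrite /snorm big_distrlr /= pair_bigA.
apply: le_trans (_ : \sum_(m : bmultinom n N) \sum_(k : bmultinom n N * bmultinom n N |
      (m : multinom n) == mnm_add k.1 k.2) F k.1 k.2 <= _).
  apply: ler_sum => m _; rewrite (@cfM _ _ N) ?bmdeg //.
  apply: le_trans (_ : \sum_(k : bmultinom n N * bmultinom n N | (m : multinom n) == mnm_add k.1 k.2)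
    cabs (cf f k.1) * cabs (cf g k.2) * mmap1 w m <= _).
    rewrite -mulr_suml ler_wpM2r ?mmap1_ge0 //.
    apply: le_trans (cabs_sum _ _ _) _; apply: ler_sum => k _; by rewrite cabsM.
  by apply: ler_sum => k /eqP ->; rewrite mmap1D /F le_eqVlt; apply/orP; left; apply/eqP; ring.
rewrite bm_conv [leRHS](bigID (fun k : bmultinom n N * bmultinom n N =>
  (mdeg (mnm_add k.1 k.2) < N)%N)) /= lerDl.
by apply: sumr_ge0 => k _; apply: F0.
Qed.

Lemma bnd_mon w m0 : (forall i, 0 <= w i) -> bnd w (mmap1 w m0) (mon (Cx R) m0).
Proof.
move=> w0 N; rewrite /snorm.
have [lt|ge] := ltnP (mdeg m0) N.
  rewrite (bigD1 (BMultinom lt)) //= eqxx cabs1 mul1r big1 ?addr0 // => m ne.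
  by rewrite -val_eqE /= in ne; rewrite (negbTE ne) cabs0 mul0r.
rewrite big1 ?mmap1_ge0 // => -[m lt] _ /=.
case: eqVneq => [e|]; first by rewrite -e leqNgt lt in ge.
by rewrite cabs0 mul0r.
Qed.
Lemma bndX w i : (forall i, 0 <= w i) -> bnd w (w i) (fX (Cx R) i).
Proof. by move=> w0; rewrite -[w i](mmap1U w); apply: bnd_mon. Qed.
Lemma bnd1 w : (forall i, 0 <= w i) -> bnd w 1 1.
Proof. by move=> w0; rewrite -mon0 -(mmap11 w); apply: bnd_mon. Qed.
Lemma bndZ w c M f : (forall i, 0 <= w i) ->
  bnd w M f -> bnd w (cabs c * M) (fps_const n c * f).
Proof.
move=> w0; apply: bnd_dom => // [|m]; first exact: cabs_ge0.
by rewrite cf_constM cabsM.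
Qed.
Lemma bndC w c : (forall i, 0 <= w i) -> bnd w (cabs c) (fps_const n c).
Proof. by move=> w0; rewrite -[X in bnd w X _]mulr1 -[X in bnd w _ X]mulr1; apply: bndZ => //; apply: bnd1. Qed.
Lemma bnd0 w M : 0 <= M -> bnd w M 0.
Proof. by move=> M0 N; rewrite /snorm big1 // => m _; rewrite cf0 cabs0 mul0r. Qed.
Lemma bndXn w M f k : (forall i, 0 <= w i) -> bnd w M f -> bnd w (M ^+ k) (f ^+ k).
Proof.
move=> w0 h; elim: k => [|k IH]; first by rewrite !expr0; apply: bnd1.
by rewrite !exprS; apply: bndM.
Qed.
Lemma bnd_sum w (I : Type) (r : seq I) (P : pred I) (B : I -> R) (F : I -> fps (Cx R) n) :
  (forall i, 0 <= w i) -> (forall i, P i -> bnd w (B i) (F i)) ->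
  bnd w (\sum_(i <- r | P i) B i) (\sum_(i <- r | P i) F i).
Proof.
move=> w0 h; elim/big_rec2: _ => [|i x y Pi IH]; first exact: bnd0.
by apply: bndD => //; apply: h.
Qed.
(** Each partial sum sees finitely many coefficients, so a bound passes to coefficientwise limits;
    this keeps the limits of the iterations in their ball. *)
Lemma bnd_closed w M f : (forall N, exists2 f', bnd w M f' & eqt N f f') -> bnd w M f.
Proof.
move=> h N; have [f' b e] := h N; apply: le_trans (b N).
by apply: ler_sum => m _; rewrite e ?bmdeg.
Qed.

(** Every monomial present has degree at least one and gains a factor [s ^+ mdeg m <= s], as in the
    Schwarz lemma. *)
Lemma bnd_shrink w M s f : (forall i, 0 <= w i) -> 0 <= s <= 1 -> deg_ge 1 f ->
  bnd w M f -> bnd (fun i => s * w i) (s * M) f.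
Proof.
move=> w0 /andP[s0 s1] f0 b N; apply: le_trans (_ : s * snorm w N f <= _); last exact: ler_wpM2l.
rewrite mulr_sumr; apply: ler_sum => m _; rewrite mmap1_scale.
have [->|/eqP nz] := eqVneq (cf f m) 0; first by rewrite cabs0 !mul0r mulr0.
have /= := f0 _ nz; case: (mdeg m) => [//|d _].
rewrite [leRHS]mulrCA ler_wpM2l ?cabs_ge0 // ler_wpM2r ?mmap1_ge0 // exprS.
by rewrite -[leRHS]mulr1 ler_wpM2l // exprn_ile1.
Qed.
Lemma bnd_mmap1 w k (v : 'I_k -> R) (Y : 'I_k -> fps (Cx R) n) (m : multinom k) :
  (forall i, 0 <= w i) -> (forall i, bnd w (v i) (Y i)) -> bnd w (mmap1 v m) (mmap1 Y m).
Proof.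
move=> w0 h; rewrite /mmap1; elim/big_rec2: _ => [|i x y _ IH]; first exact: bnd1.
by apply: bndM => //; apply: bndXn.
Qed.
End Norms.

(** A monomial [m] of [f] becomes [mmap1 Y m], of norm at most its old weight [mmap1 w m]. *)
Lemma bnd_comp (R : realType) n k (w : 'I_n -> R) (v : 'I_k -> R) M
   (f : fps (Cx R) n) (Y : 'I_n -> fps (Cx R) k) :
  (forall i, 0 <= v i) -> nocst Y ->
  (forall i, bnd v (w i) (Y i)) -> bnd w M f -> bnd v M (fcomp f Y).
Proof.
move=> v0 nc hY hf; apply: bnd_closed => N.
exists (psubst Y (ftrunc N f)); last exact: fcomp_eqt.
apply: bnd_le (hf N) _; rewrite psubst_trunc /snorm; apply: bnd_sum => // m _.
by apply: bndZ => //; apply: bnd_mmap1.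
Qed.

(** * Values of convergent series *)

Section Eval.
Variables (R : realType) (n : nat).
Implicit Types (f g : fps (Cx R) n) (m : multinom n) (N : nat) (w : 'I_n -> R) (z : 'I_n -> Cx R).

Definition pev N f z : Cx R := \sum_(m : bmultinom n N) cf f m * mmap1 z m.
(* [ev f z] is the sum of the series where the partial sums converge at the rate [2^-N], as they
   do on half of a polydisc of absolute convergence (see [conv]), and [0] elsewhere. *)
Definition is_ev f z l := exists B : R, forall N, cabs (l - pev N f z) <= B / 2 ^+ N.
Definition ev f z : Cx R := xget 0 [set l | is_ev f z l]%classic.
Definition conv w z := forall i, cabs (z i) <= w i / 2.

Lemma conv_ge0 w z : conv w z -> forall i, 0 <= w i.
Proof. by move=> c i; have := c i; have := cabs_ge0 (z i); lra. Qed.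

Lemma is_ev_unique f z l l' : is_ev f z l -> is_ev f z l' -> l = l'.
Proof.
move=> [B hB] [B' hB']; apply/eqP; rewrite -subr_eq0; apply/eqP; apply: cabs_eq0.
apply: (@le_half_pow _ _ (B + B')); first exact: cabs_ge0.
move=> N; have -> : l - l' = (l - pev N f z) - (l' - pev N f z) by ring.
by apply: le_trans (cabsB _ _) _; rewrite mulrDl lerD.
Qed.

Lemma ev_is f z l : is_ev f z l -> ev f z = l.
Proof. by move=> h; rewrite /ev; case: xgetP => [x _ /= hx|/(_ l)//]; apply: is_ev_unique hx h. Qed.

Lemma term_bound w z m : conv w z -> cabs (mmap1 z m) <= mmap1 w m / 2 ^+ mdeg m.
Proof.
move=> c; rewrite cabs_mmap1; apply: le_trans (_ : mmap1 (fun i => 2^-1 * w i) m <= _).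
  by apply: ler_mmap1 => i; rewrite cabs_ge0 mulrC c.
by rewrite mmap1_scale exprVn mulrC.
Qed.

Lemma pow2_le N N' : (N <= N')%N -> (2 ^+ N' : R)^-1 <= (2 ^+ N)^-1.
Proof. by move=> le; rewrite lef_pV2 ?posrE ?exprn_gt0 // ler_eXn2l // ltr1n. Qed.

(** On half of the polydisc a monomial of degree at least [N] is smaller than its weight by a factor
    [2 ^- N]. *)
Lemma partial_bound w z (I : finType) (P : pred I) (F : I -> multinom n) (c : I -> Cx R) N :
  conv w z -> (forall i, P i -> (N <= mdeg (F i))%N) ->
  cabs (\sum_(i | P i) c i * mmap1 z (F i)) <= (\sum_(i | P i) cabs (c i) * mmap1 w (F i)) / 2 ^+ N.
Proof.
move=> cz h; apply: le_trans (cabs_sum _ _ _) _; rewrite mulr_suml; apply: ler_sum => i Pi.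
rewrite cabsM -mulrA ler_wpM2l ?cabs_ge0 //; apply: le_trans (term_bound _ cz) _.
by rewrite ler_wpM2l ?mmap1_ge0 ?pow2_le ?h //; apply: conv_ge0 cz.
Qed.

Lemma pev_tail w M f z N k : bnd w M f -> conv w z ->
  cabs (pev (N + k) f z - pev N f z) <= M / 2 ^+ N.
Proof.
move=> b cz; have w0 := conv_ge0 cz.
rewrite /pev (bm_widen (fun m => cf f m * mmap1 z m) (leq_addr k N)).
rewrite (bigID (fun m : bmultinom n (N + k) => (mdeg m < N)%N)) /= addrC addrK.
apply: le_trans (partial_bound (N := N) _ cz _) _.
  by move=> m; rewrite -leqNgt.
rewrite ler_wpM2r ?invr_ge0 ?exprn_ge0 //; apply: le_trans (b (N + k)%N).
rewrite /snorm [leRHS](bigID (fun m : bmultinom n (N + k) => (mdeg m < N)%N)) /= lerDr.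
by apply: sumr_ge0 => m _; rewrite mulr_ge0 ?cabs_ge0 ?mmap1_ge0.
Qed.

Lemma ev_bound w M f z N : bnd w M f -> conv w z ->
  cabs (ev f z - pev N f z) <= 2 * M / 2 ^+ N.
Proof.
move=> b cz.
have [l hl] := @cauchy_limC _ (fun N => pev N f z) (fun N => M / 2 ^+ N)
   (fun N k => pev_tail N k b cz).
have hl' N' : cabs (l - pev N' f z) <= 2 * M / 2 ^+ N' by rewrite -mulrA.
by rewrite (@ev_is _ _ l) //; exists (2 * M).
Qed.

Lemma evP w M f z : bnd w M f -> conv w z -> is_ev f z (ev f z).
Proof. by move=> b c; exists (2 * M) => N; apply: ev_bound b c. Qed.

Lemma is_evD f g z l l' : is_ev f z l -> is_ev g z l' -> is_ev (f + g) z (l + l').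
Proof.
move=> [B hB] [B' hB']; exists (B + B') => N.
have -> : l + l' - pev N (f + g) z = (l - pev N f z) + (l' - pev N g z).
  rewrite /pev; under eq_bigr do rewrite cfD mulrDl.
  by rewrite big_split /=; ring.
by apply: le_trans (cabsD _ _) _; rewrite mulrDl lerD.
Qed.

Lemma is_evN f z l : is_ev f z l -> is_ev (- f) z (- l).
Proof.
move=> [B hB]; exists B => N.
have -> : - l - pev N (- f) z = - (l - pev N f z).
  by rewrite /pev; under eq_bigr do rewrite cfN mulNr; rewrite sumrN; ring.
by rewrite cabsN.
Qed.

Lemma pevM N f g w M M' z : bnd w M f -> bnd w M' g -> conv w z ->
  cabs (pev N f z * pev N g z - pev N (f * g) z) <= M * M' / 2 ^+ N.
Proof.
move=> bf bg cz; have w0 := conv_ge0 cz.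
pose F k l := cf f k * cf g l * mmap1 z (mnm_add k l).
have -> : pev N f z * pev N g z = \sum_(k : bmultinom n N * bmultinom n N) F k.1 k.2.
  rewrite /pev big_distrlr /= pair_bigA /=; apply: eq_bigr => k _.
  by rewrite /F mmap1D; ring.
have -> : pev N (f * g) z = \sum_(k : bmultinom n N * bmultinom n N |
    (mdeg (mnm_add k.1 k.2) < N)%N) F k.1 k.2.
  rewrite -bm_conv; apply: eq_bigr => m _; rewrite (@cfM _ _ N) ?bmdeg // mulr_suml.
  by apply: eq_bigr => k /eqP ->.
rewrite [X in X - _](bigID (fun k : bmultinom n N * bmultinom n N =>
  (mdeg (mnm_add k.1 k.2) < N)%N)) /= addrAC subrr add0r.
apply: le_trans (partial_bound (N := N) (F := fun k : bmultinom n N * bmultinom n N => mnm_add k.1 k.2) _ cz _) _.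
  by move=> k; rewrite -leqNgt.
rewrite ler_wpM2r ?invr_ge0 ?exprn_ge0 //.
apply: le_trans (_ : snorm w N f * snorm w N g <= _); last by apply: ler_pM; rewrite ?snorm_ge0.
have F0 k l : 0 <= cabs (cf f k * cf g l) * mmap1 w (mnm_add k l).
  by rewrite mulr_ge0 ?cabs_ge0 ?mmap1_ge0.
rewrite /snorm big_distrlr /= pair_bigA /=.
apply: le_trans (_ : \sum_(k : bmultinom n N * bmultinom n N)
   cabs (cf f k.1 * cf g k.2) * mmap1 w (mnm_add k.1 k.2) <= _).
  rewrite [leRHS](bigID (fun k : bmultinom n N * bmultinom n N =>
    (mdeg (mnm_add k.1 k.2) < N)%N)) /= lerDr.
  by apply: sumr_ge0 => k _; apply: F0.
by apply: ler_sum => k _; rewrite mmap1D cabsM le_eqVlt; apply/orP; left; apply/eqP; ring.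
Qed.

Lemma ev_le w M f z : bnd w M f -> conv w z -> cabs (ev f z) <= M.
Proof.
move=> b cz; have w0 := conv_ge0 cz.
rewrite leNgt; apply/negP => lt.
have h N : cabs (ev f z) - M <= 2 * M / 2 ^+ N.
  have h1 := ev_bound N b cz; have h2 : cabs (pev N f z) <= M.
    apply: le_trans (partial_bound (N := 0) _ cz _) _ => //.
    by rewrite expr0 divr1; apply: b.
  have -> : ev f z = (ev f z - pev N f z) + pev N f z by rewrite subrK.
  by have := cabsD (ev f z - pev N f z) (pev N f z); lra.
by have := le_half_pow _ h; lra.
Qed.

Lemma evM f g w M M' z : bnd w M f -> bnd w M' g -> conv w z ->
  ev (f * g) z = ev f z * ev g z.
Proof.
move=> bf bg cz; have w0 := conv_ge0 cz.
have M0 := bnd_ge0 w0 bf; have M0' := bnd_ge0 w0 bg.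
(* Two units for the tail of each factor, by [ev_bound], and one for truncating the product, by
   [pevM]. *)
apply: ev_is; exists (5 * M * M') => N.
have := ev_bound N bf cz; have := ev_bound N bg cz; have := pevM N bf bg cz.
have := ev_le bf cz; have : cabs (pev N g z) <= M'.
  apply: le_trans (partial_bound (N := 0) _ cz _) _ => //.
  by rewrite expr0 divr1; apply: bg.
set a := ev f z; set b := ev g z; set a' := pev N f z; set b' := pev N g z.
move=> hb' ha h0 hb h1.
have -> : a * b - pev N (f * g) z = a * (b - b') + (a - a') * b' + (a' * b' - pev N (f * g) z) by ring.
apply: le_trans (cabsD _ _) _; apply: le_trans (lerD (cabsD _ _) h0) _.
rewrite !cabsM.
have := ler_pM (cabs_ge0 _) (cabs_ge0 _) ha hb.
have := ler_pM (cabs_ge0 _) (cabs_ge0 _) h1 hb'.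
have -> : 5 * M * M' / 2 ^+ N = M * (2 * M' / 2 ^+ N) + 2 * M / 2 ^+ N * M' + M * M' / 2 ^+ N by ring.
lra.
Qed.

Lemma evD f g w M M' z : bnd w M f -> bnd w M' g -> conv w z ->
  ev (f + g) z = ev f z + ev g z.
Proof.
move=> bf bg cz; apply: ev_is.
by apply: is_evD; [exact: evP bf cz|exact: evP bg cz].
Qed.
Lemma evN f w M z : bnd w M f -> conv w z -> ev (- f) z = - ev f z.
Proof. by move=> bf cz; apply: ev_is; apply: is_evN; exact: evP bf cz. Qed.

Lemma pev_mon N m0 z : (mdeg m0 < N)%N -> pev N (mon _ m0) z = mmap1 z m0.
Proof.
move=> lt; rewrite /pev (bigD1 (BMultinom lt)) //= eqxx mul1r big1 ?addr0 // => m ne.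
by rewrite -val_eqE /= in ne; rewrite (negbTE ne) mul0r.
Qed.

Lemma ev_mon m0 z : ev (mon _ m0) z = mmap1 z m0.
Proof.
apply: ev_is; exists (cabs (mmap1 z m0) * 2 ^+ mdeg m0) => N.
have [lt|ge] := ltnP (mdeg m0) N.
  by rewrite pev_mon // subrr cabs0 mulr_ge0 ?invr_ge0 ?exprn_ge0 // mulr_ge0 ?cabs_ge0 ?exprn_ge0.
rewrite /pev big1 ?subr0 => [|[m lt] _ /=].
  rewrite -mulrA ler_peMr ?cabs_ge0 // ler_pdivlMr ?exprn_gt0 // mul1r ler_eXn2l // ltr1n //.
case: eqVneq => [e|]; first by rewrite -e leqNgt lt in ge.
by rewrite mul0r.
Qed.
Lemma evX i z : ev (fX _ i) z = z i.
Proof. by rewrite ev_mon mmap1U. Qed.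
Lemma evZ c f w M z : bnd w M f -> conv w z -> ev (fps_const n c * f) z = c * ev f z.
Proof.
move=> b cz; apply: ev_is; exists (cabs c * (2 * M)) => N.
have -> : pev N (fps_const n c * f) z = c * pev N f z.
  by rewrite /pev mulr_sumr; apply: eq_bigr => m _; rewrite cf_constM mulrA.
by rewrite -mulrBr cabsM -[leRHS]mulrA ler_wpM2l ?cabs_ge0 // (ev_bound N b cz).
Qed.
Lemma ev1 z : ev 1 z = 1.
Proof. by rewrite -mon0 ev_mon mmap11. Qed.
Lemma ev0 z : ev 0 z = 0.
Proof.
apply: ev_is; exists 0 => N; rewrite mul0r /pev big1 ?subrr ?cabs0 // => m _.
by rewrite cf0 mul0r.
Qed.
Lemma ev_pow f w M z k : bnd w M f -> conv w z -> ev (f ^+ k) z = ev f z ^+ k.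
Proof.
move=> b cz; have w0 := conv_ge0 cz; elim: k => [|k IH]; first by rewrite !expr0 ev1.
by rewrite !exprS (evM b (bndXn k w0 b) cz) IH.
Qed.
Lemma ev_sum w (I : Type) (r : seq I) (P : pred I) (B : I -> R) (F : I -> fps (Cx R) n) z :
  (forall i, P i -> bnd w (B i) (F i)) -> conv w z ->
  ev (\sum_(i <- r | P i) F i) z = \sum_(i <- r | P i) ev (F i) z.
Proof.
move=> h cz; have w0 := conv_ge0 cz.
have [//] : bnd w (\sum_(i <- r | P i) B i) (\sum_(i <- r | P i) F i) /\
   ev (\sum_(i <- r | P i) F i) z = \sum_(i <- r | P i) ev (F i) z.
elim/big_rec3: _ => [|i x y u Pi [h1 h2]]; first by split; [exact: bnd0|rewrite ev0].
by split; [apply: bndD => //; apply: h|rewrite (evD (h _ Pi) h1 cz) h2].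
Qed.
Lemma ev_deg w M f z N : bnd w M f -> conv w z -> deg_ge N f ->
  cabs (ev f z) <= 2 * M / 2 ^+ N.
Proof.
move=> b cz dg; have := ev_bound N b cz.
rewrite /pev big1 ?subr0 // => m _.
rewrite (cf_spt_eq0 dg) ?mul0r // => le; have := bmdeg m; rewrite ltnNge le //.
Qed.
Lemma ev_mmap1 k (v : 'I_k -> R) (Y : 'I_k -> fps (Cx R) n) (m : multinom k) w z :
  (forall i, bnd w (v i) (Y i)) -> conv w z ->
  ev (mmap1 Y m) z = mmap1 (fun i => ev (Y i) z) m.
Proof.
move=> h cz; have w0 := conv_ge0 cz; rewrite /mmap1.
have [//] : bnd w (\prod_i v i ^+ m i) (\prod_i Y i ^+ m i) /\
   ev (\prod_i Y i ^+ m i) z = \prod_i ev (Y i) z ^+ m i.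
elim/big_rec3: _ => [|i x y u _ [h1 h2]]; first by split; [exact: bnd1|rewrite ev1].
split; first by apply: bndM => //; apply: bndXn.
by rewrite (evM (bndXn (m i) w0 (h i)) h1 cz) h2 (ev_pow _ (h i) cz).
Qed.
End Eval.

(** The bound [w i / 2] on [Y i] puts the values [ev (Y i) z] in the half polydisc where [f] is
    evaluated. *)
Lemma ev_comp (R : realType) n k (w : 'I_n -> R) (v : 'I_k -> R) M
   (f : fps (Cx R) n) (Y : 'I_n -> fps (Cx R) k) z :
  nocst Y -> (forall i, bnd v (w i / 2) (Y i)) -> bnd w M f -> conv v z ->
  ev (fcomp f Y) z = ev f (fun i => ev (Y i) z).
Proof.
move=> nc hY hf cz; have v0 := conv_ge0 cz.
have w0 i : 0 <= w i by have := bnd_ge0 v0 (hY i); lra.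
have hf' : bnd (fun i => w i / 2) M f.
  by apply: bnd_w hf => i; have := w0 i; move=> ?; apply/andP; split; lra.
have cw : conv w (fun i => ev (Y i) z) by move=> i; apply: ev_le (hY i) cz.
have bc := bnd_comp v0 nc hY hf'.
apply: (@is_ev_unique _ _ f (fun i => ev (Y i) z)); last exact: evP hf cw.
(* [fcomp f Y - P] has norm at most [M + M] and order at least [N]; [ev_deg] adds the factor [2]. *)
exists (2 * (M + M)) => N.
pose P := psubst Y (ftrunc N f).
have bP : bnd v M P.
  apply: bnd_le (hf' N) _; rewrite /P psubst_trunc /snorm; apply: bnd_sum => // m _.
  by apply: bndZ => //; apply: bnd_mmap1.
have <- : ev P z = pev N f (fun i => ev (Y i) z).
  rewrite /P psubst_trunc (@ev_sum _ _ v _ _ _ (fun m : bmultinom n N => cabs (cf f m) * mmap1 (fun i => w i / 2) m)) //.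
    apply: eq_bigr => m _.
    by rewrite (evZ _ (bnd_mmap1 m v0 hY) cz) (ev_mmap1 _ hY cz).
  by move=> m _; apply: bndZ => //; apply: bnd_mmap1.
rewrite -(evN bP cz) -(evD bc (bndN bP) cz).
apply: ev_deg (bndB v0 bc bP) cz _.
by apply/eqt_sub; apply: fcomp_eqt.
Qed.

(** * Germs and their series *)

Section HasSeries.
Variables (R : realType).
Local Notation C := (Cx R).

Definition cst_w n (r : R) : 'I_n -> R := fun=> r.
Arguments cst_w n r _ : clear implicits.
Definition rep n r (f : ('I_n -> C) -> C) (F : fps C n) :=
  (exists M, bnd (cst_w n r) M F) /\
  forall z, (forall i, cabs (z i) <= r / 2) -> f z = ev F z.
(** The dictionary between the germs of the statement and formal series: [F] is the expansion of [f]
    at the origin. Identities pass from series to germs by [hs_agree] and from germs to series by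
    [hs_inj]. *)
Definition hs n (f : ('I_n -> C) -> C) (F : fps C n) := exists2 r, 0 < r & rep r f F.

Lemma rep_le n r r' (f : ('I_n -> C) -> C) F : 0 < r' <= r -> rep r f F -> rep r' f F.
Proof.
move=> /andP[r0 le] [[M b] h]; split.
  by exists M; apply: bnd_w b => i; rewrite /cst_w ltW.
by move=> z hz; apply: h => i; apply: le_trans (hz i) _; rewrite ler_pM2r // invr_gt0.
Qed.

Lemma hs_common n m (f : 'I_m -> ('I_n -> C) -> C) F :
  (forall i, hs (f i) (F i)) -> exists2 r, 0 < r & forall i, rep r (f i) (F i).
Proof.
move=> h; suff [r r0 H] : exists2 r, 0 < r & forall i, i \in enum 'I_m -> rep r (f i) (F i).
  by exists r => // i; apply: H; rewrite mem_enum.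
elim: (enum _) => [|i s [r r0 IH]]; first by exists 1.
have [r' r'0 h'] := h i; have m0 : 0 < Num.min r r' by rewrite lt_min r0.
exists (Num.min r r') => // j; rewrite inE => /predU1P[->|/IH hj].
  by apply: rep_le h'; rewrite m0 ge_min lexx orbT.
by apply: rep_le hj; rewrite m0 ge_min lexx.
Qed.

Lemma hs_common2 n (f g : ('I_n -> C) -> C) F G : hs f F -> hs g G ->
  exists2 r, 0 < r & rep r f F /\ rep r g G.
Proof.
move=> [r r0 hf] [r' r'0 hg]; have m0 : 0 < Num.min r r' by rewrite lt_min r0.
exists (Num.min r r') => //; split.
  by apply: rep_le hf; rewrite m0 ge_min lexx.
by apply: rep_le hg; rewrite m0 ge_min lexx orbT.
Qed.

Lemma hsD n (f g : ('I_n -> C) -> C) F G : hs f F -> hs g G ->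
  hs (fun z => f z + g z) (F + G).
Proof.
move=> hf hg; have [r r0 [[[M bf] h1] [[M' bg] h2]]] := hs_common2 hf hg.
exists r => //; split; first by exists (M + M'); apply: bndD => // i; apply: ltW.
by move=> z cz; rewrite h1 // h2 // (evD bf bg).
Qed.
Lemma hsM n (f g : ('I_n -> C) -> C) F G : hs f F -> hs g G ->
  hs (fun z => f z * g z) (F * G).
Proof.
move=> hf hg; have [r r0 [[[M bf] h1] [[M' bg] h2]]] := hs_common2 hf hg.
exists r => //; split; first by exists (M * M'); apply: bndM => // i; apply: ltW.
by move=> z cz; rewrite h1 // h2 // (evM bf bg).
Qed.
Lemma hsN n (f : ('I_n -> C) -> C) F : hs f F -> hs (fun z => - f z) (- F).
Proof.
move=> [r r0 [[M b] h]]; exists r => //; split; first by exists M; apply: bndN.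
by move=> z cz; rewrite h // (evN b).
Qed.
Lemma hsB n (f g : ('I_n -> C) -> C) F G : hs f F -> hs g G ->
  hs (fun z => f z - g z) (F - G).
Proof. by move=> hf hg; apply: hsD => //; apply: hsN. Qed.
Lemma hsC n c : hs (fun=> c) (fps_const n c : fps C n).
Proof.
exists 1 => //; have w0 : forall j : 'I_n, 0 <= cst_w n 1 j by move=> j; rewrite /cst_w.
split; first by exists (cabs c); apply: bndC.
by move=> z cz; rewrite -[fps_const n c]mulr1 (evZ _ (bnd1 w0)) // ev1 mulr1.
Qed.
Lemma hs1 n : hs (fun=> 1) (1 : fps C n).
Proof. exact: hsC. Qed.
Lemma hsX n (i : 'I_n) : hs (fun z => z i) (fX C i).
Proof.
exists 1 => //; have w0 : forall j : 'I_n, 0 <= cst_w n 1 j by move=> j; rewrite /cst_w.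
split; first by exists (cst_w n 1 i); apply: bndX.
by move=> z cz; rewrite evX.
Qed.
Lemma hs_pow n (f : ('I_n -> C) -> C) F k : hs f F -> hs (fun z => f z ^+ k) (F ^+ k).
Proof.
move=> h; elim: k => [|k IH]; first exact: hs1.
have := hsM h IH; rewrite -exprS => -[r r0 [b e]]; exists r => //; split=> // z cz.
by rewrite exprS e.
Qed.

Lemma hs_ext n (f g : ('I_n -> C) -> C) F : hs f F ->
  (exists2 r, 0 < r & forall z, (forall i, cabs (z i) < r) -> f z = g z) -> hs g F.
Proof.
move=> [r r0 hf] [r' r'0 h]; exists (Num.min r r'); first by rewrite lt_min r0.
have m0 : 0 < Num.min r r' <= r by rewrite lt_min r0 r'0 ge_min lexx.
have [b e] := rep_le m0 hf; split=> // z cz; rewrite -e // h // => i.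
apply: le_lt_trans (cz i) _; rewrite ltr_pdivrMr //.
have : Num.min r r' <= r' by rewrite ge_min lexx orbT.
by move=> le; apply: le_lt_trans le _; lra.
Qed.
Lemma hs_ext0 n (f g : ('I_n -> C) -> C) F : hs f F -> (forall z, f z = g z) -> hs g F.
Proof. by move=> h e; apply: hs_ext h _; exists 1. Qed.

Lemma hs_agree n (f g : ('I_n -> C) -> C) F : hs f F -> hs g F ->
  exists2 r, 0 < r & forall z, (forall i, cabs (z i) < r) -> f z = g z.
Proof.
move=> hf hg; have [r r0 [[_ h1] [_ h2]]] := hs_common2 hf hg.
by exists (r / 2); [rewrite divr_gt0|move=> z cz; rewrite h1 ?h2 // => i; rewrite ltW].
Qed.

Lemma hs_ev n w r M (F : fps C n) : 0 < r -> (forall i, r <= w i) -> bnd w M F -> hs (ev F) F.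
Proof.
move=> r0 hr b; exists r => //; split=> //; exists M; apply: bnd_w b => i.
by rewrite /cst_w (ltW r0) hr.
Qed.

Lemma hs_ev_self n (f : ('I_n -> C) -> C) F : hs f F -> hs (ev F) F.
Proof. by move=> [r r0 [[M b] _]]; apply: (hs_ev r0 _ b) => i. Qed.

Lemma nocst_deg n (F : fps C n) : cf F mnm0 = 0 -> deg_ge 1 F.
Proof.
by move=> h m nz; rewrite lt0n mdeg_eq0; case: eqP => // e; rewrite e in nz.
Qed.

Lemma hs_comp n k (f : ('I_n -> C) -> C) F (y : 'I_n -> ('I_k -> C) -> C) Y :
  hs f F -> (forall i, hs (y i) (Y i)) -> nocst Y ->
  hs (fun z => f (fun i => y i z)) (fcomp F Y).
Proof.
move=> [r r0 [[M b] h]] hY nc; have [r1 r10 h1] := hs_common hY.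
have [M1 M10 b1] : exists2 M1, 0 < M1 & forall i, bnd (cst_w k r1) M1 (Y i).
  have [g hg] := choice (fun i => (h1 i).1).
  have w0 : forall i : 'I_k, 0 <= cst_w k r1 i by move=> i; apply: ltW.
  have g0 i : 0 <= g i by apply: bnd_ge0 (hg i).
  exists (1 + \sum_i g i); first by rewrite ltr_pwDl // sumr_ge0.
  move=> i; apply: bnd_le (hg i); rewrite (bigD1 i) //=.
  by rewrite addrCA lerDl addr_ge0 // sumr_ge0.
(* Shrinking the polydisc by [s] multiplies the norm of each [Y i] by at most [s], as there is no
   constant term; this [s] brings it below [r / 2]. *)
pose s := Num.min 1 (r / 2 / M1).
have s0 : 0 < s by rewrite lt_min ltr01 !divr_gt0.
have s1 : s <= 1 by rewrite ge_min lexx.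
have bY i : bnd (cst_w k (s * r1)) (cst_w n r i / 2) (Y i).
  have w0 : forall i : 'I_k, 0 <= cst_w k r1 i by move=> i'; apply: ltW.
  apply: bnd_le (_ : s * M1 <= _) _; last first.
    by apply: bnd_shrink (b1 i) => //; [rewrite (ltW s0)|apply: nocst_deg].
  by rewrite /cst_w -ler_pdivlMr // ge_min lexx orbT.
have v0 : forall i : 'I_k, 0 <= cst_w k (s * r1) i by move=> i; rewrite mulr_ge0 // ltW.
exists (s * r1); first by rewrite mulr_gt0.
split; first exists M.
  apply: bnd_comp nc bY _ => //; apply: bnd_w b => i; rewrite /cst_w; apply/andP; split; lra.
move=> z cz; rewrite (ev_comp nc bY b cz).
have e i : y i z = ev (Y i) z.
  apply: (h1 i).2 => j; apply: le_trans (cz j) _.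
  by rewrite ler_pM2r // ger_pMl.
under [in LHS]eq_fun do rewrite e.
by apply: h => i; apply: ev_le (bY i) cz.
Qed.

End HasSeries.
Arguments cst_w {R} n r _.

Lemma bm_shift (V : nmodType) n N (i : 'I_n) (G : multinom n -> V) :
  \sum_(m : bmultinom n N) G (mnm_add m (mU i)) =
  \sum_(m : bmultinom n N.+1 | (0 < (m : multinom n) i)%N) G m.
Proof.
have lt (m : bmultinom n N) : (mdeg (mnm_add m (mU i)) < N.+1)%N.
  by rewrite mdegD mdeg1 addn1 ltnS bmdeg.
rewrite (reindex_omap (fun m => BMultinom (lt m)) (fun m => insub (mnm_sub m (mU i)))) /=.
  apply: eq_bigl => m; rewrite addmK mnmDE mnm1E eqxx addn1 /=.
  by case: insubP => [u _ /val_inj ->|]; rewrite ?eqxx // bmdeg.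
move=> m pos; have le : lem (mU i) m by rewrite lep1mP -lt0n.
case: insubP => [u _ e|] /=.
  by congr Some; apply: val_inj; rewrite /= e submK.
have := bmdeg m; rewrite -{1}(submK le) mdegD mdeg1 addn1 ltnS => ->//.
Qed.

(** * Derivatives of convergent series and the identity theorem *)

Section Derivative.
Variables (R : realType) (n : nat).
Local Notation C := (Cx R).
Implicit Types (F : fps C n) (z : 'I_n -> C).

Definition zadd z (i : 'I_n) (t : C) : 'I_n -> C := fun j => if j == i then z j + t else z j.

(** A Cauchy estimate: halving the radius gains [2 ^- mdeg m], which absorbs the factor [(m i).+1]
    because [(m i).+1 <= 2 ^ m i]. *)
Lemma bnd_fder r M F i : 0 < r -> bnd (cst_w n r) M F ->
  bnd (cst_w n (r / 2)) (M / r) (fder i F).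
Proof.
move=> r0 b N; have w0 : forall i : 'I_n, 0 <= cst_w n r i by move=> j; apply: ltW.
apply: le_trans (_ : snorm (cst_w n r) N.+1 F / r <= _); last first.
  by rewrite ler_pM2r ?invr_gt0.
pose G m := cabs (cf F m) * mmap1 (cst_w n r) m.
have G0 m : 0 <= G m by rewrite mulr_ge0 ?cabs_ge0 ?mmap1_ge0.
apply: le_trans (_ : (\sum_(m : bmultinom n N) G (mnm_add m (mU i))) / r <= _).
  rewrite mulr_suml; apply: ler_sum => m _; rewrite /G mmap1D mmap1U /cst_w.
  rewrite mulrA mulfK ?gt_eqF //=.
  have -> : cabs (cf F (mnm_add m (mU i)) *+ (m i).+1) = cabs (cf F (mnm_add m (mU i))) * (m i).+1%:R.
    by rewrite -[in LHS]mulr_natr cabsM cabs_nat.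
  rewrite -mulrA ler_wpM2l ?cabs_ge0 //.
  have -> : mmap1 (fun _ : 'I_n => r / 2) m = 2^-1 ^+ mdeg m * mmap1 (fun=> r) m.
    by rewrite -mmap1_scale; congr mmap1; apply/funext => j; rewrite mulrC.
  rewrite mulrA ler_piMl ?mmap1_ge0 // exprVn ler_pdivrMr ?exprn_gt0 // mul1r.
  rewrite -natrX ler_nat; apply: leq_trans (_ : 2 ^ m i <= _)%N.
    exact: ltn_expl.
  by rewrite leq_exp2l // mdegE (bigD1 i) //= leq_addr.
rewrite ler_pM2r ?invr_gt0 // (bm_shift N i G) /snorm.
rewrite [leRHS](bigID (fun m : bmultinom n N.+1 => (0 < (m : multinom n) i)%N)) /= lerDl.
by apply: sumr_ge0 => m _; apply: G0.
Qed.

(** Since [a + t] has modulus at most [r / 2], the induction hypothesis uses up half of the new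
    bound; the other half covers [t ^+ 2 * (k%:R * a ^+ k.-1)]. *)
Lemma taylor_pow (r : R) (a t : C) k : 0 < r -> cabs a <= r / 4 -> cabs t <= r / 4 ->
  cabs ((a + t) ^+ k - a ^+ k - t * (k%:R * a ^+ k.-1)) <= cabs t ^+ 2 * (4 / r ^+ 2 * r ^+ k).
Proof.
move=> r0 ha ht; elim: k => [|k IH].
  rewrite !expr0 mul0r mulr0 subrr subr0 cabs0 mulr1.
  by rewrite mulr_ge0 ?exprn_ge0 ?cabs_ge0 // divr_ge0 // exprn_ge0 // ltW.
have -> : (a + t) ^+ k.+1 - a ^+ k.+1 - t * (k.+1%:R * a ^+ k.+1.-1) =
   (a + t) * ((a + t) ^+ k - a ^+ k - t * (k%:R * a ^+ k.-1)) + t ^+ 2 * (k%:R * a ^+ k.-1).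
  case: k {IH} => [|k] /=; first by rewrite !expr0 !expr1; ring.
  by rewrite !exprS; ring.
apply: le_trans (cabsD _ _) _.
have -> : cabs (t ^+ 2 * (k%:R * a ^+ k.-1)) = cabs t ^+ 2 * (k%:R * cabs (a ^+ k.-1)).
  by rewrite cabsM cabsX cabsM cabs_nat.
rewrite cabsM.
have hat : cabs (a + t) <= r / 2 by apply: le_trans (cabsD _ _) _; lra.
have h1 := ler_pM (cabs_ge0 _) (cabs_ge0 _) hat IH.
have h2 : k%:R * cabs (a ^+ k.-1) <= 2 / r ^+ 2 * r ^+ k.+1.
  case: k {IH h1} => [|k] /=.
    by rewrite mul0r !mulr_ge0 ?invr_ge0 ?exprn_ge0 // ltW.
  have -> : 2 / r ^+ 2 * r ^+ k.+2 = 2 * r ^+ k.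
    by rewrite !exprS expr0; field; rewrite gt_eqF.
  rewrite cabsX; apply: le_trans (_ : k.+1%:R * (r / 4) ^+ k <= _).
    by rewrite ler_wpM2l // lerXn2r // nnegrE ?cabs_ge0 // divr_ge0 // ltW.
  rewrite exprMn mulrCA mulrC ler_wpM2r ?exprn_ge0 ?(ltW r0) // exprVn ler_pdivrMr ?exprn_gt0 //.
  rewrite -natrX -natrM ler_nat.
  have := ltn_expl k.+1 (isT : (1 < 2)%N); rewrite expnS => /ltnW h.
  apply: leq_trans h _; rewrite leq_mul2l /=; by case: (k) => // l; rewrite leq_exp2r.
have h3 := ler_wpM2l (exprn_ge0 2 (cabs_ge0 t)) h2.
apply: le_trans (lerD h1 h3) _.
rewrite le_eqVlt; apply/orP; left; apply/eqP; rewrite [r ^+ k.+1]exprS.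
by field; rewrite gt_eqF.
Qed.

Lemma mmap1_split (S : comNzRingType) (h : 'I_n -> S) m i :
  mmap1 h m = h i ^+ m i * \prod_(j | j != i) h j ^+ m j.
Proof. by rewrite /mmap1 (bigD1 i). Qed.

Lemma taylor_mon (r : R) z t i m : 0 < r -> (forall j, cabs (z j) <= r / 4) -> cabs t <= r / 4 ->
  cabs (mmap1 (zadd z i t) m - mmap1 z m - t * ((m i)%:R * mmap1 z (mnm_sub m (mU i))))
  <= cabs t ^+ 2 * (4 / r ^+ 2 * mmap1 (cst_w n r) m).
Proof.
move=> r0 hz ht; rewrite !(mmap1_split _ _ i) mnmBE mnm1E eqxx subn1 {1}/zadd eqxx.
set Q := \prod_(j | j != i) z j ^+ m j.
have -> : \prod_(j | j != i) zadd z i t j ^+ m j = Q.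
  by apply: eq_bigr => j /negbTE ne; rewrite /zadd ne.
have -> : \prod_(j | j != i) z j ^+ (mnm_sub m (mU i)) j = Q.
  by apply: eq_bigr => j ne; rewrite mnmBE mnm1E eq_sym (negbTE ne) subn0.
have -> : (z i + t) ^+ m i * Q - z i ^+ m i * Q - t * ((m i)%:R * (z i ^+ (m i).-1 * Q)) =
  ((z i + t) ^+ m i - z i ^+ m i - t * ((m i)%:R * z i ^+ (m i).-1)) * Q by ring.
set Q' := \prod_(j | j != i) _.
have -> : cabs t ^+ 2 * (4 / r ^+ 2 * (cst_w n r i ^+ m i * Q')) =
  cabs t ^+ 2 * (4 / r ^+ 2 * r ^+ m i) * Q' by rewrite /cst_w; ring.
rewrite cabsM; apply: ler_pM; rewrite ?cabs_ge0 //; first exact: taylor_pow.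
rewrite /Q cabs_prod; apply: ler_prod => j _; rewrite cabs_ge0 cabsX /= /cst_w.
by rewrite lerXn2r ?nnegrE ?cabs_ge0 ?(ltW r0) //; have := hz j; lra.
Qed.

Lemma taylor_ev (r : R) M F z t i : 0 < r -> bnd (cst_w n r) M F ->
  (forall j, cabs (z j) <= r / 4) -> cabs t <= r / 4 ->
  cabs (ev F (zadd z i t) - ev F z - t * ev (fder i F) z) <= cabs t ^+ 2 * (4 / r ^+ 2 * M).
Proof.
move=> r0 b hz ht; have w0 : forall i : 'I_n, 0 <= cst_w n r i by move=> j; apply: ltW.
have c1 : conv (cst_w n r) z by move=> j; rewrite /cst_w; have := hz j; lra.
have c2 : conv (cst_w n r) (zadd z i t).
  move=> j; rewrite /cst_w /zadd; case: ifP => _; last by have := hz j; lra.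
  by apply: le_trans (cabsD _ _) _; have := hz j; lra.
have c3 : conv (cst_w n (r / 2)) z by move=> j; rewrite /cst_w; have := hz j; lra.
have bd := bnd_fder i r0 b.
set X := cabs _; set Y := _ * _; rewrite leNgt; apply/negP => lt.
have h N : X - Y <= (2 * M + 2 * M + (cabs t * (2 * (M / r)))) / 2 ^+ N.
  (* The derivative of the truncation of [F] at [N.+1] is the truncation of [fder i F] at [N], so
     the two orders of truncation differ by one. *)
  have e1 := ev_bound N.+1 b c1; have e2 := ev_bound N.+1 b c2; have e3 := ev_bound N bd c3.
  have p2 : (2 ^+ N.+1 : R)^-1 <= (2 ^+ N)^-1 by apply: pow2_le.
  have M0 := bnd_ge0 w0 b.
  have p3 : 2 * M / 2 ^+ N.+1 <= 2 * M / 2 ^+ N by rewrite ler_wpM2l // mulr_ge0.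
  have P : cabs (pev N.+1 F (zadd z i t) - pev N.+1 F z - t * pev N (fder i F) z) <= Y.
    have -> : pev N (fder i F) z = \sum_(m : bmultinom n N.+1)
        cf F m * ((m i)%:R * mmap1 z (mnm_sub m (mU i))).
      rewrite [RHS](bigID (fun m : bmultinom n N.+1 => (0 < (m : multinom n) i)%N)) /=.
      rewrite [X in _ + X]big1 ?addr0; last first.
        by move=> m; rewrite -eqn0Ngt => /eqP ->; rewrite mul0r mulr0.
      rewrite -(bm_shift N i (fun m => cf F m * ((m i)%:R * mmap1 z (mnm_sub m (mU i))))).
      apply: eq_bigr => m _; rewrite addmK mnmDE mnm1E eqxx addn1.
      have -> : cf (fder i F) m = cf F (mnm_add m (mU i)) * (m i).+1%:R by rewrite mulr_natr.
      by rewrite -mulrA.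
    rewrite /pev mulr_sumr -!sumrB /=; apply: le_trans (cabs_sum _ _ _) _.
    apply: le_trans (_ : cabs t ^+ 2 * (4 / r ^+ 2 * snorm (cst_w n r) N.+1 F) <= _); last first.
      rewrite ler_wpM2l ?exprn_ge0 ?cabs_ge0 // ler_wpM2l //.
      by rewrite divr_ge0 // exprn_ge0 // ltW.
    rewrite /snorm !mulr_sumr; apply: ler_sum => m _.
    have -> : cf F m * mmap1 (zadd z i t) m - cf F m * mmap1 z m -
         t * (cf F m * ((m i)%:R * mmap1 z (mnm_sub m (mU i)))) =
        cf F m * (mmap1 (zadd z i t) m - mmap1 z m - t * ((m i)%:R * mmap1 z (mnm_sub m (mU i)))) by ring.
    rewrite cabsM; have := ler_wpM2l (cabs_ge0 (cf F m)) (taylor_mon i m r0 hz ht).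
    by move=> le; apply: le_trans le _; rewrite le_eqVlt; apply/orP; left; apply/eqP; ring.
  have e3' := ler_wpM2l (cabs_ge0 t) e3; rewrite -cabsM in e3'.
  rewrite /X.
  have key (a a' c d d' c' : C) : a - a' - t * c =
    (a - d) - (a' - d') - t * (c - c') + (d - d' - t * c') by ring.
  rewrite (key _ _ _ (pev N.+1 F (zadd z i t)) (pev N.+1 F z) (pev N (fder i F) z)).
  apply: le_trans (lerB (cabsD _ _) (lexx _)) _.
  have q1 := cabsB (ev F (zadd z i t) - pev N.+1 F (zadd z i t) - (ev F z - pev N.+1 F z))
     (t * (ev (fder i F) z - pev N (fder i F) z)).
  have q2 := cabsB (ev F (zadd z i t) - pev N.+1 F (zadd z i t)) (ev F z - pev N.+1 F z).
  have -> : (2 * M + 2 * M + cabs t * (2 * (M / r))) / 2 ^+ N =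
     2 * M / 2 ^+ N + 2 * M / 2 ^+ N + cabs t * (2 * (M / r) / 2 ^+ N) by ring.
  lra.
by have := le_half_pow _ h; lra.
Qed.

Lemma hs_taylor (f : ('I_n -> C) -> C) F i : hs f F ->
  exists2 r, 0 < r & exists2 K, 0 <= K & forall z t,
    (forall j, cabs (z j) <= r) -> cabs t <= r ->
    cabs (f (zadd z i t) - f z - t * ev (fder i F) z) <= cabs t ^+ 2 * K.
Proof.
move=> [r r0 [[M b] h]]; exists (r / 4); first by rewrite divr_gt0.
have w0 : forall i : 'I_n, 0 <= cst_w n r i by move=> j; apply: ltW.
exists (4 / r ^+ 2 * M).
  by rewrite mulr_ge0 ?divr_ge0 ?exprn_ge0 ?(ltW r0) // (bnd_ge0 w0 b).
move=> z t hz ht; rewrite !h; first exact: taylor_ev.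
  by move=> j; have := hz j; lra.
move=> j; rewrite /zadd; case: ifP => _; last by have := hz j; lra.
by apply: le_trans (cabsD _ _) _; have := hz j; lra.
Qed.

Lemma hs_fder (f : ('I_n -> C) -> C) F i : hs f F -> hs (ev (fder i F)) (fder i F).
Proof.
move=> [r r0 [[M b] _]]; have r2 : 0 < r / 2 by rewrite divr_gt0.
exact: hs_ev r2 (fun=> lexx _) (bnd_fder i r0 b).
Qed.

(** Induction on the degree. The constant term is the value at the origin; for the rest, the partial
    derivatives also represent the zero germ, by the Taylor estimate at [t = r / 2 ^+ N]. *)
Lemma hs0_eq0 F : hs (fun=> 0) F -> F = 0.
Proof.
suff H m : forall F, hs (fun=> 0) F -> cf F m = 0 by move=> h; apply: fpsP => m; apply: H.
have [d] := ubnP (mdeg m); elim: d m => // d IH m lt {}F h.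
have [m0|] := eqVneq m mnm0.
  have [r r0 [[M b] e]] := h; have c0 : conv (cst_w n r) (fun=> 0).
    by move=> j; rewrite cabs0 /cst_w divr_ge0 // ltW.
  have e0 : 0 = ev F (fun=> 0) by apply: e => j; rewrite cabs0 divr_ge0 // ltW.
  apply: cabs_eq0; apply: (@le_half_pow _ _ (2 * M * 2)); first exact: cabs_ge0.
  move=> N; have := ev_bound N.+1 b c0; rewrite -e0 sub0r cabsN.
  have -> : pev N.+1 F (fun=> 0) = cf F m.
    rewrite /pev (bigD1 bm0) //= m0 mmap11 mulr1 big1 ?addr0 // => k ne.
    have [i ni] : exists i, (k : multinom n) i != 0%N.
      apply: contrapT => H; case/negP: ne; apply/eqP/val_inj/mnmP => i.
      rewrite mnm0E; apply/eqP; apply: contrapT => /negP ni; apply: H; by exists i.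
    by rewrite (mmap1_split _ _ i) expr0n (negbTE ni) mul0r mulr0.
  move=> le; apply: le_trans le _; rewrite exprS.
  rewrite invfM mulrA ler_wpM2r ?invr_ge0 ?exprn_ge0 //.
  have M0 : 0 <= M by apply: bnd_ge0 b => i; apply: ltW.
  lra.
rewrite -mdeg_eq0 => nz.
have [i ni] : exists i, m i != 0%N.
  apply: contrapT => H; case/negP: nz; rewrite mdegE big1 // => i _.
  by apply/eqP; apply: contrapT => /negP ni; apply: H; exists i.
have le : lem (mU i) m by rewrite lep1mP.
have hd : hs (fun=> 0) (fder i F).
  have [r r0 [K K0 T]] := hs_taylor i h.
  apply: hs_ext (hs_fder i h) _; exists r => // z hz.
  apply: cabs_eq0; apply: (@le_half_pow _ _ (r * K)); first exact: cabs_ge0.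
  move=> N; have p0 : 0 < r / 2 ^+ N by rewrite divr_gt0 ?exprn_gt0.
  have := T z (((r / 2 ^+ N)%:C)%C) (fun j => ltW (hz j)).
  rewrite subrr sub0r cabsN cabsM cabs_real ?(ltW p0) //.
  have le1 : r / 2 ^+ N <= r.
    by rewrite ler_pdivrMr ?exprn_gt0 // ler_peMr ?(ltW r0) // exprn_ege1 // ler1n.
  move=> /(_ le1); rewrite expr2 -mulrA ler_pM2l // => le2.
  by apply: le_trans le2 _; rewrite mulrAC.
have := IH (mnm_sub m (mU i)) _ _ hd.
rewrite /= submK // mnmBE mnm1E eqxx.
have -> : (m i - 1%N).+1 = m i by case: (m i) ni => // k _; rewrite subn1.
move=> H; have lt' : (mdeg (mnm_sub m (mU i)) < d)%N.
  by move: lt; rewrite -{1}(submK le) mdegD mdeg1 addn1 ltnS.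
have /eqP := H lt'; rewrite -mulr_natr mulf_eq0 pnatr_eq0 (negbTE ni) orbF.
by move/eqP.
Qed.

Lemma hs_inj (f : ('I_n -> C) -> C) F G : hs f F -> hs f G -> F = G.
Proof.
move=> h1 h2; apply/eqP; rewrite -subr_eq0; apply/eqP; apply: hs0_eq0.
by apply: hs_ext0 (hsB h1 h2) _ => z; rewrite subrr.
Qed.

End Derivative.

(** * Comparison with the analytic germs and derivatives of the statement *)

Section Interface.
Variables (R : realType).
Local Notation C := (Cx R).

Definition mnF n (k : 'I_n -> nat) : multinom n := Multinom (mktuple k).

Lemma mnFE n (k : 'I_n -> nat) i : mnF k i = k i.
Proof. exact: mnmE. Qed.

(** The partial sums of the statement run over boxes of exponents, those of [pev] over the total
    degree. A box of side [N] contains all degrees below [N] and lies in degrees at most [n * N]. *)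
Lemma box_sum (V : nmodType) n N B (G : multinom n -> V) : (n * N < B)%N ->
  \sum_(k : {ffun 'I_n -> 'I_N}) G (mnF (fun i => nat_of_ord (k i))) =
  \sum_(m : bmultinom n B | [forall i, ((m : multinom n) i < N)%N]) G m.
Proof.
move=> lt.
have dg (k : {ffun 'I_n -> 'I_N}) : (mdeg (mnF (fun i => nat_of_ord (k i))) < B)%N.
  apply: leq_ltn_trans lt; rewrite mdegE -[X in (_ <= X * _)%N]card_ord -sum_nat_const.
  by apply: leq_sum => i _; rewrite mnFE ltnW.
pose h k := BMultinom (dg k).
have hinj : injective h.
  move=> k1 k2 /(congr1 (fun m : bmultinom n B => m : multinom n)) /= /mnmP e.
  by apply/ffunP => i; apply: val_inj; have := e i; rewrite !mnFE.
rewrite (reindex_omap h (fun m => [pick k | h k == m])) /=.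
  apply: eq_bigl => k; case: pickP => [k' /eqP /hinj ->|/(_ k)]; last by rewrite eqxx.
  by rewrite eqxx andbT; apply/esym/forallP => i; rewrite /= mnFE.
move=> m /forallP hm; case: pickP => [k /eqP <- //|].
move=> /(_ [ffun i => Ordinal (hm i)]) /negP []; apply/eqP/val_inj/mnmP => i /=.
by rewrite mnFE ffunE.
Qed.

Lemma mmap1_cst n (r : R) (m : multinom n) : mmap1 (cst_w n r) m = r ^+ mdeg m.
Proof. by rewrite /mmap1 mdegE prodrXr. Qed.

Definition box_norm n (F : fps C n) (r : R) N : R :=
  \sum_(k : {ffun 'I_n -> 'I_N})
    cabs (cf F (mnF (fun i => nat_of_ord (k i)))) * r ^+ mdeg (mnF (fun i => nat_of_ord (k i))).

Lemma snorm_box n (F : fps C n) r N : 0 <= r -> snorm (cst_w n r) N F <= box_norm F r N.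
Proof.
move=> r0; pose G (m : multinom n) := cabs (cf F m) * r ^+ mdeg m.
have G0 m : 0 <= G m by rewrite mulr_ge0 ?cabs_ge0 ?exprn_ge0.
have lt : (n * N < (n * N).+1 + N)%N by lia.
rewrite /box_norm (box_sum G lt).
have le : (N <= (n * N).+1 + N)%N by lia.
rewrite /snorm (bm_widen (fun m => cabs (cf F m) * mmap1 (cst_w n r) m) le).
rewrite [leRHS](bigID (fun m : bmultinom n ((n * N).+1 + N) => (mdeg m < N)%N)) /=.
apply: ler_wpDr; first by apply: sumr_ge0.
rewrite le_eqVlt; apply/orP; left; apply/eqP.
apply: eq_big => [m|m _]; last by rewrite mmap1_cst.
case: (ltnP (mdeg m) N) => h; rewrite ?andbF // andbT; apply/esym/forallP => i.
by apply: leq_ltn_trans h; rewrite mdegE (bigD1 i) //= leq_addr.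
Qed.

Lemma box_snorm n (F : fps C n) r N : 0 <= r ->
  box_norm F r N <= snorm (cst_w n r) (n * N).+1 F.
Proof.
move=> r0; pose G (m : multinom n) := cabs (cf F m) * r ^+ mdeg m.
rewrite /box_norm (box_sum G (ltnSn (n * N)%N)) /snorm.
rewrite [leRHS](bigID (fun m : bmultinom n (n * N).+1 => [forall i, ((m : multinom n) i < N)%N])) /=.
apply: ler_wpDr; first by apply: sumr_ge0 => m _; rewrite mulr_ge0 ?cabs_ge0 // mmap1_cst exprn_ge0.
by rewrite le_eqVlt; apply/orP; left; apply/eqP; apply: eq_bigr => m _; rewrite mmap1_cst.
Qed.

Lemma psum_pev n (F : fps C n) r M N (z : 'I_n -> C) : 0 <= r ->
  bnd (cst_w n r) M F -> conv (cst_w n r) z ->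
  cabs (psum (fun k => cf F (mnF k)) N z - pev N F z) <= M / 2 ^+ N.
Proof.
move=> r0 b cz; pose G (m : multinom n) := cf F m * mmap1 z m.
have lt : (n * N < (n * N).+1 + N)%N by lia.
have -> : psum (fun k => cf F (mnF k)) N z =
   \sum_(m : bmultinom n ((n * N).+1 + N) | [forall i, ((m : multinom n) i < N)%N]) G m.
  rewrite -(box_sum G lt); apply: eq_bigr => k _; congr (_ * _).
  by rewrite /monom /mmap1; apply: eq_bigr => i _; rewrite mnFE.
have le : (N <= (n * N).+1 + N)%N by lia.
rewrite /pev (bm_widen G le).
rewrite [X in X - _](bigID (fun m : bmultinom n ((n * N).+1 + N) => (mdeg m < N)%N)) /=.
rewrite (eq_bigl (fun m : bmultinom n ((n * N).+1 + N) => (mdeg m < N)%N)); last first.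
  move=> m; case: (ltnP (mdeg m) N) => h; rewrite ?andbF // andbT; apply/forallP => i.
  by apply: leq_ltn_trans h; rewrite mdegE (bigD1 i) //= leq_addr.
rewrite addrAC subrr add0r; apply: le_trans (partial_bound (N := N) _ cz _) _.
  by move=> m /andP[_]; rewrite -leqNgt.
rewrite ler_wpM2r ?invr_ge0 ?exprn_ge0 //; apply: le_trans (b ((n * N).+1 + N)%N).
rewrite /snorm [leRHS](bigID (fun m : bmultinom n ((n * N).+1 + N) =>
  [forall i, ((m : multinom n) i < N)%N] && ~~ (mdeg m < N)%N)) /= lerDl.
by apply: sumr_ge0 => m _; rewrite mulr_ge0 ?cabs_ge0 // mmap1_cst exprn_ge0.
Qed.

Lemma half_pow_lt (e B : R) : 0 < e -> exists N, B / 2 ^+ N < e.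
Proof.
move=> e0; apply: contrapT => H.
have h N : e <= B / 2 ^+ N by rewrite leNgt; apply/negP => lt; apply: H; exists N.
by have := le_half_pow (ltW e0) h; lra.
Qed.

Lemma box_normC n (F : fps C n) (r : R) N :
  \sum_(k : {ffun 'I_n -> 'I_N})
     `|cf F (mnF (fun i => nat_of_ord (k i)))| * ((r%:C)%C : C) ^+ (\sum_(i < n) nat_of_ord (k i))
  = ((box_norm F r N)%:C)%C :> C.
Proof.
rewrite /box_norm (rmorph_sum (real_complex R)) /=; apply: eq_bigr => k _.
rewrite rmorphM rmorphXn /=; congr (_ * _ ^+ _).
by rewrite mdegE; apply: eq_bigr => i _; rewrite mnFE.
Qed.

Lemma ltc_cabs (x : C) (r : R) : (`|x| < ((r%:C)%C : C)) = (cabs x < r).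
Proof. by rewrite [`|x|]norm_cabs ltcR. Qed.

Lemma analytic_hs n (f : ('I_n -> C) -> C) : analytic_at0 f -> exists F, hs f F.
Proof.
move=> [a [r [r0 [[M hM] hf]]]].
pose F := Fps (fun m : multinom n => a (fun i => m i)).
have aF : a = fun k => cf F (mnF k).
  by apply/funext => k /=; congr a; apply/funext => i; rewrite mnFE.
exists F; exists r => //.
have b : bnd (cst_w n r) M F.
  move=> N; apply: le_trans (snorm_box F N (ltW r0)) _.
  by rewrite -lecR; have := hM N; rewrite {1}aF box_normC.
split; first by exists M.
move=> z cz; apply/eqP; rewrite -subr_eq0; apply/eqP; apply: cabs_eq0.
have hz i : `|z i| < ((r%:C)%C : C) by rewrite ltc_cabs; apply: le_lt_trans (cz i) _; lra.
have := hf z hz; rewrite aF => /cvgrPdist_lt H.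
apply/eqP; rewrite eq_le cabs_ge0 andbT leNgt; apply/negP => d0.
set d := cabs _ in d0.
have d20 : 0 < d / 2 by rewrite divr_gt0.
have d2 : 0 < (((d / 2)%:C)%C : C) by rewrite ltcR.
have [N0 _ HN] := H _ d2.
(* [M] bounds the gap between box sum and degree sum, [2 * M] the tail of the latter; with the box
   sum within [d / 2] of [f z], this gives [d < d]. *)
have [N1 lt1] := half_pow_lt (3 * M) d20.
have := HN (maxn N0 N1) (leq_maxl _ _); rewrite ltc_cabs.
set N := maxn N0 N1 => h1.
have h2 := psum_pev N (ltW r0) b cz; have h3 := ev_bound N b cz.
have M0 : 0 <= M by apply: bnd_ge0 b => i; apply: ltW.
have h4 : 3 * M / 2 ^+ N <= 3 * M / 2 ^+ N1.
  by rewrite ler_wpM2l ?mulr_ge0 // pow2_le // leq_maxr.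
set P := psum _ _ _ in h1 h2.
have e : f z - ev F z = (f z - P) + (P - pev N F z) - (ev F z - pev N F z) by ring.
have : d <= cabs (f z - P) + cabs (P - pev N F z) + cabs (ev F z - pev N F z).
  by rewrite /d e; apply: le_trans (cabsB _ _) _; rewrite lerD2r cabsD.
move: h4; have -> : 3 * M / 2 ^+ N = M / 2 ^+ N + 2 * M / 2 ^+ N by ring.
lra.
Qed.

Lemma hs_analytic n (f : ('I_n -> C) -> C) F : hs f F -> analytic_at0 f.
Proof.
move=> [r r0 [[M b] e]]; exists (fun k => cf F (mnF k)), (r / 2); split; first by rewrite divr_gt0.
have r20 : 0 <= r / 2 by rewrite divr_ge0 // ltW.
split.
  exists M => N; rewrite box_normC lecR; apply: le_trans (box_snorm F N r20) _.
  apply: (@bnd_w _ _ (cst_w n (r / 2)) (cst_w n r)) => // i; rewrite /cst_w r20 /=; lra.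
move=> z hz; have cz : conv (cst_w n r) z.
  by move=> i; have := hz i; rewrite ltc_cabs => /ltW.
apply/cvgrPdist_lt => eps e0.
have ee : eps = (((cabs eps)%:C)%C : C) by rewrite -[LHS](gtr0_norm e0) norm_cabs.
have ce0 : 0 < cabs eps by rewrite -ltcR -ee.
have M0 : 0 <= M by apply: bnd_ge0 b => i; apply: ltW.
have [N1 lt1] := half_pow_lt (3 * M) ce0.
exists N1 => // N /= le; rewrite ee ltc_cabs e //.
apply: le_lt_trans lt1.
have h2 := psum_pev N (ltW r0) b cz; have h3 := ev_bound N b cz.
apply: le_trans (_ : 3 * M / 2 ^+ N <= _); last first.
  by rewrite ler_wpM2l ?mulr_ge0 // pow2_le.
have -> : 3 * M / 2 ^+ N = 2 * M / 2 ^+ N + M / 2 ^+ N by ring.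
set P := psum _ _ _ in h2 *.
have -> : ev F z - P = (ev F z - pev N F z) - (P - pev N F z) by ring.
by apply: le_trans (cabsB _ _) _; apply: lerD.
Qed.

Lemma derive1_taylor (g : C -> C) a l (r K : R) : 0 < r -> 0 <= K ->
  (forall t, cabs t <= r -> cabs (g (a + t) - g a - t * l) <= cabs t ^+ 2 * K) ->
  derive1 g a = l.
Proof.
move=> r0 K0 h; rewrite /derive1; apply: cvg_lim => //.
apply/cvgrPdist_lt => eps e0.
have ee : eps = (((cabs eps)%:C)%C : C) by rewrite -[LHS](gtr0_norm e0) norm_cabs.
have ce0 : 0 < cabs eps by rewrite -ltcR -ee.
pose d := Num.min r (cabs eps / (K + 1)).
have K1 : 0 < K + 1 by rewrite ltr_wpDl.
have d0 : 0 < d by rewrite lt_min r0 divr_gt0.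
have dC : 0 < ((d%:C)%C : C) by rewrite ltcR.
rewrite ee; near=> t.
have tn0 : t != 0 by near: t; exact: nbhs_dnbhs_neq.
have : `|t| < ((d%:C)%C : C) by near: t; exact: dnbhs0_lt.
rewrite ltc_cabs => td; rewrite ltc_cabs.
have ct0 : 0 < cabs t by rewrite lt0r cabs_ge0 andbT; apply: contra_neq tn0 => /cabs_eq0.
have /= H := h t; have tr : cabs t <= r.
  by apply: ltW; apply: lt_le_trans td _; rewrite /d ge_min lexx.
have {}H := H tr.
rewrite -(ltr_pM2l ct0) -cabsM.
have -> : t * (l - t^-1 *: (g (t + a) - g a)) = - (g (a + t) - g a - t * l).
  rewrite [_ *: _]/(_ * _) mulrBr mulrA divff // mul1r (addrC t a); ring.
rewrite cabsN; apply: le_lt_trans H _.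
rewrite expr2 -mulrA ltr_pM2l //.
apply: le_lt_trans (_ : cabs t * (K + 1) < _).
  by rewrite ler_wpM2l ?cabs_ge0 // lerDl.
rewrite -ltr_pdivlMr //; apply: lt_le_trans td _.
by rewrite /d ge_min lexx orbT.
Unshelve. all: by end_near.
Qed.

End Interface.

(** For a polynomial [F] this holds because [fcomp _ Y] is a ring morphism; truncation reduces the
    general case to it. *)
Lemma fcomp_comp (K : comNzRingType) n k l (F : fps K n) (Z : 'I_n -> fps K k) (Y : 'I_k -> fps K l) :
  nocst Z -> nocst Y -> nocst (fun i => fcomp (Z i) Y) ->
  fcomp (fcomp F Z) Y = fcomp F (fun i => fcomp (Z i) Y).
Proof.
move=> ncZ ncY ncZY.
have H p : fcomp (psubst Z p) Y = psubst (fun i => fcomp (Z i) Y) p.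
  rewrite /psubst /mmap; elim: (msupp p) => [|m s IH].
    by rewrite !big_nil; have := fcompC Y 0; rewrite !raddf0.
  rewrite !big_cons fcompD IH fcompM // fcompC; congr (_ * _ + _).
  rewrite /mmap1; elim/big_rec2: _ => [|i x y _ <-]; first exact: (fcompC Y 1).
  rewrite fcompM //; congr (_ * _).
  elim: (m i) => [|d IHd]; first by rewrite !expr0; exact: (fcompC Y 1).
  by rewrite !exprS fcompM // IHd.
apply: eqt_eq => N; apply: eqt_trans (eqt_sym (fcomp_eqt F ncZY)).
rewrite -H; apply: eqt_trans (fcomp_eqt _ ncY) _.
apply: eqt_sym; apply: eqt_trans (fcomp_eqt _ ncY) _.
by apply: eqt_psubst => // m lt; rewrite !mcoeff_trunc lt (fcomp_eqt F ncZ lt).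
Qed.

Lemma nocst_comp (K : comNzRingType) n k l (Z : 'I_n -> fps K k) (Y : 'I_k -> fps K l) :
  nocst Z -> nocst Y -> nocst (fun i => fcomp (Z i) Y).
Proof.
move=> ncZ ncY i; have := deg_ge_psubst (N := 1) (p := ftrunc 1 (Z i)) ncY.
move=> h; rewrite (fcomp_eqt (N := 1) _ ncY) ?mdeg0 //; apply: (cf_spt_eq0 (h _)).
  move=> m; rewrite ltnS leqn0 mdeg_eq0 => /eqP ->; rewrite mcoeff_trunc mdeg0 /=; exact: ncZ.
by rewrite mdeg0.
Qed.

(* Convergence of the iteration is coefficientwise: every application of [Phi]
   stabilises one more degree of the grading [lev]. *)
Lemma graded_fixpoint (K : comNzRingType) n (T : Type) (lev : multinom n -> nat)
  (P : (T -> fps K n) -> Prop) (Phi : (T -> fps K n) -> T -> fps K n) Z0 :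
  P Z0 -> (forall Z, P Z -> P (Phi Z)) ->
  (forall Z Z' N, P Z -> P Z' -> (forall i, spt (fun m => (N <= lev m)%N) (Z i - Z' i)) ->
     forall i, spt (fun m => (N < lev m)%N) (Phi Z i - Phi Z' i)) ->
  (forall Z, (forall N, exists2 Z', P Z' &
     forall i, spt (fun m => (N <= lev m)%N) (Z i - Z' i)) -> P Z) ->
  exists2 Z, P Z & forall i, Phi Z i = Z i.
Proof.
move=> P0 PP contr closed; pose Zs k := iter k Phi Z0.
have PZ k : P (Zs k) by elim: k => //= k; apply: PP.
have step k i : spt (fun m => (k <= lev m)%N) (Zs k.+1 i - Zs k i).
  elim: k i => [|k IH] i; first by move=> m _.
  exact: (contr (Zs k.+1) (Zs k) k (PZ _) (PZ _) IH i).
have steps k d i : spt (fun m => (k <= lev m)%N) (Zs (k + d)%N i - Zs k i).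
  elim: d => [|d IH]; first by rewrite addn0 subrr; exact: spt0.
  rewrite addnS; have -> : Zs (k + d).+1 i - Zs k i = (Zs (k + d).+1 i - Zs (k + d)%N i) + (Zs (k + d)%N i - Zs k i) by ring.
  by apply: sptD => //; apply: spt_weak (step _ _) _ => m; apply: leq_trans; apply: leq_addr.
pose Z i := Fps (fun m => cf (Zs (lev m).+1 i) m).
have approx k i : spt (fun m => (k <= lev m)%N) (Z i - Zs k i).
  apply/sptP => m /negP; rewrite -ltnNge => lt.
  have := steps (lev m).+1 (k - (lev m).+1)%N i; rewrite subnKC // => /sptP/(_ m).
  rewrite ltnn => /(_ (fun h => notF h)); rewrite !cfB /= => /eqP.
  by rewrite subr_eq0 => /eqP ->; rewrite subrr.
have PZZ : P Z by apply: closed => N; exists (Zs N) => // i; apply: approx.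
exists Z => // i; apply: fpsP => m; apply/eqP; rewrite -subr_eq0; apply/eqP.
have := contr Z (Zs (lev m)) (lev m) PZZ (PZ _) (approx _) i.
move=> /sptP/(_ m); rewrite ltnn cfB => /(_ (fun h => notF h)) => /eqP.
rewrite subr_eq0 => /eqP ->.
have /sptP/(_ m) := approx (lev m).+1 i; rewrite ltnn cfB => /(_ (fun h => notF h))/eqP.
by rewrite subr_eq0 => /eqP ->; rewrite subrr.
Qed.

(** * Operators on coefficients *)

Section Operators.
Variables (K : comNzRingType) (n : nat).
Implicit Types (f g : fps K n) (m : multinom n).

Definition cmul (phi : multinom n -> K) f := Fps (fun m => phi m * cf f m).
(** Division by the variable [i] after discarding the monomials without it. *)
Definition dropv (i : 'I_n) f := Fps (fun m => cf f (mnm_add m (mU i))).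

Lemma cmulD phi f g : cmul phi (f + g) = cmul phi f + cmul phi g.
Proof. by apply: fpsP => m; rewrite /= mulrDr. Qed.
Lemma cmulB phi f g : cmul phi (f - g) = cmul phi f - cmul phi g.
Proof. by apply: fpsP => m; rewrite /= mulrBr. Qed.
Lemma dropvD i f g : dropv i (f + g) = dropv i f + dropv i g.
Proof. exact: fpsP. Qed.
Lemma dropvB i f g : dropv i (f - g) = dropv i f - dropv i g.
Proof. exact: fpsP. Qed.
Lemma spt_cmul_and S phi f : spt S f -> spt (fun m => S m /\ phi m <> 0) (cmul phi f).
Proof.
move=> h m nz; split; first by apply: h => e; apply: nz; rewrite /= e mulr0.
by move=> e; apply: nz; rewrite /= e mul0r.
Qed.
Lemma spt_dropv (S S' : multinom n -> Prop) i f : spt S f ->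
  (forall m, S (mnm_add m (mU i)) -> S' m) -> spt S' (dropv i f).
Proof. by move=> h hS m nz; apply/hS/h. Qed.
Lemma cf_XM i f m : cf (fX K i * f) (mnm_add m (mU i)) = cf f m.
Proof. by rewrite addmC cf_monM. Qed.
Lemma cf_XM0 i f m : m i = 0%N -> cf (fX K i * f) m = 0.
Proof. by move=> e; rewrite cf_monM0 // lep1mP e. Qed.
Lemma dropvK i f : (forall m, m i = 0%N -> cf f m = 0) -> fX K i * dropv i f = f.
Proof.
move=> h; apply: fpsP => m; have [e|ne] := eqVneq (m i) 0%N.
  by rewrite cf_XM0 // h.
have [m' ->] : exists m', m = mnm_add m' (mU i).
  by exists (mnm_sub m (mU i)); rewrite submK // lep1mP.
by rewrite cf_XM.
Qed.
Lemma dropv_XM i f : dropv i (fX K i * f) = f.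
Proof. by apply: fpsP => m; exact: cf_XM. Qed.

Lemma spt_all (S : multinom n -> Prop) f : (forall m, S m) -> spt S f.
Proof. by move=> h m _; apply: h. Qed.
Lemma spt_sum S (I : Type) (r : seq I) (P : pred I) (F : I -> fps K n) :
  (forall i, P i -> spt S (F i)) -> spt S (\sum_(i <- r | P i) F i).
Proof. by move=> h; elim/big_rec: _ => [|i x Pi]; [exact: spt0|apply: sptD; apply: h]. Qed.
Lemma spt_nat (S : multinom n -> Prop) k : S mnm0 -> spt S (k%:R : fps K n).
Proof. by rewrite -(rmorph_nat (@fps_const K n)) => h; apply: spt_const. Qed.
End Operators.

Lemma bnd_dropv (R : realType) n (w : 'I_n -> R) M (f : fps (Cx R) n) i :
  (forall j, 0 < w j) -> bnd w M f -> bnd w (M / w i) (dropv i f).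
Proof.
move=> w0 b N; have w0' : forall j, 0 <= w j by move=> j; apply: ltW.
pose G m := cabs (cf f m) * mmap1 w m.
have G0 m : 0 <= G m by rewrite mulr_ge0 ?cabs_ge0 ?mmap1_ge0.
rewrite ler_pdivlMr //; apply: le_trans (b N.+1).
apply: le_trans (_ : \sum_(m : bmultinom n N) G (mnm_add m (mU i)) <= _).
  rewrite /snorm mulr_suml; apply: ler_sum => m _.
  by rewrite /G mmap1D mmap1U mulrA.
rewrite (bm_shift N i G) /snorm.
rewrite [leRHS](bigID (fun m : bmultinom n N.+1 => (0 < (m : multinom n) i)%N)) /= lerDl.
by apply: sumr_ge0 => m _; apply: G0.
Qed.

Lemma bnd_nat (R : realType) n (w : 'I_n -> R) k : (forall i, 0 <= w i) ->
  bnd w k%:R (k%:R : fps (Cx R) n).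
Proof.
move=> w0; rewrite -(rmorph_nat (@fps_const (Cx R) n)) -(cabs_nat R k).
exact: bndC.
Qed.

(** * The Siegel fixed point *)

Section Hamiltonian.
Variables (A : comNzRingType).
Implicit Types (k th x t q p : A).

(* [Wp] and [Wq] are the partial derivatives of [ham - q * p], with the factors [x] and [t] separated. *)
Definition Wpx th0 th q p := th0 - q - th * q + 2 * (q * q * p) - 2 * (q * p).
Definition Wpt th0 th q p := q - th0 * q + 2 * (q * q * p) + th * (q * q) - 2 * (q * q * q * p).
Definition Wqx th q p := 2 * (q * (p * p)) - p - th * p - p * p.
Definition Wqt k th0 th q p :=
  p - th0 * p - k + 2 * (q * (p * p)) + 2 * th * (q * p) - 3 * (q * q * (p * p)).
Definition Wp th0 th x t q p := x * Wpx th0 th q p + t * Wpt th0 th q p.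
Definition Wq k th0 th x t q p := x * Wqx th q p + t * Wqt k th0 th q p.
(** With [t = x - e], the parameter [e] reads [x - t] and [2 * x - e] reads [x + t]. In the
    application [th] is [th0 + th1t] and [k] is a quarter of [th ^+ 2 - thinf ^+ 2]. *)
Definition ham k th0 th x t q p :=
  - k * (t * q - x) + x * th0 * p + (1 - (x - t) - t * th0 - x * th) * q * p
  + (x + t) * (q * p) ^+ 2 + t * th * q ^+ 2 * p - x * q * p ^+ 2 - t * q ^+ 3 * p ^+ 2.
End Hamiltonian.

Ltac bnd_step := lazymatch goal with
  | |- bnd _ _ (?a - ?b) => eapply bndB
  | |- bnd _ _ (?a + ?b) => eapply bndD
  | |- bnd _ _ (?a * ?b) => eapply bndM
  | |- bnd _ _ 1 => eapply bnd1
  | |- bnd _ _ (?n%:R) => eapply bnd_nat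
  | |- bnd _ _ (fps_const _ _) => eapply bndC
  | |- _ => eassumption
  end.

(** * Modes and bounded inverses *)

Section Modes.
Variables (R : realType).
Local Notation C := (Cx R).
Local Notation S4 := (fps C 4).
Implicit Types (m : multinom 4) (f g : S4).

Definition lev m := (m i42 + m i43)%N.
(* [mode_ph s m] is the eigenvalue of [D + s] on the monomial [m]: [L1] and [L2] invert [D - 1]
   and [D + 1] away from their kernels, on which they vanish because [0^-1 = 0]. *)
Definition mode_ph (s : C) m : C := (m ord0)%:R - (m i41)%:R + s.
Definition L1 f := cmul (fun m => (mode_ph (-1) m)^-1) f.
Definition L2 f := cmul (fun m => (mode_ph 1 m)^-1) f.
(** [D] followed by the inverse of [D + 1]. Unlike [D] it is bounded, as it equals the identity
    minus [L2] off the kernel of [D + 1]; it lets [G * D pi] enter the equation for [pi]. *)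
Definition M2 f := cmul (fun m => mode_ph 0 m / mode_ph 1 m) f.
Definition Pi1 f := cmul (fun m => (m ord0 != (m i41).+1)%:R) f.
Definition diag f := cmul (fun m => (m ord0 == m i41)%:R) f.
(** The part of [f] in the kernel of [D - 1] is [u1 * T1 f]. Likewise the resonant part of [f] is
    [u1 * u2 * T0 f], up to terms free of [u1] and [u2]. *)
Definition T1 f := diag (dropv ord0 f).
Definition T0 f := diag (dropv ord0 (dropv i41 f)).

Definition u1 : S4 := fX C ord0.
Definition u2 : S4 := fX C i41.
Definition vx : S4 := fX C i42.
Definition vt : S4 := fX C i43.

(** The perturbation is divisible by [x] or [t], so it becomes small with [mu], while dropping a
    factor [u1] or [u2], as [T1] and [T0] do, costs nothing. *)
Definition wt (mu : R) : 'I_4 -> R := fun i => if (i < 2)%N then 1 else mu.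

(** The divisor is an integer: either it is zero and so is its inverse by convention, or its modulus
    is at least one. *)
Lemma cabs_inv_shift (a b : nat) (s : C) : s = 1 \/ s = -1 ->
  cabs (((a%:R - b%:R + s) : C)^-1) <= 1.
Proof.
have V n : cabs ((n%:R : C)^-1) <= 1.
  rewrite /cabs ComplexField.Normc.normcV -/(cabs _) cabs_nat.
  case: n => [|n]; first by rewrite invr0.
  by rewrite invf_le1 ?ltr0n // ler1n.
have VN n : cabs ((- n%:R : C)^-1) <= 1 by rewrite invrN cabsN.
case=> ->.
  have [le|lt] := leqP b a.
    have -> : (a%:R - b%:R + 1 : C) = (a - b + 1)%:R by rewrite natrD natrB.
    exact: V.
  have -> : (a%:R - b%:R + 1 : C) = - (b - a.+1)%:R by rewrite natrB // -(@natr1 _ a); ring.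
  exact: VN.
have [le|lt] := leqP a b.
  have -> : (a%:R - b%:R + -1 : C) = - (b - a + 1)%:R by rewrite natrD natrB //; ring.
  exact: VN.
have -> : (a%:R - b%:R + -1 : C) = (a - b.+1)%:R by rewrite natrB // -(@natr1 _ b); ring.
exact: V.
Qed.

Lemma bnd_cmul n (w : 'I_n -> R) (M c : R) (phi : multinom n -> C) (h : fps C n) :
  (forall i, 0 <= w i) -> 0 <= c -> (forall j, cabs (phi j) <= c) -> bnd w M h -> bnd w (c * M) (cmul phi h).
Proof.
move=> w0 c0 hphi; apply: bnd_dom => // m.
by rewrite /= cabsM ler_wpM2r ?cabs_ge0.
Qed.

Lemma bnd_L1 w M f : (forall i, 0 <= w i) -> bnd w M f -> bnd w M (L1 f).
Proof.
move=> w0 b; rewrite -[M]mul1r; apply: bnd_cmul => // m.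
by apply: cabs_inv_shift; right.
Qed.
Lemma bnd_L2 w M f : (forall i, 0 <= w i) -> bnd w M f -> bnd w M (L2 f).
Proof.
move=> w0 b; rewrite -[M]mul1r; apply: bnd_cmul => // m.
by apply: cabs_inv_shift; left.
Qed.
Lemma bnd_M2 w M f : (forall i, 0 <= w i) -> bnd w M f -> bnd w (2 * M) (M2 f).
Proof.
move=> w0; apply: bnd_cmul => // m.
have [e|ne] := eqVneq (mode_ph 1 m) 0; first by rewrite e invr0 mulr0 cabs0.
have -> : mode_ph 0 m = mode_ph 1 m - 1 by rewrite /mode_ph; ring.
rewrite mulrBl divff // mul1r; apply: le_trans (cabsB _ _) _.
rewrite cabs1; have : cabs (mode_ph 1 m)^-1 <= 1 by apply: cabs_inv_shift; left.
lra.
Qed.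
Lemma cabs_bool (b : bool) : cabs (b%:R : C) <= 1.
Proof. by case: b; rewrite ?cabs1 ?cabs0. Qed.
Lemma bnd_Pi1 w M f : (forall i, 0 <= w i) -> bnd w M f -> bnd w M (Pi1 f).
Proof. by move=> w0 b; rewrite -[M]mul1r; apply: bnd_cmul => // m; apply: cabs_bool. Qed.
Lemma bnd_diag w M f : (forall i, 0 <= w i) -> bnd w M f -> bnd w M (diag f).
Proof. by move=> w0 b; rewrite -[M]mul1r; apply: bnd_cmul => // m; apply: cabs_bool. Qed.
Lemma wt_gt0 mu : 0 < mu -> forall i, 0 < wt mu i.
Proof. by move=> m0 i; rewrite /wt; case: ifP. Qed.
Lemma bnd_T1 mu M f : 0 < mu -> bnd (wt mu) M f -> bnd (wt mu) M (T1 f).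
Proof.
move=> m0 b; have w0 := wt_gt0 m0; apply: bnd_diag => [i|]; first exact: ltW.
by rewrite -[M]divr1; apply: (@bnd_dropv _ _ (wt mu) M f ord0).
Qed.
Lemma bnd_T0 mu M f : 0 < mu -> bnd (wt mu) M f -> bnd (wt mu) M (T0 f).
Proof.
move=> m0 b; have w0 := wt_gt0 m0; apply: bnd_diag => [i|]; first exact: ltW.
rewrite -[M]divr1; apply: (@bnd_dropv _ _ (wt mu) M _ ord0) => //.
by rewrite -[M]divr1; apply: (@bnd_dropv _ _ (wt mu) M f i41).
Qed.

(** [B] is uniform in the weights, so that [mu] can be chosen after it. Its value is an existential
    variable that [bnd_step] fills from the shape of the polynomial. *)
Lemma Wpx_bnd (th0 th : C) : exists2 B, 0 <= B & forall (w : 'I_4 -> R) (q p : S4),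
  (forall i, 0 <= w i) -> bnd w 2 q -> bnd w 2 p ->
  bnd w B (Wpx (fps_const 4 th0) (fps_const 4 th) q p).
Proof.
have [B h] : exists B, forall (w : 'I_4 -> R) (q p : S4),
    (forall i, 0 <= w i) -> bnd w 2 q -> bnd w 2 p ->
    bnd w B (Wpx (fps_const 4 th0) (fps_const 4 th) q p).
  eexists => w q p w0 hq hp; rewrite /Wpx.
  by repeat bnd_step.
exists B => //; have w0 : forall i : 'I_4, 0 <= cst_w 4 (1 : R) i by [].
by apply: bnd_ge0 w0 (h _ 0 0 w0 _ _); apply: bnd0.
Qed.
Lemma Wpt_bnd (th0 th : C) : exists2 B, 0 <= B & forall (w : 'I_4 -> R) (q p : S4),
  (forall i, 0 <= w i) -> bnd w 2 q -> bnd w 2 p ->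
  bnd w B (Wpt (fps_const 4 th0) (fps_const 4 th) q p).
Proof.
have [B h] : exists B, forall (w : 'I_4 -> R) (q p : S4),
    (forall i, 0 <= w i) -> bnd w 2 q -> bnd w 2 p ->
    bnd w B (Wpt (fps_const 4 th0) (fps_const 4 th) q p).
  eexists => w q p w0 hq hp; rewrite /Wpt.
  by repeat bnd_step.
exists B => //; have w0 : forall i : 'I_4, 0 <= cst_w 4 (1 : R) i by [].
by apply: bnd_ge0 w0 (h _ 0 0 w0 _ _); apply: bnd0.
Qed.
Lemma Wqx_bnd (th : C) : exists2 B, 0 <= B & forall (w : 'I_4 -> R) (q p : S4),
  (forall i, 0 <= w i) -> bnd w 2 q -> bnd w 2 p ->
  bnd w B (Wqx (fps_const 4 th) q p).
Proof.
have [B h] : exists B, forall (w : 'I_4 -> R) (q p : S4),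
    (forall i, 0 <= w i) -> bnd w 2 q -> bnd w 2 p ->
    bnd w B (Wqx (fps_const 4 th) q p).
  eexists => w q p w0 hq hp; rewrite /Wqx.
  by repeat bnd_step.
exists B => //; have w0 : forall i : 'I_4, 0 <= cst_w 4 (1 : R) i by [].
by apply: bnd_ge0 w0 (h _ 0 0 w0 _ _); apply: bnd0.
Qed.
Lemma Wqt_bnd (k th0 th : C) : exists2 B, 0 <= B & forall (w : 'I_4 -> R) (q p : S4),
  (forall i, 0 <= w i) -> bnd w 2 q -> bnd w 2 p ->
  bnd w B (Wqt (fps_const 4 k) (fps_const 4 th0) (fps_const 4 th) q p).
Proof.
have [B h] : exists B, forall (w : 'I_4 -> R) (q p : S4),
    (forall i, 0 <= w i) -> bnd w 2 q -> bnd w 2 p ->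
    bnd w B (Wqt (fps_const 4 k) (fps_const 4 th0) (fps_const 4 th) q p).
  eexists => w q p w0 hq hp; rewrite /Wqt.
  by repeat bnd_step.
exists B => //; have w0 : forall i : 'I_4, 0 <= cst_w 4 (1 : R) i by [].
by apply: bnd_ge0 w0 (h _ 0 0 w0 _ _); apply: bnd0.
Qed.
End Modes.

(** Exact sums of supports let [sptm] read the support of a product off its factors; the inclusion
    in the wanted set is left to linear arithmetic. *)
Definition Mink n (S1 S2 : multinom n -> Prop) m :=
  exists m1, exists m2, m = mnm_add m1 m2 /\ S1 m1 /\ S2 m2.
Lemma spt_Mink (K : comNzRingType) n (S1 S2 : multinom n -> Prop) (f g : fps K n) :
  spt S1 f -> spt S2 g -> spt (Mink S1 S2) (f * g).
Proof. by move=> h1 h2; apply: (sptM h1 h2) => m1 m2 s1 s2; exists m1, m2. Qed.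

Definition Sat (a b k l : nat) (m : multinom 4) :=
  [/\ m ord0 = a, m i41 = b, m i42 = k & m i43 = l].
(* Monomials of mode at least [c - d] when [x] is absent and at most [c - d] when [t] is absent;
   these supports are multiplicative, [Sm c d * Sm c' d'] lying in [Sm (c + c') (d + d')]. *)
Definition Sm (c d : nat) (m : multinom 4) :=
  (m i42 = 0%N -> (c + m i41 <= m ord0 + d)%N) /\
  (m i43 = 0%N -> (m ord0 + d <= c + m i41)%N).
Definition Slev (N : nat) (m : multinom 4) := (N <= lev m)%N.
Definition Sdiag (m : multinom 4) := m ord0 = m i41.
Definition Sq (m : multinom 4) := [/\ (0 < lev m)%N, Sm 1 0 m & m ord0 <> (m i41).+1].
(** Weaker than [Sq]: the term [u2 * T0 (pi * ze)] brings monomials of mode [-1] into [pi], but only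
    with both [x] and [t] present. *)
Definition Sp (m : multinom 4) := [/\ (0 < lev m)%N, Sm 0 1 m &
  (m i42 = 0%N \/ m i43 = 0%N) -> m i41 <> (m ord0).+1].

Section Atoms.
Variable R : realType.
Local Notation C := (Cx R).
Lemma spt_u1 : spt (Sat 1 0 0 0) (u1 R).
Proof. by apply: spt_mon; split; rewrite mnm1E. Qed.
Lemma spt_u2 : spt (Sat 0 1 0 0) (u2 R).
Proof. by apply: spt_mon; split; rewrite mnm1E. Qed.
Lemma spt_vx : spt (Sat 0 0 1 0) (vx R).
Proof. by apply: spt_mon; split; rewrite mnm1E. Qed.
Lemma spt_vt : spt (Sat 0 0 0 1) (vt R).
Proof. by apply: spt_mon; split; rewrite mnm1E. Qed.
Lemma spt_c c : spt (Sat 0 0 0 0) (fps_const 4 c : fps C 4).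
Proof. by apply: spt_const; split; rewrite mnm0E. Qed.
Lemma spt_n k : spt (Sat 0 0 0 0) (k%:R : fps C 4).
Proof. by apply: spt_nat; split; rewrite mnm0E. Qed.
Lemma spt_1 : spt (Sat 0 0 0 0) (1 : fps C 4).
Proof. by rewrite -[X in spt _ X]mulr1n; apply: spt_n. Qed.
Lemma mode_ph_m1 (m : multinom 4) : mode_ph (-1 : C) m = 0 <-> m ord0 = (m i41).+1.
Proof.
rewrite /mode_ph; split=> [/eqP|->]; last by rewrite -(@natr1 _ (m i41)); ring.
have -> : (m ord0)%:R - (m i41)%:R + -1 = (m ord0)%:R - (m i41).+1%:R :> C.
  by rewrite -(@natr1 _ (m i41)); ring.
by rewrite subr_eq0 eqr_nat => /eqP.
Qed.
Lemma mode_ph_p1 (m : multinom 4) : mode_ph (1 : C) m = 0 <-> m i41 = (m ord0).+1.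
Proof.
rewrite /mode_ph; split=> [/eqP|->]; last by rewrite -(@natr1 _ (m ord0)); ring.
have -> : (m ord0)%:R - (m i41)%:R + 1 = (m ord0).+1%:R - (m i41)%:R :> C.
  by rewrite -(@natr1 _ (m ord0)); ring.
by rewrite subr_eq0 eqr_nat => /eqP.
Qed.

Lemma spt_L1 S (f : fps C 4) : spt S f -> spt (fun m => S m /\ m ord0 <> (m i41).+1) (L1 f).
Proof.
move=> h m nz; have [s ne] := spt_cmul_and h nz; split=> // /mode_ph_m1 e.
by apply: ne; rewrite e invr0.
Qed.
Lemma spt_L2 S (f : fps C 4) : spt S f -> spt (fun m => S m /\ m i41 <> (m ord0).+1) (L2 f).
Proof.
move=> h m nz; have [s ne] := spt_cmul_and h nz; split=> // /mode_ph_p1 e.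
by apply: ne; rewrite e invr0.
Qed.
Lemma spt_M2 S (f : fps C 4) : spt S f -> spt (fun m => S m /\ m i41 <> (m ord0).+1) (M2 f).
Proof.
move=> h m nz; have [s ne] := spt_cmul_and h nz; split=> // /mode_ph_p1 e.
by apply: ne; rewrite e invr0 mulr0.
Qed.
Lemma spt_Pi1 S (f : fps C 4) : spt S f -> spt (fun m => S m /\ m ord0 <> (m i41).+1) (Pi1 f).
Proof.
move=> h m nz; have [s ne] := spt_cmul_and h nz; split=> // e.
by apply: ne; rewrite e eqxx.
Qed.
Lemma spt_diag S (f : fps C 4) : spt S f -> spt (fun m => S m /\ Sdiag m) (diag f).
Proof.
move=> h m nz; have [s ne] := spt_cmul_and h nz; split=> //.
by apply: contrapT => e; apply: ne; case: eqP.
Qed.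
Definition Sdrop (i : 'I_4) (S : multinom 4 -> Prop) (m : multinom 4) := S (mnm_add m (mU i)).
Lemma spt_T1 S (f : fps C 4) : spt S f -> spt (fun m => Sdrop ord0 S m /\ Sdiag m) (T1 f).
Proof. by move=> h; apply: spt_diag; apply: (spt_dropv h). Qed.
Lemma spt_T0 S (f : fps C 4) : spt S f -> spt (fun m => Sdrop ord0 (Sdrop i41 S) m /\ Sdiag m) (T0 f).
Proof.
move=> h; have h1 : spt (Sdrop i41 S) (dropv i41 f) by apply: (spt_dropv h).
by apply: spt_diag; apply: (spt_dropv h1).
Qed.
End Atoms.

Ltac sptm := lazymatch goal with
  | |- spt _ (?a * ?b) => eapply spt_Mink; sptm
  | |- spt _ 1 => eapply spt_1
  | |- spt _ (?n%:R) => eapply spt_n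
  | |- spt _ (fps_const _ _) => eapply spt_c
  | |- spt _ (u1 _) => eapply spt_u1
  | |- spt _ (u2 _) => eapply spt_u2
  | |- spt _ (vx _) => eapply spt_vx
  | |- spt _ (vt _) => eapply spt_vt
  | |- spt _ (T1 _) => eapply spt_T1; eassumption
  | |- spt _ (T0 _) => eapply spt_T0; eassumption
  | |- spt _ (L1 _) => eapply spt_L1; eassumption
  | |- spt _ (L2 _) => eapply spt_L2; eassumption
  | |- spt _ (M2 _) => eapply spt_M2; eassumption
  | |- spt _ (Pi1 _) => eapply spt_Pi1; eassumption
  | |- spt _ (diag _) => eapply spt_diag; eassumption
  | |- _ => eassumption
  end.
Lemma mU0E : (((mU (ord0 : 'I_4)) ord0 = 1%N) * ((mU (ord0 : 'I_4)) i41 = 0%N) *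
  ((mU (ord0 : 'I_4)) i42 = 0%N) * ((mU (ord0 : 'I_4)) i43 = 0%N))%type.
Proof. by rewrite !mnm1E. Qed.
Lemma mU1E : (((mU i41) ord0 = 0%N) * ((mU i41) i41 = 1%N) *
  ((mU i41) i42 = 0%N) * ((mU i41) i43 = 0%N))%type.
Proof. by rewrite !mnm1E. Qed.
(** An implication between conditions on exponents is used when its premise follows from the other
    hypotheses, the negated goal included, and is dropped otherwise. *)
Ltac mink_lia := intros;
  repeat match goal with H : Mink _ _ _ |- _ => destruct H as (? & ? & -> & ? & ?) end;
  unfold Sdrop, Slev, Sq, Sp, Sm, Sat, Sdiag, lev in *;
  repeat match goal with
    H : and4 _ _ _ _ |- _ => destruct H
  | H : and3 _ _ _ |- _ => destruct H
  | H : _ /\ _ |- _ => destruct H end;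
  repeat match goal with H : context [fun_of_multinom (mnm_add _ _) _] |- _ =>
    rewrite !mnmDE ?mU0E ?mU1E in H end;
  repeat match goal with H : spt _ _ |- _ => clear H end;
  rewrite ?mnmDE ?mU0E ?mU1E; repeat split; intros;
  try (apply: contraT => ?);
  repeat match goal with H : _ \/ _ |- _ => destruct H end;
  repeat match goal with H : ?P -> ?Q |- _ =>
    first [specialize (H ltac:(lia)) | clear H] end; lia.
Ltac spt_tac := lazymatch goal with
  | |- spt _ (?a - ?b) => apply: sptB; spt_tac
  | |- spt _ (?a + ?b) => apply: sptD; spt_tac
  | |- spt _ (- ?b) => apply: sptN; spt_tac
  | |- _ => eapply spt_weak; [sptm | mink_lia]
  end.

Section Perturbation.
Variable R : realType.
Local Notation C := (Cx R).
Local Notation S4 := (fps C 4).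
(** On a term with factor [x] the condition for [x] absent is void, so [Wpx] has to satisfy only the
    one for [t] absent; [Wpt] is symmetric. Each of the two polynomials is one-sided in exactly this
    way. *)
Lemma spt_Wp (th0 th : C) (q p : S4) : spt (Sm 1 0) q -> spt (Sm 0 1) p ->
  spt (fun m => (0 < lev m)%N /\ Sm 1 0 m)
    (Wp (fps_const 4 th0) (fps_const 4 th) (vx R) (vt R) q p).
Proof.
move=> hq hp; rewrite /Wp.
have hX : spt (fun m => m i43 = 0%N -> (m ord0 <= 1 + m i41)%N) (Wpx (fps_const 4 th0) (fps_const 4 th) q p).
  rewrite /Wpx; spt_tac.
have hT : spt (fun m => m i42 = 0%N -> (1 + m i41 <= m ord0)%N) (Wpt (fps_const 4 th0) (fps_const 4 th) q p).
  rewrite /Wpt; spt_tac.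
spt_tac.
Qed.
Lemma spt_Wq (k th0 th : C) (q p : S4) : spt (Sm 1 0) q -> spt (Sm 0 1) p ->
  spt (fun m => (0 < lev m)%N /\ Sm 0 1 m)
    (Wq (fps_const 4 k) (fps_const 4 th0) (fps_const 4 th) (vx R) (vt R) q p).
Proof.
move=> hq hp; rewrite /Wq.
have hX : spt (fun m => m i43 = 0%N -> (m ord0 + 1 <= m i41)%N) (Wqx (fps_const 4 th) q p).
  rewrite /Wqx; spt_tac.
have hT : spt (fun m => m i42 = 0%N -> (m i41 <= m ord0 + 1)%N)
   (Wqt (fps_const 4 k) (fps_const 4 th0) (fps_const 4 th) q p).
  rewrite /Wqt; spt_tac.
spt_tac.
Qed.
End Perturbation.

Section Differences.
Variables (A : comNzRingType).
(** The cofactors are divided differences, first in [q] at fixed [p], then in [p] at fixed [q'];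
    only their existence is used, to place the difference in an ideal. *)
Lemma Wpx_diff (th0 th q p q' p' : A) : exists a b,
  Wpx th0 th q p - Wpx th0 th q' p' = a * (q - q') + b * (p - p').
Proof.
exists (- 1 - th + 2 * ((q + q') * p) - 2 * p), (2 * (q' * q') - 2 * q').
by rewrite /Wpx; ring.
Qed.
Lemma Wpt_diff (th0 th q p q' p' : A) : exists a b,
  Wpt th0 th q p - Wpt th0 th q' p' = a * (q - q') + b * (p - p').
Proof.
exists (1 - th0 + 2 * ((q + q') * p) + th * (q + q') - 2 * ((q * q + q * q' + q' * q') * p)),
  (2 * (q' * q') - 2 * (q' * q' * q')).
by rewrite /Wpt; ring.
Qed.
Lemma Wqx_diff (th q p q' p' : A) : exists a b,
  Wqx th q p - Wqx th q' p' = a * (q - q') + b * (p - p').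
Proof.
exists (2 * (p * p)), (2 * (q' * (p + p')) - 1 - th - (p + p')).
by rewrite /Wqx; ring.
Qed.
Lemma Wqt_diff (k th0 th q p q' p' : A) : exists a b,
  Wqt k th0 th q p - Wqt k th0 th q' p' = a * (q - q') + b * (p - p').
Proof.
exists (2 * (p * p) + 2 * th * p - 3 * ((q + q') * (p * p))),
  (1 - th0 + 2 * (q' * (p + p')) + 2 * th * q' - 3 * (q' * q' * (p + p'))).
by rewrite /Wqt; ring.
Qed.
End Differences.

(** * The iteration and its invariant ball *)

Section Siegel.
Variables (R : realType) (k th0 th : Cx R).
Local Notation C := (Cx R).
Local Notation S4 := (fps C 4).
Implicit Types (q p : S4).

Definition wpf q p := Wp (fps_const 4 th0) (fps_const 4 th) (vx R) (vt R) q p.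
Definition wqf q p := Wq (fps_const 4 k) (fps_const 4 th0) (fps_const 4 th) (vx R) (vt R) q p.

Lemma spt_ideal N (f g : S4) : spt (Slev N) f -> spt (Slev N) (g * f).
Proof.
move=> h; apply: (sptM (S1 := fun=> True) _ h) => // m1 m2 _.
by rewrite /Slev /lev !mnmDE; lia.
Qed.

(** The factor [x] or [t] in front of each polynomial raises the level by one; this is the source of
    the contraction. *)
Lemma wpf_contr N q p q' p' : spt (Slev N) (q - q') -> spt (Slev N) (p - p') ->
  spt (Slev N.+1) (wpf q p - wpf q' p').
Proof.
move=> hq hp; rewrite /wpf /Wp.
have [a [b e1]] := Wpx_diff (fps_const 4 th0) (fps_const 4 th) q p q' p'.
have [c [d e2]] := Wpt_diff (fps_const 4 th0) (fps_const 4 th) q p q' p'.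
set X := Wpx _ _ _ _ in e1 *; set X' := Wpx _ _ _ _ in e1 *.
set T := Wpt _ _ _ _ in e2 *; set T' := Wpt _ _ _ _ in e2 *.
have -> : vx R * X + vt R * T - (vx R * X' + vt R * T') =
  vx R * (X - X') + vt R * (T - T') by ring.
rewrite e1 e2.
have h1 : spt (Slev N) (a * (q - q') + b * (p - p')) by apply: sptD; apply: spt_ideal.
have h2 : spt (Slev N) (c * (q - q') + d * (p - p')) by apply: sptD; apply: spt_ideal.
by spt_tac.
Qed.

Lemma wqf_contr N q p q' p' : spt (Slev N) (q - q') -> spt (Slev N) (p - p') ->
  spt (Slev N.+1) (wqf q p - wqf q' p').
Proof.
move=> hq hp; rewrite /wqf /Wq.
have [a [b e1]] := Wqx_diff (fps_const 4 th) q p q' p'.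
have [c [d e2]] := Wqt_diff (fps_const 4 k) (fps_const 4 th0) (fps_const 4 th) q p q' p'.
set X := Wqx _ _ _ in e1 *; set X' := Wqx _ _ _ in e1 *.
set T := Wqt _ _ _ _ _ in e2 *; set T' := Wqt _ _ _ _ _ in e2 *.
have -> : vx R * X + vt R * T - (vx R * X' + vt R * T') =
  vx R * (X - X') + vt R * (T - T') by ring.
rewrite e1 e2.
have h1 : spt (Slev N) (a * (q - q') + b * (p - p')) by apply: sptD; apply: spt_ideal.
have h2 : spt (Slev N) (c * (q - q') + d * (p - p')) by apply: sptD; apply: spt_ideal.
by spt_tac.
Qed.

(** [D] is unbounded in the l1 norm, so the derivative [D xi], which enters the equations, is
    carried as an unknown of its own in [SZeta]. *)
Inductive slot := SXi | SZeta | SPi.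
Implicit Types (Z : slot -> S4).
Definition zq Z := u1 R + Z SXi.
Definition zp Z := u2 R + Z SPi.
(** The correction of the frequency, with [g = 1 + gam Z]: it takes up the terms of mode [1] of the
    equation for [q], on which [D - 1] cannot be inverted. *)
Definition gam Z := T1 (wpf (zq Z) (zp Z)).
Definition new_xi Z := L1 (wpf (zq Z) (zp Z) - gam Z * Z SZeta).
(* At a fixed point [SZeta] equals [D SXi]. The last term of the [SPi] component makes the resonant
   part of [p * D q] equal to [u1 * u2], which forces the Jacobian to be [1]. *)
Definition siegel_map Z s := match s with
  | SXi => new_xi Z
  | SZeta => new_xi Z + Pi1 (wpf (zq Z) (zp Z)) - gam Z * Z SZeta
  | SPi => - L2 (wqf (zq Z) (zp Z)) - gam Z * M2 (Z SPi) - u2 R * T0 (Z SPi * Z SZeta)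
  end.
Definition slotS s := match s with SPi => Sp | _ => Sq end.
Definition siegel_inv mu Z := forall s, bnd (wt mu) (4^-1) (Z s) /\ spt (slotS s) (Z s).

Lemma L1B (f g : S4) : L1 f - L1 g = L1 (f - g).
Proof. by rewrite /L1 cmulB. Qed.
Lemma L2B (f g : S4) : L2 f - L2 g = L2 (f - g).
Proof. by rewrite /L2 cmulB. Qed.
Lemma M2B (f g : S4) : M2 f - M2 g = M2 (f - g).
Proof. by rewrite /M2 cmulB. Qed.
Lemma Pi1B (f g : S4) : Pi1 f - Pi1 g = Pi1 (f - g).
Proof. by rewrite /Pi1 cmulB. Qed.
Lemma T1B (f g : S4) : T1 f - T1 g = T1 (f - g).
Proof. by rewrite /T1 /diag dropvB cmulB. Qed.
Lemma T0B (f g : S4) : T0 f - T0 g = T0 (f - g).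
Proof. by rewrite /T0 /diag !dropvB cmulB. Qed.

Section SptFacts.
Variable Z : slot -> S4.
Hypotheses (hx : spt Sq (Z SXi)) (hz : spt Sq (Z SZeta)) (hp : spt Sp (Z SPi)).

Lemma spt_zq : spt (Sm 1 0) (zq Z).
Proof. by rewrite /zq; spt_tac. Qed.
Lemma spt_zp : spt (Sm 0 1) (zp Z).
Proof. by rewrite /zp; spt_tac. Qed.
Lemma spt_wpf : spt (fun m => (0 < lev m)%N /\ Sm 1 0 m) (wpf (zq Z) (zp Z)).
Proof. exact: spt_Wp spt_zq spt_zp. Qed.
Lemma spt_wqf : spt (fun m => (0 < lev m)%N /\ Sm 0 1 m) (wqf (zq Z) (zp Z)).
Proof. exact: spt_Wq spt_zq spt_zp. Qed.
Lemma spt_gam : spt (fun m => (0 < lev m)%N /\ Sm 0 0 m /\ Sdiag m) (gam Z).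
Proof.
have h := spt_wpf.
by rewrite /gam; apply: (spt_weak (spt_T1 h)); mink_lia.
Qed.
Lemma spt_new_xi : spt Sq (new_xi Z).
Proof.
have h := spt_wpf; have hg := spt_gam.
have h1 : spt (fun m => (0 < lev m)%N /\ Sm 1 0 m) (wpf (zq Z) (zp Z) - gam Z * Z SZeta).
  by spt_tac.
by rewrite /new_xi; apply: (spt_weak (spt_L1 h1)); mink_lia.
Qed.
Lemma spt_siegel s : spt (slotS s) (siegel_map Z s).
Proof.
have h := spt_wpf; have hg := spt_gam; have hn := spt_new_xi.
have h' := spt_wqf.
case: s => /=; first exact: hn.
  have hP : spt Sq (Pi1 (wpf (zq Z) (zp Z))).
    by apply: (spt_weak (spt_Pi1 h)); mink_lia.
  by spt_tac.
have hL : spt Sp (L2 (wqf (zq Z) (zp Z))).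
  by apply: (spt_weak (spt_L2 h')); mink_lia.
have hM : spt Sp (M2 (Z SPi)).
  by apply: (spt_weak (spt_M2 hp)); mink_lia.
have hpz : spt (fun m => [/\ (0 < lev m)%N, Sm 0 0 m & m i42 = 0%N \/ m i43 = 0%N -> m ord0 <> m i41])
   (Z SPi * Z SZeta) by spt_tac.
have hT : spt (fun m => [/\ (0 < lev m)%N, (0 < m i42)%N, (0 < m i43)%N & Sdiag m]) (T0 (Z SPi * Z SZeta)).
  by apply: (spt_weak (spt_T0 hpz)); mink_lia.
by spt_tac.
Qed.
End SptFacts.

(** Each occurrence of an unknown comes with a factor of positive level: [x] or [t] in the
    perturbation, [gam Z], or the other factor of [Z SPi * Z SZeta]. *)
Lemma siegel_contr mu Z Z' N : siegel_inv mu Z -> siegel_inv mu Z' ->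
  (forall s, spt (Slev N) (Z s - Z' s)) ->
  forall s, spt (Slev N.+1) (siegel_map Z s - siegel_map Z' s).
Proof.
move=> hZ hZ' d.
have hx' := (hZ' SXi).2; have hz' := (hZ' SZeta).2; have hp' := (hZ' SPi).2.
have hz := (hZ SZeta).2; have hp := (hZ SPi).2; rewrite /= in hx' hz' hp' hz hp.
have dq : spt (Slev N) (zq Z - zq Z').
  have -> : zq Z - zq Z' = Z SXi - Z' SXi by rewrite /zq; ring.
  exact: d.
have dp : spt (Slev N) (zp Z - zp Z').
  have -> : zp Z - zp Z' = Z SPi - Z' SPi by rewrite /zp; ring.
  exact: d.
have dW := wpf_contr dq dp; have dW' := wqf_contr dq dp.
have dg : spt (Slev N.+1) (gam Z - gam Z').
  by rewrite /gam T1B; apply: (spt_weak (spt_T1 dW)); mink_lia.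
have hg' := spt_gam hx' hp'.
have dmul (g g' a a' : S4) : g * a - g' * a' = a * (g - g') + g' * (a - a') by ring.
have dgz : spt (Slev N.+1) (gam Z * Z SZeta - gam Z' * Z' SZeta).
  rewrite dmul; apply: sptD; first exact: spt_ideal.
  by have dz := d SZeta; spt_tac.
have dxi : spt (Slev N.+1) (new_xi Z - new_xi Z').
  rewrite /new_xi L1B.
  have h : spt (Slev N.+1) (wpf (zq Z) (zp Z) - gam Z * Z SZeta - (wpf (zq Z') (zp Z') - gam Z' * Z' SZeta)).
    have e (a b a' b' : S4) : a - b - (a' - b') = (a - a') - (b - b') by ring.
    by rewrite e; apply: sptB.
  by apply: (spt_weak (spt_L1 h)); mink_lia.
case; [exact: dxi| |] => /=.
  have e (a b c a' b' c' : S4) : a + b - c - (a' + b' - c') = (a - a') + (b - b') - (c - c') by ring.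
  rewrite e; apply: sptB => //; apply: sptD => //.
  by rewrite Pi1B; apply: (spt_weak (spt_Pi1 dW)); mink_lia.
have e (a b c a' b' c' : S4) : - a - b - c - (- a' - b' - c') = - (a - a') - (b - b') - (c - c') by ring.
rewrite e; apply: sptB; first (apply: sptB; first apply: sptN).
- by rewrite L2B; apply: (spt_weak (spt_L2 dW')); mink_lia.
- rewrite dmul; apply: sptD; first exact: spt_ideal.
  rewrite M2B; have dM : spt (Slev N) (M2 (Z SPi - Z' SPi)).
    by apply: (spt_weak (spt_M2 (d SPi))); mink_lia.
  by move: (M2 _) dM => X dM; spt_tac.
rewrite -mulrBr T0B.
have dz := d SZeta; have dpi := d SPi.
have h : spt (Slev N.+1) (Z SPi * Z SZeta - Z' SPi * Z' SZeta).
  by rewrite dmul; spt_tac.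
have hT : spt (Slev N.+1) (T0 (Z SPi * Z SZeta - Z' SPi * Z' SZeta)).
  by apply: (spt_weak (spt_T0 h)); mink_lia.
exact: spt_ideal.
Qed.

(** The level is at most the degree, so agreement in levels below [N] covers all degrees below
    [N]. *)
Lemma inv_closed (w : 'I_4 -> R) M (S : multinom 4 -> Prop) (f : S4) :
  (forall N, exists2 f', bnd w M f' /\ spt S f' & spt (Slev N) (f - f')) ->
  bnd w M f /\ spt S f.
Proof.
move=> h; split.
  apply: bnd_closed => N; have [f' [b _] e] := h N; exists f' => //.
  move=> m lt; apply/eqP; rewrite -subr_eq0 -cfB; apply/eqP.
  apply: (cf_spt_eq0 e); rewrite /Slev /lev => le.
  have : (m i42 + m i43 <= mdeg m)%N.
    by rewrite mdegE (bigD1 i42) //= (bigD1 i43) //= addnA leq_addr.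
  lia.
move=> m nz; have [f' [_ s] e] := h (lev m).+1; apply: s => e0.
have := cf_spt_eq0 e (m := m); rewrite cfB e0 subr0 => H; apply: nz; apply: H.
by rewrite /Slev ltnn.
Qed.

Lemma siegel_closed mu Z : (forall N, exists2 Z', siegel_inv mu Z' &
  forall s, spt (Slev N) (Z s - Z' s)) -> siegel_inv mu Z.
Proof.
move=> h s; apply: inv_closed => N; have [Z' i d] := h N.
by exists (Z' s).
Qed.

Lemma wt_X mu i : 0 < mu -> bnd (wt mu) (wt mu i) (fX C i).
Proof. by move=> m0; apply: bndX => j; apply/ltW/wt_gt0. Qed.

Lemma siegel_radius : exists2 mu, 0 < mu <= 1 & forall Z, siegel_inv mu Z -> siegel_inv mu (siegel_map Z).
Proof.
have [B1 B10 b1] := Wpx_bnd th0 th; have [B2 B20 b2] := Wpt_bnd th0 th.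
have [B3 B30 b3] := Wqx_bnd th; have [B4 B40 b4] := Wqt_bnd k th0 th.
pose B := 1 + B1 + B2 + B3 + B4; have B0 : 1 <= B by rewrite /B; lra.
(* The perturbation then has norm at most [1 / 64]. The largest contribution left is
   [u2 * T0 (Z SPi * Z SZeta)], at most [1 / 16], so all sums stay below the radius [1 / 4]. *)
exists ((64 * B)^-1).
  rewrite invr_gt0 mulr_gt0 ?(lt_le_trans ltr01) //=; try lra.
  rewrite invf_le1; lra.
set mu := (64 * B)^-1 => Z hZ.
have mu0 : 0 < mu by rewrite invr_gt0; lra.
have muB : mu * B = 64^-1 by rewrite /mu invfM -mulrA mulVf ?mulr1 // gt_eqF //; lra.
have w0 : forall i, 0 <= wt mu i by move=> i; apply/ltW/wt_gt0.
move=> s; split; last first.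
  by apply: spt_siegel; [exact: (hZ SXi).2|exact: (hZ SZeta).2|exact: (hZ SPi).2].
have bx := (hZ SXi).1; have bz := (hZ SZeta).1; have bp := (hZ SPi).1.
have bu1 : bnd (wt mu) 1 (u1 R) := wt_X ord0 mu0.
have bu2 : bnd (wt mu) 1 (u2 R) := wt_X i41 mu0.
have bvx : bnd (wt mu) mu (vx R) := wt_X i42 mu0.
have bvt : bnd (wt mu) mu (vt R) := wt_X i43 mu0.
have bq : bnd (wt mu) 2 (zq Z) by apply: bnd_le (bndD w0 bu1 bx); lra.
have bpp : bnd (wt mu) 2 (zp Z) by apply: bnd_le (bndD w0 bu2 bp); lra.
have p1 : mu * B1 + mu * B2 + (mu * B3 + mu * B4) <= 64^-1.
  have e : mu * B = mu + (mu * B1 + mu * B2 + (mu * B3 + mu * B4)) by rewrite /B; ring.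
  by rewrite -muB e; lra.
have q1 : 0 <= mu * B1 by rewrite mulr_ge0 // ltW.
have q2 : 0 <= mu * B2 by rewrite mulr_ge0 // ltW.
have q3 : 0 <= mu * B3 by rewrite mulr_ge0 // ltW.
have q4 : 0 <= mu * B4 by rewrite mulr_ge0 // ltW.
have bW : bnd (wt mu) 64^-1 (wpf (zq Z) (zp Z)).
  rewrite /wpf /Wp; apply: bnd_le (bndD w0 (bndM w0 bvx (b1 _ _ _ w0 bq bpp)) (bndM w0 bvt (b2 _ _ _ w0 bq bpp))).
  by lra.
have bW' : bnd (wt mu) 64^-1 (wqf (zq Z) (zp Z)).
  rewrite /wqf /Wq; apply: bnd_le (bndD w0 (bndM w0 bvx (b3 _ _ _ w0 bq bpp)) (bndM w0 bvt (b4 _ _ _ w0 bq bpp))).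
  by lra.
have bg : bnd (wt mu) 64^-1 (gam Z) := bnd_T1 mu0 bW.
have bgz := bndM w0 bg bz.
have bn : bnd (wt mu) (64^-1 + 64^-1 * 4^-1) (new_xi Z).
  by apply: bnd_L1 => //; apply: bndB.
case: s => /=.
- by apply: bnd_le bn; lra.
- by apply: bnd_le (bndB w0 (bndD w0 bn (bnd_Pi1 w0 bW)) bgz); lra.
- have b5 := bndN (bnd_L2 w0 bW'); have b6 := bndM w0 bg (bnd_M2 w0 bp).
  have b7 := bndM w0 bu2 (bnd_T0 mu0 (bndM w0 bp bz)).
  by apply: bnd_le (bndB w0 (bndB w0 b5 b6) b7); lra.
Qed.

Theorem siegel_fixpoint : exists2 mu, 0 < mu <= 1 & exists2 Z, siegel_inv mu Z &
  forall s, siegel_map Z s = Z s.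
Proof.
have [mu hmu H] := siegel_radius; exists mu => //.
apply: (graded_fixpoint (lev := lev) (Z0 := fun=> 0)) => //.
- move=> s; split; last exact: spt0.
  by apply: bnd0; rewrite invr_ge0.
- by move=> Z Z' N h h' d s; apply: (siegel_contr h h').
- exact: siegel_closed.
Qed.
End Siegel.

Section HamDeriv.
Variables (A : comNzRingType) (d : A -> A).
Hypotheses (dD : forall f g, d (f + g) = d f + d g) (dN : forall f, d (- f) = - d f)
  (dM : forall f g, d (f * g) = d f * g + f * d g) (d1 : d 1 = 0).
(** Stated for an abstract derivation that kills the parameters, so as to serve both [Dop] and the
    derivatives in [u1] and [u2]. *)
Lemma ham_deriv k th0 th x t q p :
  d k = 0 -> d th0 = 0 -> d th = 0 -> d x = 0 -> d t = 0 ->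
  d (ham k th0 th x t q p) =
    (p + Wq k th0 th x t q p) * d q + (q + Wp th0 th x t q p) * d p.
Proof.
move=> hk h0 h hx ht; rewrite /ham /Wq /Wp /Wqx /Wqt /Wpx /Wpt.
rewrite !exprS !expr0 !mulr1 !(dD, dN, dM) d1 hk h0 h hx ht; ring.
Qed.
End HamDeriv.

(** * The derivation [D] and the equations of its partial inverses *)

Section SeriesD.
Variable R : realType.
Local Notation C := (Cx R).
Local Notation S4 := (fps C 4).
Implicit Types (f g : S4).

Lemma cf_X_fder n (i : 'I_n) (f : fps C n) m : cf (fX C i * fder i f) m = (m i)%:R * cf f m.
Proof.
have [e|ne] := eqVneq (m i) 0%N; first by rewrite cf_XM0 // e mul0r.
have [m' e'] : exists m', m = mnm_add m' (mU i).
  by exists (mnm_sub m (mU i)); rewrite submK // lep1mP.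
rewrite e' cf_XM mnmDE mnm1E eqxx addn1 -[LHS]/(_ *+ _).
by rewrite [RHS]mulr_natl.
Qed.

Lemma fder_comm n (i j : 'I_n) (f : fps C n) : fder i (fder j f) = fder j (fder i f).
Proof.
case: (eqVneq i j) => [->//|ne]; have ne' : (j == i) = false by rewrite eq_sym (negbTE ne).
apply: fpsP => m /=; rewrite -!mulrnA -!addmA (addmC (mU i)) !mnmDE !mnm1E (negbTE ne) ne'.
by rewrite !addn0 mulnC.
Qed.

Definition Dop f := cmul (fun m => mode_ph (0 : C) m) f.
Lemma DopE f : Dop f = u1 R * fder ord0 f - u2 R * fder i41 f.
Proof.
by apply: fpsP => m; rewrite cfB !cf_X_fder /= /mode_ph; ring.
Qed.
Lemma DopD f g : Dop (f + g) = Dop f + Dop g.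
Proof. exact: cmulD. Qed.
Lemma DopN f : Dop (- f) = - Dop f.
Proof. by apply: fpsP => m; rewrite /= mulrN. Qed.
Lemma DopM f g : Dop (f * g) = Dop f * g + f * Dop g.
Proof. by rewrite !DopE !fderM; ring. Qed.
Lemma Dop_diag f : Dop f = 0 <-> spt Sdiag f.
Proof.
split=> [h m nz|h].
  have := congr1 (fun u => cf u m) h; rewrite /= /mode_ph addr0 => /eqP.
  by rewrite mulf_eq0 subr_eq0 eqr_nat => /orP[/eqP//|/eqP].
apply: fpsP => m; rewrite cf0 /=.
have [->|/eqP/h e] := eqVneq (cf f m) 0; first by rewrite mulr0.
by rewrite /mode_ph e; ring.
Qed.
Lemma Dop_c c : Dop (fps_const 4 c) = 0.
Proof. by apply: (proj2 (Dop_diag _)); spt_tac. Qed.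
Lemma Dop_1 : Dop 1 = 0.
Proof. exact: (Dop_c 1). Qed.
Lemma Dop_vx : Dop (vx R) = 0.
Proof. by apply: (proj2 (Dop_diag _)); spt_tac. Qed.
Lemma Dop_vt : Dop (vt R) = 0.
Proof. by apply: (proj2 (Dop_diag _)); spt_tac. Qed.
Lemma fderE_u1 i : fder i (u1 R) = (i == ord0)%:R. Proof. exact: fderX. Qed.
Lemma fderE_u2 i : fder i (u2 R) = (i == i41)%:R. Proof. exact: fderX. Qed.
Lemma fderE_vx i : fder i (vx R) = (i == i42)%:R. Proof. exact: fderX. Qed.
Lemma fderE_vt i : fder i (vt R) = (i == i43)%:R. Proof. exact: fderX. Qed.
Lemma Dop_u1 : Dop (u1 R) = u1 R.
Proof. by rewrite DopE !fderE_u1 /= mulr1n mulr0n; ring. Qed.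
Lemma Dop_u2 : Dop (u2 R) = - u2 R.
Proof. by rewrite DopE !fderE_u2 /= mulr1n mulr0n; ring. Qed.

Definition P2 f := cmul (fun m : multinom 4 => (m i41 != (m ord0).+1)%:R) f.

Lemma Pi1_id f : spt (fun m => m ord0 <> (m i41).+1) f -> Pi1 f = f.
Proof.
move=> h; apply: fpsP => m /=; have [->|/eqP/h e] := eqVneq (cf f m) 0; first by rewrite mulr0.
by case: eqP => //= _; rewrite mul1r.
Qed.
Lemma L1_eq f : Dop (L1 f) - L1 f = Pi1 f.
Proof.
apply: fpsP => m; rewrite cfB /=.
have -> : mode_ph 0 m = mode_ph (-1) m + 1 :> C by rewrite /mode_ph; ring.
rewrite mulrDl mul1r addrK mulrA; congr (_ * _).
have [e|/eqP ne] := eqVneq (m ord0) (m i41).+1.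
  by rewrite (proj2 (mode_ph_m1 R m) e) mul0r.
rewrite divff //; apply/eqP => e; apply: ne; exact/(mode_ph_m1 R).
Qed.
Lemma mode_p1_inv (m : multinom 4) : mode_ph 1 m / mode_ph 1 m = (m i41 != (m ord0).+1)%:R :> C.
Proof.
have [e|/eqP ne] := eqVneq (m i41) (m ord0).+1.
  by rewrite (proj2 (mode_ph_p1 R m) e) mul0r.
rewrite divff //; apply/eqP => e; apply: ne; exact/(mode_ph_p1 R).
Qed.
Lemma L2_eq f : Dop (L2 f) + L2 f = P2 f.
Proof.
apply: fpsP => m; rewrite cfD /= -mode_p1_inv.
have -> : mode_ph 0 m = mode_ph 1 m - 1 :> C by rewrite /mode_ph; ring.
by move: (_^-1) => i; ring.
Qed.
Lemma M2_eq f : Dop (M2 f) + M2 f = P2 (Dop f).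
Proof.
apply: fpsP => m; rewrite cfD /= -mode_p1_inv.
have -> : mode_ph 0 m = mode_ph 1 m - 1 :> C by rewrite /mode_ph; ring.
by move: (_^-1) => i; ring.
Qed.
Lemma P2_mode f : spt (fun m => m i41 = (m ord0).+1) (f - P2 f).
Proof.
move=> m; rewrite cfB /=; case: eqVneq => //= _.
by rewrite mul1r subrr.
Qed.
Lemma mode_m1 f : spt (fun m => m i41 = (m ord0).+1) f -> Dop f + f = 0.
Proof.
move=> h; apply: fpsP => m; rewrite cfD cf0 /=.
have [->|/eqP/h e] := eqVneq (cf f m) 0; first by rewrite mulr0 addr0.
by rewrite /mode_ph e -(@natr1 _ (m ord0)); ring.
Qed.
Lemma T1_Pi1 f : u1 R * T1 f + Pi1 f = f.
Proof.
apply: fpsP => m; rewrite cfD.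
have [e|ne] := eqVneq (m ord0) 0%N.
  by rewrite cf_XM0 // add0r /= e mul1r.
have [m' ->] : exists m', m = mnm_add m' (mU ord0).
  by exists (mnm_sub m (mU ord0)); rewrite submK // lep1mP.
rewrite cf_XM /= !mnmDE !mU0E addn1 addn0 eqSS; case: eqP => _ /=.
  by rewrite mul1r mul0r addr0.
by rewrite mul1r mul0r add0r.
Qed.
Lemma T0_off f : spt (fun m => (0 < m ord0 + m i41)%N) f ->
  spt (fun m => m ord0 <> m i41) (f - u1 R * (u2 R * T0 f)).
Proof.
move=> h; apply/sptP => m /contrapT e; rewrite cfB.
have [e0|ne] := eqVneq (m ord0) 0%N.
  rewrite cf_XM0 // subr0; apply: (cf_spt_eq0 h); rewrite -e e0 //.
have [m1 e1] : exists m1, m = mnm_add m1 (mU ord0).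
  by exists (mnm_sub m (mU ord0)); rewrite submK // lep1mP.
have [m2 e2] : exists m2, m1 = mnm_add m2 (mU i41).
  exists (mnm_sub m1 (mU i41)); rewrite submK // lep1mP; move: e ne.
  by rewrite e1 !mnmDE !mU0E addn0 => <-; rewrite addn1.
rewrite {m1}e2 in e1; rewrite e1 !cf_XM /=.
have -> : m2 ord0 == m2 i41 by apply/eqP; move: e; rewrite e1 !mnmDE !mU0E !mU1E; lia.
by rewrite mul1r -!addmA (addmC (mU ord0)) subrr.
Qed.
End SeriesD.

(** * From the fixed point to an area preserving normal form *)

Section NormalForm.
Variables (R : realType) (k th0 th : Cx R).
Local Notation C := (Cx R).
Local Notation S4 := (fps C 4).

Definition hamf (q p : S4) :=
  ham (fps_const 4 k) (fps_const 4 th0) (fps_const 4 th) (vx R) (vt R) q p.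
Definition Jac (f g : S4) := fder ord0 f * fder i41 g - fder i41 f * fder ord0 g.
(** The expected invariant at [h = u1 * u2], in the variables [x] and [t]. *)
Definition chi4 : S4 := 1 - (vx R - vt R) - vt R * fps_const 4 th0 - vx R * fps_const 4 th
   + 2 * ((vx R + vt R) * (u1 R * u2 R)).
Local Notation wp := (wpf th0 th).
Local Notation wq := (wqf k th0 th).

Record siegel_nf (mu : R) (xi pi g : S4) : Prop := SiegelNF {
  nf_bnd_xi : bnd (wt mu) (4^-1) xi;
  nf_bnd_pi : bnd (wt mu) (4^-1) pi;
  nf_lev_xi : spt (fun m => (0 < lev m)%N) xi;
  nf_lev_pi : spt (fun m => (0 < lev m)%N) pi;
  nf_lev_g : spt (fun m => (0 < lev m)%N) (g - 1);
  nf_diag_g : spt Sdiag g;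
  nf_chi : spt (fun m => (0 < m i42)%N /\ (0 < m i43)%N) (g - chi4);
  nf_eq1 : g * Dop (u1 R + xi) = u1 R + xi + wp (u1 R + xi) (u2 R + pi);
  nf_eq2 : g * Dop (u2 R + pi) = - (u2 R + pi + wq (u1 R + xi) (u2 R + pi));
  nf_K : Dop (hamf (u1 R + xi) (u2 R + pi)) = 0;
  nf_jac : Jac (u1 R + xi) (u2 R + pi) = 1 }.

Lemma fps_cancel1 (f g : S4) : spt (fun m => (0 < lev m)%N) (f - 1) -> f * g = 0 -> g = 0.
Proof.
move=> h; apply: fps_cancel; exists 1; rewrite mul1r.
have := cf_spt_eq0 h (m := mnm0); rewrite cfB cf1 eqxx => H; apply/eqP; rewrite -subr_eq0; apply/eqP.
by apply: H; rewrite /lev !mnm0E.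
Qed.

Lemma hamf_fder i (q p : S4) : (i = ord0 \/ i = i41) ->
  fder i (hamf q p) = (p + wq q p) * fder i q + (q + wp q p) * fder i p.
Proof.
move=> hi; apply: (ham_deriv (fderD i) (fderN i) (fderM i) (fder1 _ i)); try exact: fderC.
  by rewrite fderE_vx; case: hi => ->.
by rewrite fderE_vt; case: hi => ->.
Qed.

(** Differentiating in [u1] lowers the mode from [0] to [-1]. *)
Lemma Dop_fder_diag (K : S4) : spt Sdiag K -> Dop (fder ord0 K) = - fder ord0 K.
Proof.
move=> h; apply: fpsP => m; rewrite cfN /=.
have [->|/eqP/h] := eqVneq (cf K (mnm_add m (mU ord0))) 0.
  by rewrite mul0rn mulr0 oppr0.
rewrite /Sdiag !mnmDE !mU0E addn0 addn1 => e.
by rewrite /mode_ph -e -(@natr1 _ (m ord0)); ring.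
Qed.

Lemma T1_XM (X : S4) : spt Sdiag X -> T1 (u1 R * X) = X.
Proof.
move=> dX; rewrite /T1 dropv_XM; apply: fpsP => m /=.
have [->|/eqP/dX ->] := eqVneq (cf X m) 0; first by rewrite mulr0.
by rewrite eqxx mul1r.
Qed.

Section Equations.
Variables (xi ze pi G : S4).
Let q := u1 R + xi.
Let p := u2 R + pi.
Let g := 1 + G.
Hypotheses (eG : G = T1 (wp q p)) (ex : L1 (wp q p - G * ze) = xi)
  (ez : xi + Pi1 (wp q p) - G * ze = ze)
  (ep : - L2 (wq q p) - G * M2 pi - u2 R * T0 (pi * ze) = pi).
Hypotheses (hx : spt Sq xi) (hz : spt Sq ze) (hp : spt Sp pi)
  (hG : spt (fun m => (0 < lev m)%N /\ Sm 0 0 m /\ Sdiag m) G).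

Let Dop_G : Dop G = 0.
Proof. by apply: (proj2 (Dop_diag _)); apply: (spt_weak hG); mink_lia. Qed.

Let g_unit : spt (fun m => (0 < lev m)%N) (g - 1).
Proof. by rewrite /g addrAC subrr add0r; apply: (spt_weak hG); mink_lia. Qed.

Let Dop_g : Dop g = 0.
Proof. by rewrite /g DopD Dop_1 Dop_G addr0. Qed.

(** [L1_eq] gives [Dop xi - xi = Pi1 (wp q p) - G * ze], since [G * ze] has no mode [1]; by [ez] the
    right-hand side is [ze - xi]. *)
Let Dop_xi : Dop xi = ze.
Proof.
have := L1_eq (wp q p - G * ze); rewrite ex -Pi1B (Pi1_id (f := G * ze)); last by spt_tac.
move: (Pi1 _) ez => P e1 e2; rewrite -e1.
have -> : xi + P - G * ze = P - G * ze + xi by ring.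
by rewrite -e2 subrK.
Qed.

Let Dop_q : Dop q = u1 R + ze.
Proof. by rewrite /q DopD Dop_u1 Dop_xi. Qed.

Let eq1 : g * Dop q = q + wp q p.
Proof.
have e := T1_Pi1 (wp q p); rewrite -eG in e.
have e2 : Pi1 (wp q p) = ze - xi + G * ze by rewrite -{1}ez; ring.
rewrite -e e2 Dop_q /g /q; ring.
Qed.

(** [L2] inverts [D + 1] only off its kernel, so [ep] yields the equation for [p] up to this series
    of mode [-1]. *)
Let defect := g * Dop p + p + wq q p.
Let defect_mode : spt (fun m => m i41 = (m ord0).+1) defect.
Proof.
have S1M f : Dop (G * f) + G * f = G * (Dop f + f) by rewrite DopM Dop_G; ring.
have S1T : Dop (u2 R * T0 (pi * ze)) + u2 R * T0 (pi * ze) = 0.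
  apply: mode_m1; have h : spt (fun=> True) (pi * ze) by apply: spt_all.
  by have hT := spt_T0 h; move: (T0 _) hT => X hX; spt_tac.
have S1pi : Dop pi + pi = - P2 (wq q p) - G * P2 (Dop pi).
  rewrite -[in LHS]ep !DopD !DopN.
  rewrite -L2_eq -M2_eq -S1M.
  have aux (a b c a' b' c' : S4) : c' + c = 0 ->
    - a' - b' - c' + (- a - b - c) = - (a' + a) - (b' + b).
    move=> e; have -> : c' = - c by apply/eqP; rewrite -addr_eq0 e.
    ring.
  exact: aux S1T.
have -> : defect = - (G * u2 R) + (wq q p - P2 (wq q p)) + G * (Dop pi - P2 (Dop pi)).
  have -> : defect = (1 + G) * (- u2 R + Dop pi) + (u2 R + pi) + wq q p.
    by rewrite /defect -[Dop p]/(Dop (u2 R + pi)) DopD Dop_u2.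
  have -> : P2 (wq q p) = - (Dop pi + pi) - G * P2 (Dop pi) by rewrite S1pi; ring.
  by move: (Dop pi) (P2 _) (wq q p) => D P w; ring.
have h1 : spt (fun m => m i41 = (m ord0).+1) (wq q p - P2 (wq q p)) by apply: P2_mode.
have h2 : spt (fun m => m i41 = (m ord0).+1) (Dop pi - P2 (Dop pi)) by apply: P2_mode.
move: (wq q p - _) h1 (Dop pi - _) h2 => X hX Y hY.
by spt_tac.
Qed.

Let Dop_ham : Dop (hamf q p) = (p + wq q p) * Dop q + (q + wp q p) * Dop p.
Proof.
apply: (@ham_deriv (fps C 4) (@Dop R) (@DopD R) (@DopN R) (@DopM R) (Dop_1 R)); rewrite ?Dop_c ?Dop_vx ?Dop_vt //.
Qed.

(** By the equation for [q], the derivative of the energy is [Dop q * defect = u1 * defect + ze *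
    defect]. An image of [D] has no mode [0], nor has [ze * defect] because [ze] has no mode [1];
    but [u1 * defect] is purely of mode [0], so it vanishes. *)
Let defect0 : defect = 0.
Proof.
have e : Dop (hamf q p) - Dop q * defect = 0.
  apply: (fps_cancel1 g_unit); rewrite mulrBr Dop_ham.
  have -> : g * ((p + wq q p) * Dop q + (q + wp q p) * Dop p) - g * (Dop q * defect) =
    (p + wq q p) * (g * Dop q) + (q + wp q p) * (g * Dop p) - (g * Dop q) * defect by ring.
  by rewrite eq1 /defect; ring.
have e2 : u1 R * defect = Dop (hamf q p) - ze * defect.
  have -> : u1 R * defect = Dop q * defect - ze * defect by rewrite Dop_q; ring.
  by rewrite (eqP (_ : Dop (hamf q p) == Dop q * defect)) // -subr_eq0 e.
have h1 : spt Sdiag (u1 R * defect) by have h := defect_mode; spt_tac.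
have h2 : spt (fun m => m ord0 <> m i41) (u1 R * defect).
  rewrite e2; apply: sptB; last by have h := defect_mode; spt_tac.
  move=> m /= nz e'; apply: nz; rewrite /mode_ph e'; ring.
apply: (@monM_inj _ _ (mU ord0)); rewrite mulr0; apply: fpsP => m; rewrite cf0.
by apply: contrapT => nz; apply: (h2 _ nz); apply: (h1 _ nz).
Qed.

Let eq2 : g * Dop p = - (p + wq q p).
Proof. by apply/eqP; rewrite -addr_eq0 addrA; apply/eqP; exact: defect0. Qed.

Let DopK : Dop (hamf q p) = 0.
Proof.
apply: (fps_cancel1 g_unit); rewrite Dop_ham.
have -> : g * ((p + wq q p) * Dop q + (q + wp q p) * Dop p) =
    (p + wq q p) * (g * Dop q) + (q + wp q p) * (g * Dop p) by ring.
by rewrite eq1 eq2; ring.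
Qed.

(** Besides [u1 * u2], mode [0] could only come from [pi * ze] and from the last term of [u1 * pi],
    and these cancel: that term is [- u1 * u2 * T0 (pi * ze)]. *)
Let action : spt (fun m => m ord0 <> m i41) (p * Dop q - u1 R * u2 R).
Proof.
(* [T0] does not see terms free of [u1] and [u2]; there are none here, as every monomial of [ze] has
   a nonzero mode. *)
have hoff : spt (fun m => (0 < m ord0 + m i41)%N) (pi * ze).
  have h1 : spt (fun=> True) pi by apply: spt_all.
  have h2 : spt (fun m => m ord0 <> m i41) ze.
    by rewrite -Dop_xi => m /= nz e'; apply: nz; rewrite /mode_ph e'; ring.
  by spt_tac.
have hT := T0_off hoff.
have hL := spt_L2 (spt_all (f := wq q p) (S := fun=> True) (fun=> I)).
have hM := spt_M2 (spt_all (f := pi) (S := fun=> True) (fun=> I)).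
have -> : p * Dop q - u1 R * u2 R = u2 R * ze - u1 R * L2 (wq q p) - u1 R * (G * M2 pi)
   + (pi * ze - u1 R * (u2 R * T0 (pi * ze))).
  have e1 : p * Dop q = u1 R * u2 R + u2 R * ze + u1 R * pi + pi * ze.
    by rewrite Dop_q -[p]/(u2 R + pi); ring.
  have e2 : u1 R * pi = u1 R * (- L2 (wq q p) - G * M2 pi - u2 R * T0 (pi * ze)) by rewrite ep.
  rewrite e1 e2; move: (L2 _) (M2 _) (T0 _) => X Y X'; ring.
move: (_ - u1 R * (u2 R * T0 _)) hT (L2 _) hL (M2 _) hM => X hX Y hY Y' hY'.
by spt_tac.
Qed.

(** [J] is resonant because [g * u2 * J] is the derivative in [u1] of the resonant energy. On a
    resonant monomial [m], [key] says that the coefficient of [u1 * u2 * J] is [m ord0] times that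
    of [p * Dop q], which [action] identifies with that of [u1 * u2]. *)
Let jacobian : Jac q p = 1.
Proof.
set J := Jac q p.
have eJ : g * (u2 R * J) = fder ord0 (hamf q p).
  rewrite hamf_fder; last by left.
  have -> : p + wq q p = - (g * Dop p) by rewrite eq2 opprK.
  by rewrite -eq1 !DopE /J /Jac; ring.
have DJ : Dop J = 0.
  have h1 : Dop (fder ord0 (hamf q p)) = - fder ord0 (hamf q p).
    exact/Dop_fder_diag/(proj1 (Dop_diag _) DopK).
  rewrite -eJ DopM Dop_g mul0r add0r DopM Dop_u2 in h1.
  apply: (@monM_inj _ _ (mU i41)); rewrite mulr0; apply: (fps_cancel1 g_unit).
  have -> : g * (mon C (mU i41) * Dop J) = g * (- u2 R * J + u2 R * Dop J) + g * (u2 R * J).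
    by rewrite /u2 /fX; ring.
  by rewrite h1 addNr.
have dJ := proj1 (Dop_diag _) DJ.
have key : u1 R * fder ord0 (p * (u2 R * fder i41 q)) - u2 R * fder i41 (p * (u1 R * fder ord0 q))
   = - (u1 R * u2 R * J).
  rewrite !fderM !fderE_u1 !fderE_u2 (fder_comm i41 ord0) /J /Jac /= mulr0n; ring.
suff e : u1 R * (u2 R * J) = u1 R * (u2 R * 1).
  by apply: (@monM_inj _ _ (mU i41)); apply: (@monM_inj _ _ (mU ord0)).
rewrite mulr1 mulrA; apply: fpsP => m.
have [e|ne] := eqVneq (m ord0) (m i41); last first.
  have h1 : spt Sdiag (u1 R * u2 R * J) by spt_tac.
  have h2 : spt Sdiag (u1 R * u2 R) by spt_tac.
  by rewrite (cf_spt_eq0 h1) ?(cf_spt_eq0 h2) //; apply/eqP.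
have := congr1 (fun f => cf f m) key; rewrite cfN cfB !cf_X_fder -e => ek.
have ea : cf (p * (u1 R * fder ord0 q)) m - cf (p * (u2 R * fder i41 q)) m = cf (u1 R * u2 R) m.
  rewrite -cfB -mulrBr -DopE; apply/eqP; rewrite -subr_eq0 -cfB.
  by apply/eqP; apply: (cf_spt_eq0 action) => ne; apply: ne.
have -> : cf (u1 R * u2 R * J) m = (m ord0)%:R * cf (u1 R * u2 R) m.
  by rewrite -ea -[LHS]opprK -ek; ring.
have hu : spt (fun m : multinom 4 => m ord0 = 1%N) (u1 R * u2 R) by spt_tac.
have [->|/eqP/hu ->] := eqVneq (cf (u1 R * u2 R) m) 0; first by rewrite mulr0.
by rewrite mul1r.
Qed.

(** Beyond [u1 * X], the series [wp q p] has modes at least [2] where [x] is absent and at most [0]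
    where [t] is absent. [T1] extracts mode [1], which therefore needs both [x] and [t]. *)
Let chi : spt (fun m => (0 < m i42)%N /\ (0 < m i43)%N) (g - chi4).
Proof.
pose X : S4 := - (vx R - vt R) - vt R * fps_const 4 th0 - vx R * fps_const 4 th
   + 2 * ((vx R + vt R) * (u1 R * u2 R)).
have hq : spt (Sm 1 0) q by rewrite /q; spt_tac.
have hpp : spt (Sm 0 1) p by rewrite /p; spt_tac.
have hv : spt Sdiag (vx R + vt R) by spt_tac.
have dX : spt Sdiag X by rewrite /X; spt_tac.
have eX : T1 (u1 R * X) = X by apply: T1_XM.
have -> : g - chi4 = T1 (wp q p - u1 R * X).
  rewrite -T1B eX -eG /g /X /chi4; ring.
(* This is [q * q * p - u1 * u1 * u2], written so that each term shows a factor [xi] or [pi]. *)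
pose Q := xi * ((q + u1 R) * p) + u1 R * u1 R * pi.
pose A := fps_const 4 th0 - xi - fps_const 4 th * xi + 2 * Q - 2 * (q * p).
pose B := xi - fps_const 4 th0 * xi + 2 * Q + fps_const 4 th * (q * q) - 2 * (q * q * q * p).
have -> : wp q p - u1 R * X = vx R * A + vt R * B.
  rewrite /wpf /Wp /Wpx /Wpt /X /A /B /Q.
  have -> : xi = q - u1 R by rewrite /q; ring.
  have -> : pi = p - u2 R by rewrite /p; ring.
  by move: q p => q' p'; ring.
have hQ1 : spt (fun m => m i43 = 0%N -> (m ord0 <= m i41)%N) Q.
  have h := @spt_u1 R; have h2 : spt (Sm 1 0) (q + u1 R) by apply: sptD => //; spt_tac.
  by rewrite /Q; spt_tac.
have hQ2 : spt (fun m => m i42 = 0%N -> (m i41 + 2 <= m ord0)%N) Q.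
  have h := @spt_u1 R; have h2 : spt (Sm 1 0) (q + u1 R) by apply: sptD => //; spt_tac.
  by rewrite /Q; spt_tac.
have hA : spt (fun m => m i43 = 0%N -> (m ord0 <= m i41)%N) A.
  by rewrite /A; clear hQ2; clearbody Q; spt_tac.
have hB : spt (fun m => m i42 = 0%N -> (m i41 + 2 <= m ord0)%N) B.
  by rewrite /B; clear hQ1; clearbody Q; spt_tac.
have hAB : spt (fun m => (m i42 = 0%N -> (m i41 + 2 <= m ord0)%N) /\
   (m i43 = 0%N -> (m ord0 <= m i41)%N)) (vx R * A + vt R * B).
  by clearbody A B; spt_tac.
by apply: (spt_weak (spt_T1 hAB)); mink_lia.
Qed.

Lemma siegel_nf_of_fixpoint mu : bnd (wt mu) (4^-1) xi -> bnd (wt mu) (4^-1) pi ->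
  siegel_nf mu xi pi g.
Proof.
move=> b1 b2; split; [exact: b1|exact: b2| | |exact: g_unit|exact: (proj1 (Dop_diag _) Dop_g)|
  exact: chi|exact: eq1|exact: eq2|exact: DopK|exact: jacobian].
- by apply: (spt_weak hx); mink_lia.
- by apply: (spt_weak hp); mink_lia.
Qed.
End Equations.

Theorem siegel_normal_form : exists2 mu, 0 < mu <= 1 & exists xi pi g, siegel_nf mu xi pi g.
Proof.
have [mu hmu [Z inv fix_]] := siegel_fixpoint k th0 th; exists mu => //.
exists (Z SXi), (Z SPi), (1 + gam th0 th Z).
apply: (@siegel_nf_of_fixpoint _ (Z SZeta)) => //.
- exact: (fix_ SXi).
- by have := fix_ SZeta; rewrite /= -[new_xi _ _ _]/(siegel_map k th0 th Z SXi) fix_.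
- exact: (fix_ SPi).
- exact: (inv SXi).2.
- exact: (inv SZeta).2.
- exact: (inv SPi).2.
- exact: spt_gam (inv SXi).2 (inv SPi).2.
- exact: (inv SXi).1.
- exact: (inv SPi).1.
Qed.
End NormalForm.

(** * Existence of the normal form *)

Definition vec3 (T : Type) (a b c : T) (i : 'I_3) : T :=
  match nat_of_ord i with 0 => a | 1 => b | _ => c end.
Definition vec4 (T : Type) (a b c d : T) (i : 'I_4) : T :=
  match nat_of_ord i with 0 => a | 1 => b | 2 => c | _ => d end.

Lemma ord3P (P : 'I_3 -> Prop) : P ord0 -> P i31 -> P i32 -> forall i, P i.
Proof.
move=> p0 p1 p2 [[|[|[|//]]] lt].
- by rewrite (_ : Ordinal lt = ord0) //; apply: val_inj.
- by rewrite (_ : Ordinal lt = i31) //; apply: val_inj.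
- by rewrite (_ : Ordinal lt = i32) //; apply: val_inj.
Qed.
Lemma ord4P (P : 'I_4 -> Prop) : P ord0 -> P i41 -> P i42 -> P i43 -> forall i, P i.
Proof.
move=> p0 p1 p2 p3 [[|[|[|[|//]]]] lt].
- by rewrite (_ : Ordinal lt = ord0) //; apply: val_inj.
- by rewrite (_ : Ordinal lt = i41) //; apply: val_inj.
- by rewrite (_ : Ordinal lt = i42) //; apply: val_inj.
- by rewrite (_ : Ordinal lt = i43) //; apply: val_inj.
Qed.
Lemma big_ord3 (V : Type) (idx : V) (op : Monoid.law idx) (F : 'I_3 -> V) :
  \big[op/idx]_i F i = op (F ord0) (op (F i31) (F i32)).
Proof.
rewrite !big_ord_recl big_ord0 Monoid.mulm1; congr (op _ (op (F _) (F _))); exact: val_inj.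
Qed.
Lemma big_ord4 (V : Type) (idx : V) (op : Monoid.law idx) (F : 'I_4 -> V) :
  \big[op/idx]_i F i = op (F ord0) (op (F i41) (op (F i42) (F i43))).
Proof.
rewrite !big_ord_recl big_ord0 Monoid.mulm1; congr (op _ (op (F _) (op (F _) (F _)))); exact: val_inj.
Qed.

Section Morph.
Variables (A B : comNzRingType) (d : A -> B).
Hypotheses (dD : forall f g, d (f + g) = d f + d g) (dN : forall f, d (- f) = - d f)
  (dM : forall f g, d (f * g) = d f * d g) (d1 : d 1 = 1).
Lemma ham_morph k th0 th x t q p :
  d (ham k th0 th x t q p) = ham (d k) (d th0) (d th) (d x) (d t) (d q) (d p).
Proof. by rewrite /ham !exprS !expr0 !(dD, dN, dM) d1. Qed.
Lemma Wp_morph th0 th x t q p :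
  d (Wp th0 th x t q p) = Wp (d th0) (d th) (d x) (d t) (d q) (d p).
Proof. by rewrite /Wp /Wpx /Wpt !(dD, dN, dM) d1. Qed.
Lemma Wq_morph k th0 th x t q p :
  d (Wq k th0 th x t q p) = Wq (d k) (d th0) (d th) (d x) (d t) (d q) (d p).
Proof.
by rewrite /Wq /Wqx /Wqt !(dD, dN, dM) d1.
Qed.
End Morph.

Section SptComp.
Variables (K : comNzRingType) (n k : nat).
Lemma spt_fcompB S (F : fps K n) (Y Y' : 'I_n -> fps K k) : nocst Y -> nocst Y' ->
  (forall j, cf F j <> 0 -> spt S (mmap1 Y j - mmap1 Y' j)) ->
  spt S (fcomp F Y - fcomp F Y').
Proof.
move=> nc nc' h m; rewrite cfB (fcomp_eqt F nc (ltnSn (mdeg m))) (fcomp_eqt F nc' (ltnSn (mdeg m))).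
rewrite -cfB !psubst_trunc -sumrB; under eq_bigr do rewrite -mulrBr.
suff : spt S (\sum_(j : bmultinom n (mdeg m).+1) fps_const k (cf F j) * (mmap1 Y j - mmap1 Y' j)) by apply.
apply: spt_sum => j _ m'.
rewrite cf_constM => nz; apply: (h j).
  by move=> e; apply: nz; rewrite e mul0r.
by move=> e; apply: nz; rewrite e mulr0.
Qed.
Lemma spt_fcomp S (F : fps K n) (Y : 'I_n -> fps K k) : nocst Y ->
  (forall j, cf F j <> 0 -> spt S (mmap1 Y j)) -> spt S (fcomp F Y).
Proof.
move=> nc h m; rewrite (fcomp_eqt F nc (ltnSn (mdeg m))) psubst_trunc.
suff : spt S (\sum_(j : bmultinom n (mdeg m).+1) fps_const k (cf F j) * mmap1 Y j) by apply.
apply: spt_sum => j _ m'.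
rewrite cf_constM => nz; apply: (h j).
  by move=> e; apply: nz; rewrite e mul0r.
by move=> e; apply: nz; rewrite e mulr0.
Qed.
End SptComp.

(** * Inversion of a coordinate change close to the identity *)

Section Inverse.
Variables (R : realType).
Local Notation C := (Cx R).
Local Notation S4 := (fps C 4).

Definition params (f g : S4) : 'I_4 -> S4 := vec4 f g (vx R) (vt R).

Lemma mmap1_params (f g : S4) (m : multinom 4) :
  mmap1 (params f g) m = f ^+ m ord0 * g ^+ m i41 * (vx R ^+ m i42 * vt R ^+ m i43).
Proof. by rewrite /mmap1 big_ord4 /= mulrA. Qed.

Lemma spt_lev_pow (f : S4) j : spt (Slev 1) f -> spt (Slev j) (f ^+ j).
Proof.
move=> h; elim: j => [|j IH]; first by apply: spt_all.
rewrite exprS; apply: (sptM h IH) => m1 m2.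
by rewrite /Slev /lev !mnmDE; lia.
Qed.
Lemma spt_lev_vx : spt (Slev 1) (vx R). Proof. by spt_tac. Qed.
Lemma spt_lev_vt : spt (Slev 1) (vt R). Proof. by spt_tac. Qed.
Lemma spt_lev_vars j l : spt (Slev (j + l)) (vx R ^+ j * vt R ^+ l).
Proof.
have h1 : spt (Slev j) (vx R ^+ j) by apply: spt_lev_pow spt_lev_vx.
have h2 : spt (Slev l) (vt R ^+ l) by apply: spt_lev_pow spt_lev_vt.
apply: (@sptM _ _ (Slev j) (Slev l) _ _ _ h1 h2) => m1 m2.
by rewrite /Slev /lev !mnmDE; lia.
Qed.

Lemma nocst_lev (f : S4) : spt (Slev 1) f -> cf f mnm0 = 0.
Proof. by move=> h; apply: (cf_spt_eq0 h); rewrite /Slev /lev !mnm0E. Qed.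
Lemma cf_fX0 n (i : 'I_n) : cf (fX C i) mnm0 = 0.
Proof. by rewrite /= eq_sym mnm1_eq0. Qed.
Lemma nocst_params (f g : S4) : cf f mnm0 = 0 -> cf g mnm0 = 0 -> nocst (params f g).
Proof. by move=> hf hg; apply: ord4P => //; apply: cf_fX0. Qed.

Lemma lev_fcomp (F f g : S4) : nocst (params f g) -> spt (Slev 1) F ->
  spt (Slev 1) (fcomp F (params f g)).
Proof.
move=> nc hF; apply: spt_fcomp => // j /hF hj; rewrite mmap1_params.
apply: spt_ideal.
have h2 : spt (Slev (j i42 + j i43)) (vx R ^+ j i42 * vt R ^+ j i43) by apply: spt_lev_vars.
apply: (spt_weak h2) => m.
by move: hj; rewrite /Slev /lev; lia.
Qed.

(** The substitution fixes [x] and [t], so the level of [F] adds to the level of the differences. *)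
Lemma lev_fcompB N (F f g f' g' : S4) : nocst (params f g) -> nocst (params f' g') ->
  spt (Slev 1) F -> spt (Slev N) (f - f') -> spt (Slev N) (g - g') ->
  spt (Slev N.+1) (fcomp F (params f g) - fcomp F (params f' g')).
Proof.
move=> nc nc' hF hf hg; apply: spt_fcompB => // j /hF hj; rewrite !mmap1_params -mulrBl.
have h : spt (Slev N) (f ^+ j ord0 * g ^+ j i41 - f' ^+ j ord0 * g' ^+ j i41).
  have -> : f ^+ j ord0 * g ^+ j i41 - f' ^+ j ord0 * g' ^+ j i41 =
     g ^+ j i41 * (f ^+ j ord0 - f' ^+ j ord0) + f' ^+ j ord0 * (g ^+ j i41 - g' ^+ j i41) by ring.
  rewrite !subrXX; apply: sptD; apply: spt_ideal; rewrite mulrC; exact: spt_ideal.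
have h2 : spt (Slev (j i42 + j i43)) (vx R ^+ j i42 * vt R ^+ j i43) by apply: spt_lev_vars.
apply: (@sptM _ _ (Slev N) (Slev (j i42 + j i43)) _ _ _ h h2) => m1 m2.
by move: hj; rewrite /Slev /lev !mnmDE; lia.
Qed.

(** The inverse is [u + V] where [V] is a fixed point of minus the pair [(xi, pi)] taken at [u + V];
    positive level of [xi] and [pi] gives the contraction. *)
Lemma inverse_near_identity mu (xi pi : S4) : 0 < mu ->
  bnd (wt mu) (4^-1) xi -> bnd (wt mu) (4^-1) pi -> spt (Slev 1) xi -> spt (Slev 1) pi ->
  exists U1 U2 : S4, [/\ nocst (params U1 U2), hs (ev U1) U1, hs (ev U2) U2,
     fcomp (u1 R + xi) (params U1 U2) = u1 R & fcomp (u2 R + pi) (params U1 U2) = u2 R].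
Proof.
move=> mu0 bx bp hx hp.
(* Radius [1 / 2] in [u1], [u2] leaves room for [V] of norm [1 / 4] inside the unit polydisc on
   which [xi] and [pi] are bounded. *)
pose v : 'I_4 -> R := fun i => if (i < 2)%N then 2^-1 else mu.
have v0 i : 0 < v i by rewrite /v; case: ifP; rewrite ?invr_gt0.
have v0' i : 0 <= v i by apply: ltW.
pose U (V : bool -> S4) := params (u1 R + V true) (u2 R + V false).
pose P (V : bool -> S4) := forall b, bnd v (4^-1) (V b) /\ spt (Slev 1) (V b).
pose Phi (V : bool -> S4) b := - fcomp (if b then xi else pi) (U V).
have nc V : P V -> nocst (U V).
  move=> h; apply: nocst_params; rewrite cfD cf_fX0 add0r; apply: nocst_lev.
    exact: (h true).2.
  exact: (h false).2.
have bU V : P V -> forall i, bnd v (wt mu i) (U V i).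
  move=> h; have b1 := (h true).1; have b2 := (h false).1.
  apply: ord4P; rewrite /U /params /vec4 /wt /=.
  - by apply: bnd_le (bndD v0' (bndX ord0 v0') b1); rewrite /v /=; lra.
  - by apply: bnd_le (bndD v0' (bndX i41 v0') b2); rewrite /v /=; lra.
  - exact: (bndX i42 v0').
  - exact: (bndX i43 v0').
have [||V V' N hV hV' d b|V h|V PV fV] := @graded_fixpoint C 4 bool lev P Phi (fun=> 0).
- by move=> b; split; [apply: bnd0; rewrite invr_ge0|exact: spt0].
- move=> V hV b; split.
    by apply: bndN; apply: bnd_comp (nc _ hV) (bU _ hV) _ => //; case: b.
  by apply: sptN; apply: lev_fcomp (nc _ hV) _; case: b.
- rewrite /Phi; have e (X Y : S4) : - X - - Y = - (X - Y) by ring.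
  rewrite e; apply: sptN; apply: lev_fcompB (nc _ hV) (nc _ hV') _ _ _.
  + by case: (b).
  + have -> : u1 R + V true - (u1 R + V' true) = V true - V' true by ring.
    exact: d.
  + have -> : u2 R + V false - (u2 R + V' false) = V false - V' false by ring.
    exact: d.
- by move=> b; apply: inv_closed => N; have [V' i d] := h N; exists (V' b).
have n := nc V PV; have r0 : 0 < Num.min 2^-1 mu by rewrite lt_min mu0 invr_gt0 ltr0n.
have rv i : Num.min 2^-1 mu <= v i by rewrite /v; case: ifP => _; rewrite ge_min lexx ?orbT.
exists (u1 R + V true), (u2 R + V false); split => //.
- exact: (hs_ev r0 rv (bndD v0' (bndX ord0 v0') (PV true).1)).
- exact: (hs_ev r0 rv (bndD v0' (bndX i41 v0') (PV false).1)).
- rewrite fcompD fcompX // -[in LHS](opprK (fcomp xi _)) -[- fcomp xi _]/(Phi V true) fV.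
  by rewrite -[params _ _ ord0]/(u1 R + V true) addrK.
- rewrite fcompD fcompX // -[in LHS](opprK (fcomp pi _)) -[- fcomp pi _]/(Phi V false) fV.
  by rewrite -[params _ _ i41]/(u2 R + V false) addrK.
Qed.
End Inverse.

Lemma mmap1_fX (K : comNzRingType) n (m : multinom n) : mmap1 (fun i => fX K i) m = mon K m.
Proof.
have P (m' : multinom n) j : mon K (mnm_muln m' j) = mon K m' ^+ j.
  elim: j => [|j IH]; first by rewrite mulm0n mon0 expr0.
  by rewrite mulmS monD IH exprS.
rewrite [in RHS](multinomUE_id m) (big_morph (@mon K n) (@monD K n) (@mon0 K n)).
by apply: eq_bigr => i _; rewrite P.
Qed.

(** * Resonant series as series in the action *)

Section Action.
Variables (R : realType).
Local Notation C := (Cx R).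
Local Notation S4 := (fps C 4).
Local Notation S3 := (fps C 3).

Definition mn4 (a b c d : nat) : multinom 4 := mnF (vec4 a b c d).
Definition mn3 (a b c : nat) : multinom 3 := mnF (vec3 a b c).
Definition act (f : S4) : 'I_3 -> S4 := vec3 f (vx R) (vt R).

Lemma nocst_act f : cf f mnm0 = 0 -> nocst (act f).
Proof. by move=> h; apply: ord3P => //; apply: cf_fX0. Qed.

Lemma mmap1_act f (j : multinom 3) :
  mmap1 (act f) j = f ^+ j ord0 * (vx R ^+ j i31 * vt R ^+ j i32).
Proof. by rewrite /mmap1 big_ord3. Qed.

Lemma mn4_mon a b c d : mon C (mn4 a b c d) = u1 R ^+ a * (u2 R ^+ b * (vx R ^+ c * vt R ^+ d)).
Proof. by rewrite -mmap1_fX /mmap1 big_ord4 /mn4 !mnFE. Qed.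

Lemma cf_fcomp_act (G : S3) (c : C) (m : multinom 4) :
  cf (fcomp G (act (fps_const 4 c * (u1 R * u2 R)))) m =
  if m ord0 == m i41 then c ^+ m ord0 * cf G (mn3 (m ord0) (m i42) (m i43)) else 0.
Proof.
have nc : nocst (act (fps_const 4 c * (u1 R * u2 R))).
  by apply: nocst_act; rewrite cf_constM cf_XM0 ?mnm0E // mulr0.
rewrite (fcomp_eqt G nc (ltnSn (mdeg m))) psubst_trunc cf_sum.
have E (j : multinom 3) : cf (fps_const 4 (cf G j) * mmap1 (act (fps_const 4 c * (u1 R * u2 R))) j) m =
   if m == mn4 (j ord0) (j ord0) (j i31) (j i32) then c ^+ j ord0 * cf G j else 0.
  rewrite cf_constM mmap1_act exprMn -rmorphXn /= exprMn.
  have -> : fps_const 4 (c ^+ j ord0) * (u1 R ^+ j ord0 * u2 R ^+ j ord0) * (vx R ^+ j i31 * vt R ^+ j i32)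
    = fps_const 4 (c ^+ j ord0) * mon C (mn4 (j ord0) (j ord0) (j i31) (j i32)).
    by rewrite mn4_mon; ring.
  rewrite cf_constM /=; case: eqP => _; first by rewrite mulr1 mulrC.
  by rewrite !mulr0.
under eq_bigr do rewrite E.
case: eqP => [e|ne]; last first.
  apply: big1 => j _; case: eqP => // em; case: ne.
  by rewrite em /mn4 !mnFE.
have lt : (mdeg (mn3 (m ord0) (m i42) (m i43)) < (mdeg m).+1)%N.
  rewrite ltnS !mdegE big_ord3 big_ord4 /mn3 !mnFE /vec3 /=; lia.
pose j0 := mn3 (m ord0) (m i42) (m i43).
have em : m == mn4 (j0 ord0) (j0 ord0) (j0 i31) (j0 i32).
  by apply/eqP/mnmP; apply: ord4P; rewrite /mn4 /j0 /mn3 !mnFE.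
have -> : c ^+ m ord0 = c ^+ j0 ord0 by rewrite /j0 /mn3 mnFE.
rewrite (bigD1 (BMultinom lt)) //= em.
rewrite big1 ?addr0 // => j ne; case: eqP => // ej; case/negP: ne; apply/eqP/val_inj/mnmP => /=.
have E0 i := congr1 (fun u : multinom 4 => u i) ej.
have e0 := E0 ord0; have e2 := E0 i42; have e3 := E0 i43.
rewrite /mn4 !mnFE /= in e0 e2 e3.
by apply: ord3P; rewrite mnFE /vec3 /=.
Qed.

Definition action_part (K : S4) : S3 :=
  Fps (fun j : multinom 3 => cf K (mn4 (j ord0) (j ord0) (j i31) (j i32))).

Lemma action_partK (K : S4) : spt Sdiag K -> fcomp (action_part K) (act (u1 R * u2 R)) = K.
Proof.
move=> h; apply: fpsP => m.
have -> : act (u1 R * u2 R) = act (fps_const 4 1 * (u1 R * u2 R)) by rewrite rmorph1 mul1r.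
rewrite cf_fcomp_act expr1n mul1r; case: eqP => [e|ne]; last first.
  by apply/esym; apply: (cf_spt_eq0 h).
congr (cf K _); apply/mnmP; apply: ord4P; rewrite /mn4 mnFE /mn3 ?mnFE //=.
Qed.

(** A power of the action has twice its degree in [u1], [u2], so the radius [s] becomes [s ^+ 2];
    with [s <= 1] the powers of [x] and [t] only decrease. *)
Lemma hs_action_part (f : ('I_4 -> C) -> C) (K : S4) : hs f K -> hs (ev (action_part K)) (action_part K).
Proof.
move=> [r r0 hr]; have m0 : 0 < Num.min r 1 <= r by rewrite lt_min r0 ltr01 ge_min lexx.
have [[M b] _] := rep_le m0 hr; case/andP: m0 => s0 _.
set s := Num.min r 1 in s0 b; have s1 : s <= 1 by rewrite ge_min lexx orbT.
have ss : 0 < s ^+ 2 by rewrite exprn_gt0.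
apply: (hs_ev (w := cst_w 3 (s ^+ 2)) (M := M) ss) => // N.
pose h (j : multinom 3) := mn4 (j ord0) (j ord0) (j i31) (j i32).
have dg (j : bmultinom 3 N) : (mdeg (h j) < (2 * N).+1)%N.
  have := bmdeg j; rewrite !mdegE big_ord3 big_ord4 /h /mn4 !mnFE /vec4 /=; lia.
pose F (m : multinom 4) := cabs (cf K m) * s ^+ mdeg m.
have F0 m : 0 <= F m by rewrite mulr_ge0 ?cabs_ge0 // exprn_ge0 // ltW.
apply: le_trans (b (2 * N).+1).
apply: le_trans (_ : \sum_(j : bmultinom 3 N) F (h j) <= _).
  apply: ler_sum => j _; rewrite mmap1_cst /= /F ler_wpM2l ?cabs_ge0 // -exprM.
  apply: ler_wiXn2l; [exact: ltW|exact: s1|].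
  rewrite !mdegE big_ord3 big_ord4 /h /mn4 !mnFE /vec4 /=; lia.
have hinj : injective (fun j : bmultinom 3 N => BMultinom (dg j)).
  move=> j1 j2 /(congr1 (fun m : bmultinom 4 _ => m : multinom 4)) /= /mnmP e.
  apply/val_inj/mnmP; apply: ord3P.
  - by have := e ord0; rewrite /h /mn4 !mnFE.
  - by have := e i42; rewrite /h /mn4 !mnFE.
  - by have := e i43; rewrite /h /mn4 !mnFE.
rewrite /snorm; under [leRHS]eq_bigr do rewrite mmap1_cst.
rewrite [leRHS](bigID (fun m => m \in [set BMultinom (dg j) | j : bmultinom 3 N]%SET)) /=.
apply: ler_wpDr; first by apply: sumr_ge0 => m _; apply: F0.
rewrite big_imset /=; last by move=> j1 j2 _ _; apply: hinj.
by rewrite le_eqVlt; apply/orP; left; apply/eqP; apply: eq_big.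
Qed.
End Action.

Ltac hs_step := lazymatch goal with
  | |- hs _ (?a - ?b) => apply: hsB
  | |- hs _ (?a + ?b) => apply: hsD
  | |- hs _ (- ?b) => apply: hsN
  | |- hs _ (?a * ?b) => apply: hsM
  | |- hs _ (?a ^+ _) => apply: hs_pow
  | |- hs _ (fps_const _ _) => apply: hsC
  | |- _ => eassumption
  end.

Section Existence.
Variables (R : realType) (k th0 th : Cx R).
Local Notation C := (Cx R).
Local Notation S4 := (fps C 4).

Lemma hs_ham n (x t q p : ('I_n -> C) -> C) X T Q P : hs x X -> hs t T -> hs q Q -> hs p P ->
  hs (fun z => ham k th0 th (x z) (t z) (q z) (p z))
     (ham (fps_const n k) (fps_const n th0) (fps_const n th) X T Q P).
Proof.
move=> hx ht hq hp; rewrite /ham.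
have c1 : hs (fun=> 1) (1 : fps C n) by apply: hs1.
by repeat hs_step.
Qed.

(** The fixed point gives [(q, p)] as functions of [(u1, u2)], whereas a normal form asks for the
    converse. Hence the inversion; the chain rule and multiplicativity of determinants carry the
    Jacobian over. *)
Theorem normal_form_series : exists (G : fps C 3) (U1 U2 : S4),
  [/\ hs (ev G) G, hs (ev U1) U1, hs (ev U2) U2, nocst (params U1 U2) & Jac U1 U2 = 1 /\
   fcomp G (act (U1 * U2)) = hamf k th0 th (u1 R) (u2 R)].
Proof.
have [mu /andP[mu0 mu1] [xi [pi [g nf]]]] := siegel_normal_form k th0 th.
have [U1 [U2 [nc h1 h2 e1 e2]]] :=
  inverse_near_identity mu0 (nf_bnd_xi nf) (nf_bnd_pi nf) (nf_lev_xi nf) (nf_lev_pi nf).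
set q := u1 R + xi in e1; set p := u2 R + pi in e2.
have hX i : hs (fun z : 'I_4 -> C => z i) (fX C i) by apply: hsX.
have w0 i : 0 < wt mu i by apply: wt_gt0.
have rv i : mu <= wt mu i by rewrite /wt; case: ifP.
have hxi : hs (ev xi) xi := hs_ev mu0 rv (nf_bnd_xi nf).
have hpi : hs (ev pi) pi := hs_ev mu0 rv (nf_bnd_pi nf).
have hK := hs_ham (hX i42) (hX i43) (hsD (hX ord0) hxi) (hsD (hX i41) hpi).
set K := hamf k th0 th q p; have dK : spt Sdiag K by apply/Dop_diag; exact: nf_K nf.
have U10 : cf U1 mnm0 = 0 := nc ord0; have U20 : cf U2 mnm0 = 0 := nc i41.
exists (action_part K), U1, U2; split=> //; first exact: hs_action_part hK.
split.
  have chain a : a = ord0 \/ a = i41 -> forall f : S4,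
    fder a (fcomp f (params U1 U2)) = fcomp (fder ord0 f) (params U1 U2) * fder a U1 +
      fcomp (fder i41 f) (params U1 U2) * fder a U2.
    move=> ha f; rewrite fcomp_chain // big_ord4 /=.
    rewrite -[params _ _ i42]/(vx R) -[params _ _ i43]/(vt R).
    have -> : fder a (vx R) = 0 by rewrite fderE_vx; case: ha => ->.
    have -> : fder a (vt R) = 0 by rewrite fderE_vt; case: ha => ->.
    have aux (f1 f2 f3 f4 g1 g2 : S4) : f1 * g1 + (f2 * g2 + (f3 * 0 + f4 * 0)) = f1 * g1 + f2 * g2 by ring.
    exact: aux.
  have j1 := chain ord0 (or_introl erefl) q; have j2 := chain ord0 (or_introl erefl) p.
  have j3 := chain i41 (or_intror erefl) q; have j4 := chain i41 (or_intror erefl) p.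
  rewrite e1 e2 !fderE_u1 !fderE_u2 /= ?mulr1n ?mulr0n in j1 j2 j3 j4.
  have := congr1 (fun f => fcomp f (params U1 U2)) (nf_jac nf).
  rewrite /Jac fcompD fcompN !fcompM // -/q -/p (fcompC _ 1).
  move: (fcomp (fder ord0 q) _) (fcomp (fder i41 q) _) (fcomp (fder ord0 p) _) (fcomp (fder i41 p) _) j1 j2 j3 j4.
  move: (fder ord0 U1) (fder i41 U1) (fder ord0 U2) (fder i41 U2) => a b c d q1 q2 p1 p2 j1 j2 j3 j4 J.
  rewrite rmorph1 in J.
  transitivity ((q1 * p2 - q2 * p1) * (a * d - b * c)); first by rewrite J mul1r.
  transitivity ((q1 * a + q2 * c) * (p1 * b + p2 * d) - (q1 * b + q2 * d) * (p1 * a + p2 * c)); first by ring.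
  by rewrite -j1 -j2 -j3 -j4; ring.
have -> : act (U1 * U2) = (fun i => fcomp (act (u1 R * u2 R) i) (params U1 U2)).
  apply/funext; apply: ord3P; rewrite /act /vec3 /=.
  - by rewrite fcompM // !fcompX.
  - by rewrite fcompX.
  - by rewrite fcompX.
have nca : nocst (act (u1 R * u2 R)) by apply: nocst_act; rewrite cf_XM0 ?mnm0E.
rewrite -fcomp_comp //; last exact: nocst_comp.
rewrite action_partK // /K /hamf.
have dM (f f' : S4) : fcomp (f * f') (params U1 U2) = fcomp f (params U1 U2) * fcomp f' (params U1 U2) by apply: fcompM.
have d1 : fcomp 1 (params U1 U2) = 1 by have := fcompC (params U1 U2) 1; rewrite !rmorph1.
rewrite (ham_morph (fcompD _) (fcompN _) dM d1) !fcompC e1 e2.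
by rewrite !fcompX.
Qed.
End Existence.

(** * Comparison of two normal forms *)

Section Small.
Variable R : realType.
Local Notation C := (Cx R).

Lemma bnd_shrink_deg n (w : 'I_n -> R) M s d (f : fps C n) : (forall i, 0 <= w i) -> 0 <= s <= 1 ->
  deg_ge d f -> bnd w M f -> bnd (fun i => s * w i) (s ^+ d * M) f.
Proof.
move=> w0 /andP[s0 s1] hd b N; apply: le_trans (_ : s ^+ d * snorm w N f <= _).
  rewrite mulr_sumr; apply: ler_sum => m _; rewrite mmap1_scale.
  have [->|/eqP nz] := eqVneq (cf f m) 0; first by rewrite cabs0 !mul0r mulr0.
  rewrite [leRHS]mulrCA ler_wpM2l ?cabs_ge0 // ler_wpM2r ?mmap1_ge0 //.
  by apply: ler_wiXn2l => //; exact: hd nz.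
by rewrite ler_wpM2l ?exprn_ge0.
Qed.

Lemma hs_small n (f : ('I_n -> C) -> C) F eps : hs f F -> cf F mnm0 = 0 -> 0 < eps ->
  exists2 r, 0 < r & forall z, (forall i, cabs (z i) < r) -> cabs (f z) < eps.
Proof.
move=> [r r0 [[M b] e]] h eps0.
have w0 : forall i : 'I_n, 0 <= cst_w n r i by move=> i; apply: ltW.
have M0 := bnd_ge0 w0 b.
pose s := Num.min 1 (eps / (M + 1) / 2).
have s0 : 0 < s by rewrite lt_min ltr01 !divr_gt0 // ltr_wpDl.
have s1 : s <= 1 by rewrite ge_min lexx.
exists (s * r / 2); first by rewrite divr_gt0 // mulr_gt0.
move=> z hz.
have sr : s * r / 2 <= r / 2 by rewrite ler_pM2r ?invr_gt0 // ger_pMl.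
rewrite e; last by move=> i; apply: le_trans (ltW (hz i)) sr.
have bs : bnd (fun i => s * cst_w n r i) (s * M) F.
  by apply: bnd_shrink => //; [rewrite ltW|apply: nocst_deg].
have cz : conv (fun i => s * cst_w n r i) z by move=> i; apply: ltW (hz i).
apply: le_lt_trans (ev_le bs cz) _.
have M1 : 0 < M + 1 by rewrite ltr_wpDl.
apply: le_lt_trans (_ : s * (M + 1) < _); first by rewrite ler_wpM2l ?ltW // ltrDl.
rewrite -ltr_pdivlMr //; apply: le_lt_trans (_ : eps / (M + 1) / 2 < _).
  by rewrite ge_min lexx orbT.
have : 0 < eps / (M + 1) by rewrite divr_gt0.
by lra.
Qed.

(** * Solving an equation along a coordinate axis *)

Section Axis.
Variables (n : nat).
Local Notation S := (fps C n).
Definition axis (i : 'I_n) (s : S) : 'I_n -> S := fun j => if j == i then s else 0.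

Lemma nocst_axis i s : cf s mnm0 = 0 -> nocst (axis i s).
Proof. by move=> h j; rewrite /axis; case: ifP. Qed.

Lemma axis_contr N i (s s' : S) (m : multinom n) : deg_ge 1 s -> deg_ge 1 s' -> (1 < mdeg m)%N ->
  deg_ge N (s - s') -> deg_ge N.+1 (mmap1 (axis i s) m - mmap1 (axis i s') m).
Proof.
move=> h h' hm hd; rewrite !(mmap1_split _ _ i) /axis !eqxx.
have E (t : S) : \prod_(j | j != i) (if j == i then t else 0) ^+ m j = \prod_(j | j != i) 0 ^+ m j.
  by apply: eq_bigr => j /negbTE ->.
rewrite !E -mulrBl.
have [/forallP z|] := boolP [forall j, (j != i) ==> (m j == 0%N)]; last first.
  rewrite negb_forall => /existsP[j]; rewrite negb_imply => /andP[ne nz].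
  by rewrite [X in _ * X](bigD1 j) //= expr0n (negbTE nz) !mul0r mulr0; exact: spt0.
have em : m i = mdeg m.
  rewrite mdegE (bigD1 i) //= big1 ?addn0 // => j ne; apply/eqP.
  by have := z j; rewrite ne.
rewrite [X in _ * X]big1; last by move=> j ne; have := z j; rewrite ne => /eqP ->; rewrite expr0.
rewrite mulr1 em; case: (mdeg m) hm => [//|[//|d] _].
rewrite subrXX -addn1; apply: deg_geM => //; apply: spt_sum => j _.
have P (t : S) l : deg_ge 1 t -> deg_ge l (t ^+ l).
  move=> ht; elim: l => [|l IH]; first by apply: spt_all.
  by rewrite exprS -add1n; apply: deg_geM.
have := deg_geM (P s (d.+2.-1 - j)%N h) (P s' j h') => /spt_weak; apply => l.
by apply: leq_trans; have := ltn_ord j; lia.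
Qed.

(** The implicit function theorem on one axis. With [al] the derivative of [phi] along the axis and
    [N2] its part of degree at least two, [s] solves [al * s = phi (Y) - N2 (s)]; each iteration
    settles one more degree. *)
Lemma solve_axis (phi : S) (Y : 'I_n -> S) f i : hs f phi -> cf phi mnm0 = 0 ->
  cf phi (mU i) <> 0 -> nocst Y -> (forall j (r : R), 0 < r -> bnd (cst_w n r) r (Y j)) ->
  exists s, [/\ hs (ev s) s, cf s mnm0 = 0 & fcomp phi (axis i s) = fcomp phi Y].
Proof.
move=> [r r0 [[M b] _]] phi0 a0 ncY bY.
have w0 : forall j : 'I_n, 0 <= cst_w n r j by move=> j; apply: ltW.
have M0 := bnd_ge0 w0 b.
pose al := cf phi (mU i); pose A := cabs (al^-1).
have A0 : 0 <= A by apply: cabs_ge0.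
pose N2 := cmul (fun m => (1 < mdeg m)%N%:R) phi.
have dN2 : deg_ge 2 N2.
  by move=> m /=; case: ltnP => //=; rewrite mul0r.
have bN2 : bnd (cst_w n r) M N2.
  by rewrite -[M]mul1r; apply: bnd_cmul b => // m; apply: cabs_bool.
(* On the ball of radius [si * r] for the unknown, the part [N2] contributes at most half of that
   radius. *)
pose si := Num.min 1 (r / (2 * (M * A + 1))).
have D1 : 0 < 2 * (M * A + 1) by rewrite mulr_gt0 // ltr_wpDl // mulr_ge0.
have si0 : 0 < si by rewrite lt_min ltr01 divr_gt0.
have si1 : si <= 1 by rewrite ge_min lexx.
have hsi : A * (si ^+ 2 * M) <= si * r / 2.
  have h1 : si * (2 * (M * A + 1)) <= r by rewrite -ler_pdivlMr // ge_min lexx orbT.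
  have h2 : 0 <= si by exact: ltW.
  have h3 := ler_wpM2l h2 h1.
  have e : A * (si ^+ 2 * M) = si * (si * (2 * (M * A + 1))) / 2 - si * si by field.
  rewrite e; have : 0 <= si * si by rewrite mulr_ge0.
  lra.
(* On the polydisc of radius [ta * r], the given term [fcomp phi Y] contributes at most the other
   half. *)
pose ta := Num.min 1 (si * r / (2 * (M * A + 1))).
have ta0 : 0 < ta by rewrite lt_min ltr01 divr_gt0 // mulr_gt0.
have ta1 : ta <= 1 by rewrite ge_min lexx.
have hta : A * (ta * M) <= si * r / 2.
  have h1 : ta * (2 * (M * A + 1)) <= si * r by rewrite -ler_pdivlMr // ge_min lexx orbT.
  have e : A * (ta * M) = ta * (2 * (M * A + 1)) / 2 - ta by field.
  rewrite e; lra.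
pose rh := ta * r; have rh0 : 0 < rh by rewrite mulr_gt0.
have v0 : forall j : 'I_n, 0 <= cst_w n rh j by move=> j; apply: ltW.
have bphiY : bnd (cst_w n rh) (ta * M) (fcomp phi Y).
  apply: (@bnd_comp _ _ _ (cst_w n rh)) => //; first by move=> j; apply: bY.
  by apply: bnd_shrink b => //; [rewrite ltW|apply: nocst_deg].
pose al' := fps_const n al^-1.
pose Phi (Z : unit -> S) (_ : unit) := al' * (fcomp phi Y - fcomp N2 (axis i (Z tt))).
pose P (Z : unit -> S) := bnd (cst_w n rh) (si * r) (Z tt) /\ deg_ge 1 (Z tt).
have sr0 : 0 <= si * r by rewrite mulr_ge0 // ltW.
have nc Z : P Z -> nocst (axis i (Z tt)).
  move=> h; apply: nocst_axis; apply: (cf_spt_eq0 h.2); by rewrite mdeg0.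
have nd (F : S) (X : 'I_n -> S) : cf F mnm0 = 0 -> nocst X -> deg_ge 1 (fcomp F X).
  move=> hF hX; apply: spt_fcomp => // j hj; apply: (spt_weak (deg_ge_mmap1 (m := j) hX)) => m.
  by apply: leq_trans; rewrite lt0n mdeg_eq0; case: eqP => // e; rewrite e hF in hj.
have N20 : cf N2 mnm0 = 0 by rewrite /= mdeg0 mul0r.
have [||Z Z' N hZ hZ' d u|Z h|Z PZ fZ] := @graded_fixpoint C n unit (@mdeg n) P Phi (fun=> 0).
- by split; [exact: bnd0|exact: spt0].
- move=> Z hZ; split; last first.
    by rewrite /Phi -[1%N]add0n; apply: deg_geM; [apply: spt_all|apply: sptB; apply: nd => //; apply: nc].
  have bc : bnd (cst_w n rh) (si ^+ 2 * M) (fcomp N2 (axis i (Z tt))).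
    apply: (@bnd_comp _ _ _ (fun j => si * cst_w n r j)) => //; first exact: nc.
      by move=> j; rewrite /axis /cst_w; case: ifP => _; [exact: hZ.1|exact: bnd0].
    by apply: bnd_shrink_deg bN2 => //; rewrite ltW.
  by rewrite /Phi; apply: bnd_le (bndZ _ v0 (bndB v0 bphiY bc)); rewrite -/A mulrDr; lra.
- rewrite /Phi -mulrBr.
  have e (a b' c : S) : a - b' - (a - c) = - (b' - c) by ring.
  rewrite e -[N.+1]add0n; apply: deg_geM; first exact: spt_all.
  apply: sptN; apply: spt_fcompB (nc _ hZ) (nc _ hZ') _ => j hj.
  by apply: axis_contr; [exact: hZ.2|exact: hZ'.2|exact: dN2 hj|exact: d].
- split; last by move=> m nz; have [Z' i' d] := h (mdeg m).+1; rewrite lt0n mdeg_eq0;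
    case: eqP => // e; case: nz; have /sptP/(_ m) := d tt; rewrite cfB ltnn => H;
    have := H (fun h => notF h); rewrite (cf_spt_eq0 i'.2) ?subr0 // e mdeg0.
  apply: bnd_closed => N; have [Z' i' d] := h N; exists (Z' tt); first exact: i'.1.
  exact/eqt_sub.
exists (Z tt); split.
- by apply: hs_ev rh0 (fun=> lexx _) PZ.1.
- by apply: (cf_spt_eq0 PZ.2); rewrite mdeg0.
pose lin : S := \sum_j fps_const n (cf phi (mU j)) * fX C j.
have split_phi : phi = lin + N2.
  apply: fpsP => m; rewrite cfD /lin cf_sum.
  under eq_bigr do rewrite cf_constM.
  have [lt|le] := ltnP 1 (mdeg m).
    rewrite big1 /=; last first.
      by move=> j _; case: eqP => [e|]; rewrite ?mulr0 //; move: lt; rewrite e mdeg1.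
    by rewrite lt mul1r add0r.
  rewrite /= ltnNge le mul0r addr0.
  have [m0|] := eqVneq (mdeg m) 0%N.
    have e0 : m = mnm0 by apply/eqP; rewrite -mdeg_eq0 m0.
    by rewrite big1 ?e0 // => j _; rewrite eq_sym mnm1_eq0 mulr0.
  move=> ne; have /eqP/mdeg1P[j /eqP ej] : mdeg m = 1%N by lia.
  rewrite (bigD1 j) //= ej eqxx mulr1 big1 ?addr0 // => l nel.
  by rewrite eq_mnm1 eq_sym (negbTE nel) mulr0.
have elin : fcomp lin (axis i (Z tt)) = fps_const n al * Z tt.
  rewrite /lin (big_morph (fun F => fcomp F (axis i (Z tt))) (fcompD _) (_ : _ = 0)); last first.
    by have := fcompC (axis i (Z tt)) 0; rewrite !raddf0.
  rewrite (bigD1 i) //= fcompM; last exact: nc.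
  rewrite fcompC fcompX; last exact: nc.
  have -> : axis i (Z tt) i = Z tt by rewrite /axis eqxx.
  rewrite big1; last first.
    move=> j ne; rewrite fcompM; last exact: nc.
    rewrite fcompX; last exact: nc.
    by rewrite /axis (negbTE ne) mulr0.
  by rewrite addr0.
rewrite {1}split_phi fcompD elin -[in fps_const n al * _](fZ tt) /Phi mulrA.
have -> : fps_const n al * al' = 1.
  by rewrite -rmorphM divff ?rmorph1 //; apply/eqP.
by rewrite mul1r subrK.
Qed.
End Axis.
End Small.

Lemma cfM0 (K : comNzRingType) n (f g : fps K n) : cf (f * g) mnm0 = cf f mnm0 * cf g mnm0.
Proof.
have e : f = fps_const n (cf f mnm0) + (f - fps_const n (cf f mnm0)) by ring.
have h : deg_ge 1 (f - fps_const n (cf f mnm0)).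
  move=> m nz; rewrite lt0n mdeg_eq0; case: eqP => // e0; case: nz.
  by rewrite e0 cfB /= eqxx subrr.
have h2 : deg_ge 1 ((f - fps_const n (cf f mnm0)) * g).
  by rewrite -[1%N]addn0; apply: deg_geM => //; apply: spt_all.
rewrite {1}e mulrDl cfD cf_constM (cf_spt_eq0 h2) ?addr0 //; by rewrite mdeg0.
Qed.

(** * Uniqueness of the frequency *)

Section Uniqueness.
Variables (R : realType) (k th0 th : Cx R).
Local Notation C := (Cx R).
Local Notation S4 := (fps C 4).
Local Notation wp := (wpf th0 th).
Local Notation wq := (wqf k th0 th).

Lemma act_chain a (G : fps C 3) (f : S4) : a = ord0 \/ a = i41 -> cf f mnm0 = 0 ->
  fder a (fcomp G (act f)) = fcomp (fder ord0 G) (act f) * fder a f.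
Proof.
move=> ha f0; rewrite fcomp_chain; last exact: nocst_act.
rewrite big_ord3 -[act _ i31]/(vx R) -[act _ i32]/(vt R) -[act _ ord0]/f.
have -> : fder a (vx R) = 0 by rewrite fderE_vx; case: ha => ->.
have -> : fder a (vt R) = 0 by rewrite fderE_vt; case: ha => ->.
have aux (f1 f2 f3 g1 : S4) : f1 * g1 + (f2 * 0 + f3 * 0) = f1 * g1 by ring.
exact: aux.
Qed.

Lemma params_chain a (F f g : S4) : a = ord0 \/ a = i41 -> nocst (params f g) ->
  fder a (fcomp F (params f g)) =
   fcomp (fder ord0 F) (params f g) * fder a f + fcomp (fder i41 F) (params f g) * fder a g.
Proof.
move=> ha nc; rewrite fcomp_chain // big_ord4.
rewrite -[params _ _ i42]/(vx R) -[params _ _ i43]/(vt R) -[params _ _ ord0]/f -[params _ _ i41]/g.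
have -> : fder a (vx R) = 0 by rewrite fderE_vx; case: ha => ->.
have -> : fder a (vt R) = 0 by rewrite fderE_vt; case: ha => ->.
have aux (f1 f2 f3 f4 g1 g2 : S4) : f1 * g1 + (f2 * g2 + (f3 * 0 + f4 * 0)) = f1 * g1 + f2 * g2 by ring.
exact: aux.
Qed.

Lemma Dop_act (G : fps C 3) (f : S4) : cf f mnm0 = 0 ->
  Dop (fcomp G (act f)) = fcomp (fder ord0 G) (act f) * Dop f.
Proof.
move=> f0; rewrite !DopE !act_chain //; [|by right|by left].
by move: (fcomp _ _) (fder ord0 f) (fder i41 f) => c a b; ring.
Qed.
Lemma Dop_params (F f g : S4) : nocst (params f g) ->
  Dop (fcomp F (params f g)) =
   fcomp (fder ord0 F) (params f g) * Dop f + fcomp (fder i41 F) (params f g) * Dop g.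
Proof.
move=> nc; rewrite !DopE !params_chain //; [|by right|by left].
move: (fcomp (fder ord0 F) _) (fcomp (fder i41 F) _) (fder ord0 f) (fder i41 f) (fder ord0 g) (fder i41 g).
by move=> c c' a b a' b'; ring.
Qed.

(** A resonant factor preserves modes, so it respects the splitting of [f] into its mode [1] part
    and the rest. *)
Lemma T1_diagM (h f : S4) : spt Sdiag h -> T1 (h * f) = h * T1 f.
Proof.
move=> hh; have e : h * f = u1 R * (h * T1 f) + h * Pi1 f.
  by rewrite -{1}(T1_Pi1 f); move: (Pi1 f) (T1 f) => X Y; ring.
have T1D (a b : S4) : T1 (a + b) = T1 a + T1 b by rewrite /T1 /diag dropvD cmulD.
have hT : spt Sdiag (T1 f).
  apply: (spt_weak (spt_T1 (spt_all (S := fun=> True) (f := f) (fun=> I)))); mink_lia.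
have h1 : spt Sdiag (h * T1 f) by move: (T1 f) hT => X hX; spt_tac.
rewrite e T1D T1_XM // -[RHS]addr0; congr (_ + _).
have hP : spt (fun m : multinom 4 => m ord0 <> (m i41).+1) (Pi1 f).
  apply: (spt_weak (spt_Pi1 (spt_all (S := fun=> True) (f := f) (fun=> I)))); mink_lia.
have h2 : spt (fun m : multinom 4 => m ord0 <> (m i41).+1) (h * Pi1 f).
  by move: (Pi1 f) hP => X hX; spt_tac.
have h3 : spt (fun=> False) (T1 (h * Pi1 f)) by apply: (spt_weak (spt_T1 h2)); mink_lia.
by apply: fpsP => m; rewrite cf0; apply: contrapT => /h3.
Qed.
Lemma T1_Dop (f : S4) : T1 (Dop f) = T1 f.
Proof.
apply: fpsP => m; rewrite /T1 /diag /=; case: eqP => e; last by rewrite !mul0r.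
by rewrite /mode_ph !mnmDE !mU0E e addn1 addn0 -(@natr1 _ (m i41)); ring.
Qed.

(* The resonant linear part of [f] is invertible, so an eigenvalue equation determines [h]. *)
Lemma eigen_unique (g h f : S4) : spt Sdiag g -> spt Sdiag h -> g * Dop f = h * f ->
  cf f (mU ord0) <> 0 -> g = h.
Proof.
move=> hg hh e nz; apply/eqP; rewrite -subr_eq0; apply/eqP.
apply: (@fps_cancel _ _ (T1 f)).
  exists (cf f (mU ord0))^-1; rewrite /T1 /diag /= !mnm0E eqxx mul1r add0m.
  by rewrite mulVf //; apply/eqP.
have E : g * T1 f = h * T1 f.
  have := congr1 (@T1 R) e; rewrite (T1_diagM (Dop f) hg) (T1_diagM f hh) T1_Dop //.
transitivity (g * T1 f - h * T1 f); first by ring.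
by rewrite E subrr.
Qed.

(** Inserting the eigenvalue equations, the derivative of [W1 * W2] in [u1] becomes
    [e * u2 * Jac W1 W2 = e * u2]. The difference of the two sides is thus resonant with zero
    derivative in [u1], and it has no term free of [u1] and [u2] because [W1] has no mode [0]. *)
Lemma theta_eq (e : C) (W1 W2 : S4) : (e = 1 \/ e = -1) ->
  Dop W1 = fps_const 4 e * W1 -> Dop W2 = - (fps_const 4 e * W2) -> Jac W1 W2 = 1 ->
  W1 * W2 = fps_const 4 e * (u1 R * u2 R).
Proof.
move=> he h1 h2 J; set th' := W1 * W2; set E := fps_const 4 e in h1 h2 *.
have E2 : E * E = 1.
  by rewrite /E -rmorphM; case: he => ->; rewrite ?mulr1 ?mulrNN ?mulr1 rmorph1.
have dth : Dop (th' - E * (u1 R * u2 R)) = 0.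
  rewrite DopD DopN !DopM h1 h2 Dop_u1 Dop_u2 Dop_c; ring.
have fth : fder ord0 (th' - E * (u1 R * u2 R)) = 0.
  rewrite fderB !fderM fderC fderE_u1 fderE_u2 /= mulr1n mulr0n.
  have e1 : W1 = E * Dop W1 by rewrite h1 mulrA E2 mul1r.
  have e2 : W2 = - (E * Dop W2) by rewrite h2 mulrN opprK mulrA E2 mul1r.
  have -> : fder ord0 W1 * W2 + W1 * fder ord0 W2 = E * u2 R * Jac W1 W2.
    rewrite [in X in X + _]e2 [in X in _ + X]e1 !DopE /Jac; ring.
  by rewrite J; ring.
have s1 : spt (fun m : multinom 4 => (0 < m ord0 + m i41)%N) W1.
  move=> m nz; have /eqP := congr1 (fun f => cf f m) h1; rewrite cf_constM /=.
  rewrite -subr_eq0 -mulrBl mulf_eq0 => /orP[|/eqP//].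
  rewrite /mode_ph addr0 subr_eq0 => /eqP em; rewrite lt0n; apply/eqP => z.
  have [z0 z1] : m ord0 = 0%N /\ m i41 = 0%N by lia.
  move: em; rewrite z0 z1 subrr; case: he => -> /eqP; rewrite eq_sym ?oppr_eq0 oner_eq0 //.
have s2 : spt (fun m : multinom 4 => (0 < m ord0 + m i41)%N) (th' - E * (u1 R * u2 R)).
  have hW : spt (fun=> True) W2 by apply: spt_all.
  by rewrite /E /th'; spt_tac.
have s3 : spt Sdiag (th' - E * (u1 R * u2 R)) by apply/Dop_diag.
apply/eqP; rewrite -subr_eq0; apply/eqP; apply: fpsP => m; rewrite cf0.
apply: contrapT => nz; have p := s2 _ nz; have q := s3 _ nz; rewrite /Sdiag in q.
have m0 : m ord0 != 0%N by lia.
have := congr1 (fun f => cf (u1 R * f) m) fth; rewrite cf_X_fder mulr0 cf0 => /eqP.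
by rewrite mulf_eq0 pnatr_eq0 (negbTE m0) => /eqP.
Qed.

Lemma frequency_determined (w1 w2 : S4) (Gam : fps C 3) mu xi pi g : siegel_nf k th0 th mu xi pi g ->
  Jac w1 w2 = 1 -> cf (w1 * w2) mnm0 = 0 ->
  fcomp Gam (act (w1 * w2)) = hamf k th0 th (u1 R) (u2 R) ->
  exists2 e : C, (e = 1 \/ e = -1) &
    fcomp (fder ord0 Gam) (act (fps_const 4 e * (u1 R * u2 R))) = fps_const 4 e * g.
Proof.
move=> nf Jw w0 eH; set q := u1 R + xi; set p := u2 R + pi.
have q0 : cf q mnm0 = 0 by rewrite cfD cf_fX0 add0r; apply: nocst_lev; exact: nf_lev_xi nf.
have p0 : cf p mnm0 = 0 by rewrite cfD cf_fX0 add0r; apply: nocst_lev; exact: nf_lev_pi nf.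
have nc : nocst (params q p) by apply: nocst_params.
pose k0 := fcomp (fder ord0 Gam) (act (w1 * w2)).
have or0 : ord0 = ord0 :> 'I_4 \/ ord0 = i41 by left.
have or1 : i41 = ord0 :> 'I_4 \/ i41 = i41 by right.
have d0 : u2 R + wq (u1 R) (u2 R) = k0 * (fder ord0 w1 * w2 + w1 * fder ord0 w2).
  have := congr1 (fder ord0) eH; rewrite act_chain // fderM -/k0 => ->.
  rewrite (hamf_fder _ _ _ _ _ or0) fderE_u1 fderE_u2 /= mulr1n mulr0n.
  by move: (wq _ _) (wp _ _) => X Y; ring.
have d1 : u1 R + wp (u1 R) (u2 R) = k0 * (fder i41 w1 * w2 + w1 * fder i41 w2).
  have := congr1 (fder i41) eH; rewrite act_chain // fderM -/k0 => ->.
  rewrite (hamf_fder _ _ _ _ _ or1) fderE_u1 fderE_u2 /= mulr1n mulr0n.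
  by move: (wq _ _) (wp _ _) => X Y; ring.
(* The substitution is made opaque; from here on it acts as a ring morphism with a chain rule. *)
have [ph hph] : exists ph : S4 -> S4, forall f, ph f = fcomp f (params q p).
  by exists (fun f => fcomp f (params q p)).
have phM f f' : ph (f * f') = ph f * ph f' by rewrite !hph; apply: fcompM.
have phD f f' : ph (f + f') = ph f + ph f' by rewrite !hph; apply: fcompD.
have phN f : ph (- f) = - ph f by rewrite !hph; apply: fcompN.
have ph1 : ph 1 = 1 by rewrite hph; have := fcompC (params q p) 1; rewrite !rmorph1.
have phX i : ph (fX C i) = params q p i by rewrite hph; apply: fcompX.
have phc c : ph (fps_const 4 c) = fps_const 4 c by rewrite hph; apply: fcompC.
have phDop f : Dop (ph f) = ph (fder ord0 f) * Dop q + ph (fder i41 f) * Dop p.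
  by rewrite !hph; apply: Dop_params.
have phd a f : a = ord0 \/ a = i41 ->
    fder a (ph f) = ph (fder ord0 f) * fder a q + ph (fder i41 f) * fder a p.
  by move=> ha; rewrite !hph; apply: params_chain.
pose K := ph k0.
have D0 : p + wq q p = K * (ph (fder ord0 w1) * ph w2 + ph w1 * ph (fder ord0 w2)).
  have := congr1 ph d0.
  rewrite (phD (u2 R)) (phM k0) (phD (fder ord0 w1 * w2)) (phM (fder ord0 w1)) (phM w1) -/K => <-.
  by rewrite phX /wqf (Wq_morph phD phN phM ph1) !phc !phX.
have D1 : q + wp q p = K * (ph (fder i41 w1) * ph w2 + ph w1 * ph (fder i41 w2)).
  have := congr1 ph d1.
  rewrite (phD (u1 R)) (phM k0) (phD (fder i41 w1 * w2)) (phM (fder i41 w1)) (phM w1) -/K => <-.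
  by rewrite phX /wpf (Wp_morph phD phN phM ph1) !phc !phX.
have JY : ph (fder ord0 w1) * ph (fder i41 w2) - ph (fder i41 w1) * ph (fder ord0 w2) = 1.
  by have := congr1 ph Jw; rewrite /Jac phD phN !phM ph1.
have eq1 := nf_eq1 nf; have eq2 := nf_eq2 nf; rewrite -/q -/p in eq1 eq2.
have DW1 : g * Dop (ph w1) = K * ph w1.
  rewrite phDop.
  transitivity (ph (fder ord0 w1) * (g * Dop q) + ph (fder i41 w1) * (g * Dop p)).
    by move: (ph _) (ph _) (Dop q) (Dop p) => a b c d; ring.
  rewrite eq1 eq2 D0 D1.
  transitivity (K * ph w1 * (ph (fder ord0 w1) * ph (fder i41 w2) - ph (fder i41 w1) * ph (fder ord0 w2))).
    by ring.
  by rewrite JY mulr1.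
have DW2 : g * Dop (ph w2) = - (K * ph w2).
  rewrite phDop.
  transitivity (ph (fder ord0 w2) * (g * Dop q) + ph (fder i41 w2) * (g * Dop p)).
    by move: (ph _) (ph _) (Dop q) (Dop p) => a b c d; ring.
  rewrite eq1 eq2 D0 D1.
  transitivity (- (K * ph w2 * (ph (fder ord0 w1) * ph (fder i41 w2) - ph (fder i41 w1) * ph (fder ord0 w2)))).
    by ring.
  by rewrite JY mulr1.
have JW : Jac (ph w1) (ph w2) = 1.
  rewrite /Jac !phd //.
  transitivity ((ph (fder ord0 w1) * ph (fder i41 w2) - ph (fder i41 w1) * ph (fder ord0 w2)) * Jac q p).
    by rewrite /Jac; ring.
  by rewrite JY mul1r; exact: nf_jac nf.
have W0 : cf (ph w1 * ph w2) mnm0 = 0.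
  by rewrite -phM hph; exact: (nocst_comp (Z := fun _ : 'I_1 => w1 * w2) (fun=> w0) nc ord0).
have eK : K = fcomp (fder ord0 Gam) (act (ph w1 * ph w2)).
  have e : act (ph w1 * ph w2) = fun i => fcomp (act (w1 * w2) i) (params q p).
    by apply/funext; apply: ord3P; rewrite /act /vec3 /= -hph ?phM ?phX.
  rewrite e /K hph /k0 fcomp_comp //; first exact: nocst_act.
  by apply: nocst_comp => //; apply: nocst_act.
have unit_g := nf_lev_g nf; have dg := nf_diag_g nf.
(* [K] is a series in [ph w1 * ph w2], [x] and [t], and [D] kills this product because its factors
   have opposite eigenvalues. *)
have dK : spt Sdiag K.
  apply/Dop_diag; rewrite eK Dop_act //.
  have -> : Dop (ph w1 * ph w2) = 0.
    apply: (fps_cancel1 unit_g); rewrite DopM mulrDr mulrCA.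
    transitivity (g * Dop (ph w1) * ph w2 + ph w1 * (g * Dop (ph w2))); first by ring.
    by rewrite DW1 DW2; ring.
  by rewrite mulr0.
(* As the Jacobian is [1] at the origin, [ph w1] or [ph w2] has a nonzero linear term in [u1];
   whichever it is decides the sign. *)
have [e he eg] : exists2 e : C, (e = 1 \/ e = -1) & K = fps_const 4 e * g.
  have lin f i : cf (fder i f) mnm0 = cf f (mU i) by rewrite /= add0m mnm0E mulr1n.
  have := congr1 (fun f => cf f mnm0) JW; rewrite /Jac cfB !cfM0 !lin cf1 eqxx => J0.
  have [z|/eqP nz] := eqVneq (cf (ph w1) (mU ord0)) 0.
    exists (-1); first by right.
    have nz2 : cf (ph w2) (mU ord0) <> 0.
      by move=> z2; move: J0; rewrite z z2 mul0r mulr0 subrr => /eqP; rewrite eq_sym oner_eq0.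
    have e : g = - K.
      by apply: (eigen_unique (f := ph w2)) => //; [exact: sptN|rewrite DW2 mulNr].
    by rewrite rmorphN rmorph1 mulN1r e opprK.
  exists 1; first by left.
  by rewrite rmorph1 mul1r; apply/esym; apply: (eigen_unique (f := ph w1)).
exists e => //.
have h1 : Dop (ph w1) = fps_const 4 e * ph w1.
  apply/eqP; rewrite -subr_eq0; apply/eqP; apply: (fps_cancel1 unit_g).
  by rewrite mulrBr DW1 eg; ring.
have h2 : Dop (ph w2) = - (fps_const 4 e * ph w2).
  apply/eqP; rewrite -subr_eq0; apply/eqP; apply: (fps_cancel1 unit_g).
  by rewrite mulrBr DW2 eg; ring.
by rewrite -(theta_eq he h1 h2 JW) -eK.
Qed.
End Uniqueness.

(** * Germs *)

Section Near.
Variables (R : realType).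
Local Notation C := (Cx R).

Definition nearz n (P : ('I_n -> C) -> Prop) :=
  exists2 r : R, 0 < r & forall z, (forall i, cabs (z i) < r) -> P z.
Lemma nearzI n (P Q : ('I_n -> C) -> Prop) : nearz P -> nearz Q -> nearz (fun z => P z /\ Q z).
Proof.
move=> [r r0 h] [r' r'0 h']; exists (Num.min r r'); first by rewrite lt_min r0.
move=> z hz; split; [apply: h => i|apply: h' => i]; apply: lt_le_trans (hz i) _.
  by rewrite ge_min lexx.
by rewrite ge_min lexx orbT.
Qed.
Lemma nearzW n (P Q : ('I_n -> C) -> Prop) : (forall z, P z -> Q z) -> nearz P -> nearz Q.
Proof. by move=> h [r r0 H]; exists r => // z /H/h. Qed.

Definition zset n (z : 'I_n -> C) (i : 'I_n) (s : C) : 'I_n -> C := fun j => if j == i then s else z j.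

Lemma derive1_hs n (f : ('I_n -> C) -> C) F i : hs f F ->
  nearz (fun z => derive1 (fun s => f (zset z i s)) (z i) = ev (fder i F) z).
Proof.
move=> h; have [r r0 [K K0 T]] := hs_taylor i h; exists r => // z hz.
apply: (derive1_taylor r0 K0) => t ht.
have -> : zset z i (z i + t) = zadd z i t.
  by apply/funext => j; rewrite /zset /zadd; case: eqP => [->|].
have -> : zset z i (z i) = z by apply/funext => j; rewrite /zset; case: eqP => [->|].
by apply: T => // j; apply: ltW.
Qed.

Lemma near0_4P (P : C -> C -> C -> C -> Prop) :
  near0_4 P <-> nearz (fun z : 'I_4 -> C => P (z ord0) (z i41) (z i42) (z i43)).
Proof.
split=> [[r [r0 h]]|[r r0 h]].
  by exists r => // z hz; apply: h; rewrite ltc_cabs.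
exists r; split=> // a b c d; rewrite !ltc_cabs => ha hb hc hd.
by apply: (h (vec4 a b c d)); apply: ord4P.
Qed.
Lemma near0_3P (P : C -> C -> C -> Prop) :
  near0_3 P <-> nearz (fun z : 'I_3 -> C => P (z ord0) (z i31) (z i32)).
Proof.
split=> [[r [r0 h]]|[r r0 h]].
  by exists r => // z hz; apply: h; rewrite ltc_cabs.
exists r; split=> // a b c; rewrite !ltc_cabs => ha hb hc.
by apply: (h (vec3 a b c)); apply: ord3P.
Qed.

(* The involution [e <-> x - e] turns the two singular points [x = 0] and [x = e] into the
   coordinate hyperplanes [x = 0] and [t = 0], where [t = x - e]. *)
Definition flip4 (z : 'I_4 -> C) : 'I_4 -> C := vec4 (z ord0) (z i41) (z i42) (z i42 - z i43).
Definition flip3 (z : 'I_3 -> C) : 'I_3 -> C := vec3 (z ord0) (z i31) (z i31 - z i32).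

Lemma nearz_flip4 (P : ('I_4 -> C) -> Prop) : nearz P -> nearz (fun z => P (flip4 z)).
Proof.
move=> [r r0 h]; exists (r / 2); first by rewrite divr_gt0.
move=> z hz; apply: h; apply: ord4P; rewrite /flip4 /vec4 /=.
- by have := hz ord0; lra.
- by have := hz i41; lra.
- by have := hz i42; lra.
- by apply: le_lt_trans (cabsB _ _) _; have := hz i42; have := hz i43; lra.
Qed.
Lemma nearz_flip3 (P : ('I_3 -> C) -> Prop) : nearz P -> nearz (fun z => P (flip3 z)).
Proof.
move=> [r r0 h]; exists (r / 2); first by rewrite divr_gt0.
move=> z hz; apply: h; apply: ord3P; rewrite /flip3 /vec3 /=.
- by have := hz ord0; lra.
- by have := hz i31; lra.
- by apply: le_lt_trans (cabsB _ _) _; have := hz i31; have := hz i32; lra.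
Qed.
Lemma cf_fXB0 n (i j : 'I_n) : cf (fX C i - fX C j) mnm0 = 0.
Proof. by rewrite cfB !cf_fX0 subrr. Qed.

Lemma hs_flip4 (f : ('I_4 -> C) -> C) F : hs f F -> exists F', hs (fun z => f (flip4 z)) F'.
Proof.
move=> h; pose Y' : 'I_4 -> fps C 4 := vec4 (u1 R) (u2 R) (vx R) (vx R - vt R).
exists (fcomp F Y').
have := @hs_comp R 4 4 f F (fun i z => flip4 z i) Y' h.
apply.
  apply: ord4P; rewrite /flip4 /Y' /vec4 /=; try exact: hsX.
  by apply: hsB; apply: hsX.
by apply: ord4P; [exact: cf_fX0|exact: cf_fX0|exact: cf_fX0|exact: cf_fXB0].
Qed.
Lemma hs_flip3 (f : ('I_3 -> C) -> C) F : hs f F -> exists F', hs (fun z => f (flip3 z)) F'.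
Proof.
move=> h; pose Y' : 'I_3 -> fps C 3 := vec3 (fX C ord0) (fX C i31) (fX C i31 - fX C i32).
exists (fcomp F Y').
have := @hs_comp R 3 3 f F (fun i z => flip3 z i) Y' h.
apply.
  apply: ord3P; rewrite /flip3 /Y' /vec3 /=; try exact: hsX.
  by apply: hsB; apply: hsX.
by apply: ord3P; [exact: cf_fX0|exact: cf_fX0|exact: cf_fXB0].
Qed.
Lemma hs_nearz n (f g : ('I_n -> C) -> C) F : hs f F -> hs g F -> nearz (fun z => f z = g z).
Proof. exact: hs_agree. Qed.
Lemma hs_extz n (f g : ('I_n -> C) -> C) F : hs f F -> nearz (fun z => f z = g z) -> hs g F.
Proof. by move=> h [r r0 e]; apply: hs_ext h _; exists r. Qed.
End Near.

(** * Vanishing of the action at the critical point *)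

Section Main.
Variables (R : realType) (k th0 th : Cx R).
Local Notation C := (Cx R).
Local Notation S4 := (fps C 4).
Implicit Types (H : C -> C -> C -> C -> C).

Definition hamfun (z : 'I_4 -> C) : C := ham k th0 th (z i42) (z i43) (z ord0) (z i41).

Lemma hs_hamfun : hs hamfun (hamf k th0 th (u1 R) (u2 R)).
Proof. exact: (hs_ham k th0 th (@hsX R 4 i42) (@hsX R 4 i43) (@hsX R 4 ord0) (@hsX R 4 i41)). Qed.

Lemma hs_axis (s : S4) i j : hs (ev s) s -> hs (ev (axis i s j)) (axis i s j).
Proof.
move=> h; rewrite /axis; case: ifP => // _.
have := hsC 4 (0 : C); rewrite raddf0 => h0.
by apply: hs_ext0 h0 _ => z; rewrite ev0.
Qed.

(* If [u1 u2] did not vanish at the origin it would be a submersion there, and [H] would be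
   constant along its fibres; but every fibre near the origin meets a coordinate axis, on
   which [H = 0] when [x = t = 0]. *)
Lemma action_vanishes (w1 w2 : S4) (f1 f2 : ('I_4 -> C) -> C) (G : C -> C -> C -> C) :
  hs f1 w1 -> hs f2 w2 -> Jac w1 w2 = 1 ->
  nearz (fun z => hamfun z = G (f1 z * f2 z) (z i42) (z i43)) ->
  cf (w1 * w2) mnm0 = 0.
Proof.
move=> h1 h2 J [r r0 hG]; apply: contrapT => nz.
have lin (f : S4) i : cf (fder i f) mnm0 = cf f (mU i) by rewrite /= add0m mnm0E mulr1n.
pose c0 := cf (w1 * w2) mnm0; pose phi := w1 * w2 - fps_const 4 c0.
have phi0 : cf phi mnm0 = 0 by rewrite cfB /= eqxx subrr.
have hphi : hs (fun z => f1 z * f2 z - c0) phi by apply: hsB; [apply: hsM|apply: hsC].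
have ephi l : cf phi (mU l) = cf (fder l w1) mnm0 * cf w2 mnm0 + cf w1 mnm0 * cf (fder l w2) mnm0.
  rewrite -!cfM0 -cfD -fderM lin cfB [X in _ - X](_ : _ = 0) ?subr0 //.
  by rewrite /= mnm1_eq0.
(* If both derivatives of [w1 * w2] vanished at the origin, so would the constant term of [w1] times
   the Jacobian, that is, the constant term of [w1] itself. *)
have [i [hi nzi]] : exists i, (i = ord0 \/ i = i41) /\ cf phi (mU i) <> 0.
  apply: contrapT => Hn.
  have z0 : cf phi (mU ord0) = 0 by apply: contrapT => z; apply: Hn; exists ord0; split=> //; left.
  have z1 : cf phi (mU i41) = 0 by apply: contrapT => z; apply: Hn; exists i41; split=> //; right.
  rewrite !ephi in z0 z1.
  have := congr1 (fun f => cf f mnm0) J; rewrite /Jac cfB !cfM0 cf1 eqxx.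
  move: nz z0 z1; rewrite cfM0.
  move: (cf w1 mnm0) (cf w2 mnm0) (cf (fder ord0 w1) mnm0) (cf (fder i41 w1) mnm0)
    (cf (fder ord0 w2) mnm0) (cf (fder i41 w2) mnm0) => a b p q p' q' nz z0 z1 j.
  apply: nz.
  have : a * (p * q' - q * p') = 0.
    have -> : a * (p * q' - q * p') = p * (q * b + a * q') - q * (p * b + a * p') by ring.
    by rewrite z0 z1; ring.
  by rewrite j mulr1 => ->; rewrite mul0r.
pose Y : 'I_4 -> S4 := vec4 (u1 R) (u2 R) 0 0.
have ncY : nocst Y by apply: ord4P; [exact: cf_fX0|exact: cf_fX0| |].
have bY j (r' : R) : 0 < r' -> bnd (cst_w 4 r') r' (Y j).
  move=> r'0; have w0 : forall l : 'I_4, 0 <= cst_w 4 r' l by move=> l; apply: ltW.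
  move: j; apply: ord4P; rewrite /Y /vec4 /=.
  - exact: (bndX ord0 w0).
  - exact: (bndX i41 w0).
  - by apply: bnd0; apply: ltW.
  - by apply: bnd0; apply: ltW.
have [s [hs_s s0 es]] := solve_axis hphi phi0 nzi ncY bY.
have a1 := hs_comp hphi (fun j => hs_axis i j hs_s) (nocst_axis i s0).
have hY j : hs (ev (Y j)) (Y j) by apply: hs_ev ltr01 (fun=> lexx _) (bY j 1 ltr01).
have a2 := hs_comp hphi hY ncY.
rewrite es in a1.
have [r1 r10 e1] := hs_nearz a1 a2.
have [r2 r20 e2] := hs_small hs_s s0 r0.
pose c : R := Num.min r (Num.min r1 r2) / 2.
have m0 : 0 < Num.min r (Num.min r1 r2) by rewrite !lt_min r0 r10 r20.
have c0' : 0 < c by rewrite divr_gt0.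
have cm : c < Num.min r (Num.min r1 r2) by rewrite /c; lra.
have [cr cr1 cr2] : [/\ c < r, c < r1 & c < r2] by move: cm; rewrite !lt_min => /andP[-> /andP[-> ->]].
(* The energy at [(c, c, 0, 0)] is the square of [c], while the point [A] of axis [i] with the same
   action has energy zero. *)
pose cc : C := ((c%:C)%C); pose z : 'I_4 -> C := vec4 cc cc 0 0.
have cz j : cabs (z j) <= c.
  have ecc : cabs cc = c by rewrite /cc cabs_real // ltW.
  have c00 : cabs (0 : C) <= c by rewrite cabs0 ltW.
  have lc : cabs cc <= c by rewrite ecc.
  move: j; apply: ord4P; [exact: lc|exact: lc|exact: c00|exact: c00].
pose A : 'I_4 -> C := fun j => ev (axis i s j) z.
pose B : 'I_4 -> C := fun j => ev (Y j) z.
have EB : B = z.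
  by apply/funext; apply: ord4P; rewrite /B /Y /z /vec4 /= ?evX ?ev0.
have Es : cabs (ev s z) < r by apply: e2 => j; apply: le_lt_trans (cz j) cr2.
have EA j : A j = if j == i then ev s z else 0 by rewrite /A /axis; case: ifP => // _; rewrite ev0.
have rA j : cabs (A j) < r by rewrite EA; case: ifP => // _; rewrite cabs0.
have rB j : cabs (B j) < r by rewrite EB; apply: le_lt_trans (cz j) cr.
have := e1 z (fun j => le_lt_trans (cz j) cr1); rewrite -/A -/B => /addIr E12.
have A2 : A i42 = 0 by rewrite EA; case: hi => ->.
have A3 : A i43 = 0 by rewrite EA; case: hi => ->.
have : hamfun A = hamfun B by rewrite !hG // E12 A2 A3 EB.
rewrite /hamfun A2 A3 EB /z /vec4 /=.
have ham0 (q p : C) : ham k th0 th 0 0 q p = q * p by rewrite /ham; ring.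
rewrite !ham0.
have -> : A ord0 * A i41 = 0 by rewrite !EA; case: hi => ->; rewrite /= ?mul0r ?mulr0.
move/esym/eqP; rewrite mulf_eq0 orbb => /eqP /(congr1 (@cabs R)).
by rewrite cabs0 /cc cabs_real ?(ltW c0') // => e; rewrite e ltxx in c0'.
Qed.
End Main.

(** * Normal forms in the original parameters *)

Section Assembly.
Variables (R : realType) (k th0 th : Cx R).
Local Notation C := (Cx R).
Local Notation S4 := (fps C 4).
Local Notation S3 := (fps C 3).

Definition hamxe (q p x e : C) : C := ham k th0 th x (x - e) q p.

Lemma subKC (x e : C) : x - (x - e) = e. Proof. by ring. Qed.

Lemma hs_act (U1 U2 : S4) f1 f2 i : hs f1 U1 -> hs f2 U2 ->
  hs (fun z => vec3 (f1 z * f2 z) (z i42) (z i43) i) (act (U1 * U2) i).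
Proof.
move=> h1 h2; move: i; apply: ord3P.
- exact: hsM.
- exact: hsX.
- exact: hsX.
Qed.

Lemma hs_Jac (U1 U2 : S4) : hs (ev U1) U1 -> hs (ev U2) U2 ->
  hs (fun z => ev (fder ord0 U1) z * ev (fder i41 U2) z - ev (fder i41 U1) z * ev (fder ord0 U2) z)
     (Jac U1 U2).
Proof. by move=> h1 h2; apply: hsB; apply: hsM; apply: hs_fder; eassumption. Qed.

Lemma normal_form_exists : exists G, BS_normal_form hamxe G.
Proof.
have [G [U1 [U2 [hG h1 h2 nc [J E]]]]] := normal_form_series k th0 th.
have an3 := hs_analytic (projT2 (cid (hs_flip3 hG))).
have an1 := hs_analytic (projT2 (cid (hs_flip4 h1))).
have an2 := hs_analytic (projT2 (cid (hs_flip4 h2))).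
exists (fun h x e => ev G (vec3 h x (x - e))); split; first exact: an3.
exists (fun a b x e => ev U1 (vec4 a b x (x - e))), (fun a b x e => ev U2 (vec4 a b x (x - e))).
split; first exact: an1. split; first exact: an2.
apply/near0_4P.
have nJ := hs_Jac h1 h2; rewrite J in nJ.
have {}nJ := hs_nearz nJ (hs1 R 4).
have U0 : cf (U1 * U2) mnm0 = 0 by rewrite cfM0 (nc ord0 : cf U1 mnm0 = 0) mul0r.
have nH := hs_comp hG (fun i => hs_act i h1 h2) (nocst_act U0).
rewrite E in nH.
have {}nH := hs_nearz (hs_hamfun k th0 th) nH.
have d1 := nearzI (derive1_hs ord0 h1) (derive1_hs i41 h2).
have d2 := nearzI (derive1_hs i41 h1) (derive1_hs ord0 h2).
apply: nearzW (nearz_flip4 (nearzI (nearzI d1 d2) (nearzI nJ nH))).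
move=> z [[[e1 e2] [e3 e4]] [eJ eH]].
have s0 s : zset (flip4 z) ord0 s = vec4 s (z i41) (z i42) (z i42 - z i43).
  by apply/funext; apply: ord4P.
have s1 s : zset (flip4 z) i41 s = vec4 (z ord0) s (z i42) (z i42 - z i43).
  by apply/funext; apply: ord4P.
split; last exact: eH.
(* The functions differentiated in the goal match those of [derive1_hs] only under the binder, after
   [s0] or [s1]. *)
have {}e1 := etrans (congr1 (fun f => derive1 f (flip4 z ord0)) (funext (fun s => congr1 (ev U1) (esym (s0 s))))) e1.
have {}e2 := etrans (congr1 (fun f => derive1 f (flip4 z i41)) (funext (fun s => congr1 (ev U2) (esym (s1 s))))) e2.
have {}e3 := etrans (congr1 (fun f => derive1 f (flip4 z i41)) (funext (fun s => congr1 (ev U1) (esym (s1 s))))) e3.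
have {}e4 := etrans (congr1 (fun f => derive1 f (flip4 z ord0)) (funext (fun s => congr1 (ev U2) (esym (s0 s))))) e4.
rewrite -eJ -e1 -e2 -e3 -e4 //.
Qed.

Lemma hs_dropv n (F : fps C n) i : hs (ev F) F -> hs (ev (dropv i F)) (dropv i F).
Proof.
move=> [r r0 [[M b] _]].
by apply: (hs_ev r0 (fun=> lexx _) (bnd_dropv i (fun=> r0) b)).
Qed.

(** [c = 1] is the invariant and [c = -1] its image under the involution: as it is affine in [h],
    only the sign of the part free of [h] changes. *)
Definition chi3 (c : C) : S3 :=
  fps_const 3 c * (1 - (fX C i31 - fX C i32) - fX C i32 * fps_const 3 th0 - fX C i31 * fps_const 3 th)
  + fps_const 3 2 * ((fX C i31 + fX C i32) * fX C ord0).
Definition chi3f (c h x e : C) : C :=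
  c * (1 - (x - (x - e)) - (x - e) * th0 - x * th) + 2 * ((x + (x - e)) * h).

Lemma hs_chi3 c :
  hs (fun y => c * (1 - (y i31 - y i32) - y i32 * th0 - y i31 * th) + 2 * ((y i31 + y i32) * y ord0))
     (chi3 c).
Proof.
rewrite /chi3; have h0 := @hsX R 3 ord0; have h1 := @hsX R 3 i31; have h2 := @hsX R 3 i32.
have c1 := hs1 R 3.
by repeat hs_step.
Qed.

Lemma fcomp_chi3 e : fcomp (chi3 e) (act (fps_const 4 e * (u1 R * u2 R))) = fps_const 4 e * chi4 th0 th.
Proof.
have nc : nocst (act (fps_const 4 e * (u1 R * u2 R))).
  by apply: nocst_act; rewrite cf_constM cf_XM0 ?mnm0E // mulr0.
have d1 : fcomp 1 (act (fps_const 4 e * (u1 R * u2 R))) = 1.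
  by have := fcompC (act (fps_const 4 e * (u1 R * u2 R))) 1; rewrite !rmorph1.
rewrite /chi3; rewrite !(d1, fcompD, fcompN, fcompM _ _ nc, fcompC, fcompX _ nc).
rewrite -[act _ ord0]/(fps_const 4 e * (u1 R * u2 R)) -[act _ i31]/(vx R) -[act _ i32]/(vt R).
rewrite (rmorph_nat (@fps_const C 4) 2) /chi4.
move: (fps_const 4 e) (fps_const 4 th0) (fps_const 4 th) (u1 R * u2 R) (vx R) (vt R) => a b c u x t.
by ring.
Qed.

(** Composition with [h = e * u1 * u2] multiplies coefficients by powers of [e], which are units, so
    the divisibility by [x * t] of [g - chi4] passes back to series in [h]. *)
Lemma derivative_congruence (Gam : S3) (g : S4) e mu xi pi : siegel_nf k th0 th mu xi pi g ->
  hs (ev Gam) Gam -> e = 1 \/ e = -1 ->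
  fcomp (fder ord0 Gam) (act (fps_const 4 e * (u1 R * u2 R))) = fps_const 4 e * g ->
  exists2 K3 : S3, hs (ev K3) K3 & fder ord0 Gam = chi3 e + fX C i31 * (fX C i32 * K3).
Proof.
move=> nf hG he E; pose D := fder ord0 Gam - chi3 e.
have nz j : cf D j <> 0 -> (0 < j i31)%N /\ (0 < j i32)%N.
  move=> nz; have := nf_chi nf (m := mn4 (j ord0) (j ord0) (j i31) (j i32)).
  rewrite /mn4 !mnFE; apply.
  have : cf (fcomp D (act (fps_const 4 e * (u1 R * u2 R)))) (mn4 (j ord0) (j ord0) (j i31) (j i32)) =
     e * cf (g - chi4 th0 th) (mn4 (j ord0) (j ord0) (j i31) (j i32)).
    by rewrite fcompD fcompN E fcomp_chi3 -mulrBr cf_constM.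
  rewrite cf_fcomp_act /mn4 !mnFE -[vec4 _ _ _ _ _]/(j ord0) eqxx.
  have -> : mn3 (vec4 (j ord0) (j ord0) (j i31) (j i32) ord0) (vec4 (j ord0) (j ord0) (j i31) (j i32) i42)
     (vec4 (j ord0) (j ord0) (j i31) (j i32) i43) = j.
    by apply/mnmP; apply: ord3P; rewrite /mn3 mnFE.
  move=> eD z; rewrite z mulr0 in eD; move/eqP: eD; rewrite mulf_eq0 => /orP[|/eqP //].
  rewrite expf_eq0 => /andP[_ /eqP e0]; case: he; rewrite e0 => /eqP.
    by rewrite eq_sym oner_eq0.
  by rewrite eq_sym oppr_eq0 oner_eq0.
have hD : hs (ev D) D.
  apply: (@hs_ev_self _ _ (fun y => ev (fder ord0 Gam) y - _)).
  by apply: hsB; [exact: hs_fder hG|exact: hs_chi3].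
exists (dropv i32 (dropv i31 D)); first by do 2 apply: hs_dropv.
rewrite dropvK; last first.
  move=> m m0; apply: contrapT => /nz[_].
  by rewrite mnmDE m0 mnm1E.
rewrite dropvK; last by move=> m m0; apply: contrapT => /nz[]; rewrite m0.
by rewrite /D addrC subrK.
Qed.

(** By uniqueness of expansions the hypotheses on the germs become identities of series in [x] and
    [t]; the comparison is then formal, and its result is read back near the origin with
    [t = x - e]. *)
Lemma normal_form_congruence G : BS_normal_form hamxe G ->
  exists2 c : C, c = 1 \/ c = -1 & cong_mod_xxe (dh G) (chi3f c).
Proof.
move=> [/analytic_hs[G0 hG0] [v1 [v2 [/analytic_hs[V1 hV1] [/analytic_hs[V2 hV2] /near0_4P/nearz_flip4 N]]]]].
have [Gam hG] := hs_flip3 hG0; have [w1 h1] := hs_flip4 hV1; have [w2 h2] := hs_flip4 hV2.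
pose g (y : 'I_3 -> C) := G (y ord0) (y i31) (y i31 - y i32).
pose f1 (y : 'I_4 -> C) := v1 (y ord0) (y i41) (y i42) (y i42 - y i43).
pose f2 (y : 'I_4 -> C) := v2 (y ord0) (y i41) (y i42) (y i42 - y i43).
have {}hG : hs g Gam := hG; have {}h1 : hs f1 w1 := h1; have {}h2 : hs f2 w2 := h2.
have NJ : nearz (fun y => derive1 (fun s => f1 (zset y ord0 s)) (y ord0) * derive1 (fun s => f2 (zset y i41 s)) (y i41)
   - derive1 (fun s => f1 (zset y i41 s)) (y i41) * derive1 (fun s => f2 (zset y ord0 s)) (y ord0) = 1).
  by apply: nearzW N => y [].
have NH : nearz (fun y => hamfun k th0 th y = G (f1 y * f2 y) (y i42) (y i42 - y i43)).
  apply: nearzW N => y [_ e]; apply: etrans e; rewrite /hamfun /hamxe.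
  by rewrite -[flip4 y i42]/(y i42) -[flip4 y i43]/(y i42 - y i43) subKC.
have d1 := nearzI (derive1_hs ord0 h1) (derive1_hs i41 h2).
have d2 := nearzI (derive1_hs i41 h1) (derive1_hs ord0 h2).
have J : Jac w1 w2 = 1.
  apply: hs_inj (hs1 R 4); apply: hs_extz (hs_Jac (hs_ev_self h1) (hs_ev_self h2)) _.
  by apply: nearzW (nearzI NJ (nearzI d1 d2)) => y [eJ [[<- <-] [<- <-]]].
have w0 : cf (w1 * w2) mnm0 = 0.
  exact: (action_vanishes h1 h2 J (G := fun h x t => G h x (x - t)) NH).
have E : fcomp Gam (act (w1 * w2)) = hamf k th0 th (u1 R) (u2 R).
  apply: hs_inj (hs_hamfun k th0 th).
  apply: hs_extz (hs_comp hG (fun i => hs_act i h1 h2) (nocst_act w0)) _.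
  by apply: nearzW NH => y ->.
have [mu _ [xi [pi [gg nf]]]] := siegel_normal_form k th0 th.
have [c hc Ec] := frequency_determined nf J w0 E.
have [K3 hK EK] := derivative_congruence nf (hs_ev_self hG) hc Ec.
exists c => //; exists (fun h x e => ev K3 (vec3 h x (x - e))); split.
  exact: hs_analytic (projT2 (cid (hs_flip3 hK))).
have hd := hsD (hs_chi3 c) (hsM (@hsX R 3 i31) (hsM (@hsX R 3 i32) hK)).
rewrite -EK in hd.
have := nearz_flip3 (nearzI (derive1_hs ord0 hG) (hs_nearz (hs_fder ord0 hG) hd)).
move=> {}N; apply/near0_3P; apply: nearzW N => z [e1 e2].
have e3 : dh G (z ord0) (z i31) (z i32) =
   derive1 (fun s => g (zset (flip3 z) ord0 s)) (flip3 z ord0).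
  by rewrite -[in LHS](subKC (z i31) (z i32)).
rewrite e3 e1 e2 /chi3f -[flip3 z ord0]/(z ord0) -[flip3 z i31]/(z i31) -[flip3 z i32]/(z i31 - z i32).
rewrite -[vec3 _ _ _]/(flip3 z); move: (ev K3 _) (z ord0) (z i31) (z i32) => a b x e.
by ring.
Qed.
End Assembly.

Theorem mainTheorem5 (R : realType) (th0 th1t thinf : Cx R) :
  is_formal_invariant
    (fun q p x e : Cx R =>
       - (((th0 + th1t) ^+ 2 - thinf ^+ 2) / 4) * ((x - e) * q - x)
       + x * th0 * p
       + (1 - e - (x - e) * th0 - x * (th0 + th1t)) * q * p
       + (2 * x - e) * (q * p) ^+ 2
       + (x - e) * (th0 + th1t) * q ^+ 2 * p
       - x * q * p ^+ 2
       - (x - e) * q ^+ 3 * p ^+ 2)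
    (fun h x e : Cx R =>
       1 - e - (x - e) * th0 - x * (th0 + th1t) + 2 * (2 * x - e) * h).
Proof.
(* The congruence holds for arbitrary [th] and [k], and [k] does not enter the invariant. *)
move: (th0 + th1t) => th; move: ((th ^+ 2 - thinf ^+ 2) / 4) => k.
set H := (X in is_formal_invariant X _); set chi := (X in is_formal_invariant _ X).
have -> : H = hamxe k th0 th.
  by do 4 apply/funext => ?; rewrite /H /hamxe /ham; ring.
split; first exact: normal_form_exists.
move=> G /normal_form_congruence[c [] ->].
  have -> : chi3f th0 th 1 = chi; last by left.
  by do 3 apply/funext => ?; rewrite /chi3f /chi; ring.
have -> : chi3f th0 th (-1) = (fun h x e => - chi (- h) x e); last by right.
by do 3 apply/funext => ?; rewrite /chi3f /chi; ring.
Qed.
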